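(* Let $\mathbb{K}$ be a field and let $(\mathfrak{U}\mathcal{G},\natural,0)$ be the pre-braided homogeneous category associated with a groupoid $(\mathcal{G},\natural,0)$ as in the context. For all functors $F:\mathfrak{U}\mathcal{G}\rightarrow\mathbb{K}\textrm{-}\mathfrak{Mod}$, the morphism $$\Psi_{F}:H_{*}\left(G_{\infty},F_{\infty}\right)\rightarrow H_{*}\left(G_{\infty}\times\mathfrak{U}\mathcal{G},\Pi^{*}F\right)$$ is an isomorphism of $\mathbb{K}$-modules. Moreover, $\Psi_{F}$ decomposes as a natural isomorphism $$H_{*}\left(G_{\infty},F_{\infty}\right)\cong\bigoplus_{k+l=*}\left(H_{k}\left(G_{\infty},\mathbb{K}\right)\otimes_{\mathbb{K}}H_{l}\left(\mathfrak{U}\mathcal{G},F\right)\right).$$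
   Context: $(\mathcal{G},\natural,0)$ is a small braided strict monoidal groupoid with objects $\underline{n}$ indexed by $n\in\mathbb{N}$ ($\underline{n}\natural\underline{m}=\underline{n+m}$, $0=\underline{0}$), with $Aut_{\mathcal{G}}(\underline{n})=G_n$ and no morphisms between distinct objects. It is assumed that $\mathcal{G}$ has no zero divisors ($A\natural B\cong0$ iff $A\cong B\cong 0$), that $Aut_{\mathcal{G}}(0)=\{id_0\}$, that $A\natural C\cong B\natural C$ implies $A\cong B$ for all objects $A,B,C$, and that $Aut(A)\to Aut(A\natural B)$, $f\mapsto f\natural id_B$, is injective for all objects $A,B$. In particular $G_n\to G_{n+1}$, $\varphi\mapsto\varphi\natural id_{\underline{1}}$, is injective. Quillen's bracket construction $\mathfrak{U}\mathcal{G}$ has the same objects as $\mathcal{G}$. A morphism $A\to B$ is an equivalence class $[X,f]$ of pairs ($X$ an object, $f:X\natural A\to B$ a morphism of $\mathcal{G}$), with $(X,f)\sim(X',f')$ iff there is an isomorphism $g:X\to X'$ in $\mathcal{G}$ with $f'\circ(g\natural id_A)=f$. Composition is $[Y,g]\circ[X,f]=[Y\natural X,g\circ(id_Y\natural f)]$, and $0$ is initial with unique morphism $\iota_A:0\to A$. With $b$ the braiding of $\mathcal{G}$, the monoidal structure on morphisms is $[X,f]\natural[Y,g]=[X\natural Y,(f\natural g)\circ(id_X\natural (b_{A,Y})^{-1}\natural id_C)]$ for $[X,f]:A\to B$, $[Y,g]:C\to D$. Since $\mathcal{G}$ is braided strict monoidal with no zero divisors, $Aut_{\mathcal{G}}(0)=\{id_0\}$,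 cancellation ($A\natural C\cong B\natural C$ implies $A\cong B$) and injectivity of the maps $Aut(A)\to Aut(A\natural B)$, $f\mapsto f\natural id_B$, the category $\mathfrak{U}\mathcal{G}$ is pre-braided (the maximal subgroupoid is braided, with $b_{A,B}\circ(id_A\natural\iota_B)=\iota_B\natural id_A$) and homogeneous (for all $A,B$: $Aut(B)$ acts transitively on $Hom(A,B)$; and $Aut(A)\to Aut(A\natural B)$, $f\mapsto f\natural id_B$, is injective with image the stabilizer of $\iota_A\natural id_B$). $G_\infty=\mathrm{Colim}_nG_n$ along the maps $G_n\to G_{n+1}$, $\varphi\mapsto\varphi\natural id_{\underline{1}}$; $F_\infty=\mathrm{Colim}_nF(\underline{n})$ along the maps $F(id_{\underline{n}}\natural\iota_{\underline{1}})$; $H_*(G_\infty,F_\infty)$ is group homology and equals $\mathrm{Colim}_nH_*(G_n,F(\underline{n}))$. For a small category $\mathfrak{C}$ and $F:\mathfrak{C}\to\mathbb{K}\textrm{-}\mathfrak{Mod}$, $H_*(\mathfrak{C},F)$ denotes the left derived functors of $\mathrm{Colim}_{\mathfrak{C}}$ at $F$; a functor $\phi:\mathfrak{D}\to\mathfrak{C}$ induces $H_*(\mathfrak{D},F\circ\phi)\to H_*(\mathfrak{C},F)$. Groups are viewed as one-object categories. $\Pi:G_\infty\times\mathfrak{U}\mathcal{G}\to\mathfrak{U}\mathcal{G}$ is the projection and $\Pi^*F=F\circ\Pi$. Let $\Psi_{F,n}:H_*(G_n,F(\underline{n}))\to H_*(G_\infty\times\mathfrak{U}\mathcal{G},\Pi^*F)$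 be induced by the functor $G_n\to G_\infty\times\mathfrak{U}\mathcal{G}$ which sends the unique object to $\underline{n}$ in the second factor and sends $g\in G_n$ to the pair (image of $g$ in $G_\infty$, $g\in Aut_{\mathfrak{U}\mathcal{G}}(\underline{n})$). The maps $\Psi_{F,n}$ are compatible with the stabilization maps, and $\Psi_F$ is the induced map on the colimit. *)

(* Defs.v *)
From HB Require Import structures.
From mathcomp Require Import finmap monalg.
From mathcomp Require Import all_boot all_algebra.
From mathcomp Require Import boolp.

Set Implicit Arguments.
Unset Strict Implicit.
Unset Printing Implicit Defensive.

Import GRing.Theory.
Local Open Scope ring_scope.
Local Open Scope quotient_scope.

Section Modules.
Variable K : fieldType.
Implicit Types U V W : lmodType K.

Definition mklin V W (f : V -> W) (fL : linear f) : {linear V -> W} :=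
  HB.pack f (GRing.isLinear.Build K V W *:%R f fL).

Definition idlin V : {linear V -> V} := mklin (fun a u v => erefl (a *: u + v)).

Lemma cmplin_subproof U V W (g : {linear V -> W}) (f : {linear U -> V}) :
  linear (fun x => g (f x)).
Proof. by move=> a x y; rewrite !linearP. Qed.

Definition cmplin U V W (g : {linear V -> W}) (f : {linear U -> V}) :
  {linear U -> W} := mklin (cmplin_subproof g f).

Lemma cmplinE U V W (g : {linear V -> W}) (f : {linear U -> V}) x :
  cmplin g f x = g (f x).
Proof. by []. Qed.

Inductive spanmod V (S : V -> Prop) : V -> Prop :=
| span0 : spanmod S 0
| span_gen v : S v -> spanmod S v
| spanP a u v : spanmod S u -> spanmod S v -> spanmod S (a *: u + v).

Section Quotient.
Variables (V : lmodType K) (S : V -> Prop).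

Definition qmod_rel (u v : V) : bool := `[< spanmod S (u - v) >].

Lemma spanZ a u : spanmod S u -> spanmod S (a *: u).
Proof. by move=> Su; rewrite -[_ *: _]addr0; apply/spanP/span0. Qed.

Lemma spanD u v : spanmod S u -> spanmod S v -> spanmod S (u + v).
Proof. by move=> Su Sv; rewrite -[u]scale1r; apply: spanP. Qed.

Lemma spanN u : spanmod S u -> spanmod S (- u).
Proof. by rewrite -scaleN1r; apply: spanZ. Qed.

Lemma qmod_equiv : equiv_class_of qmod_rel.
Proof.
split=> [u|u v|v u w].
- by apply/asboolP; rewrite subrr; apply: span0.
- by apply/asbool_equiv_eq; split=> /spanN; rewrite opprB.
- by move=> /asboolP Suv /asboolP Svw; apply/asboolP; rewrite -(subrKA v); apply: spanD.
Qed.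

Canonical qmod_equiv_rel := EquivRelPack qmod_equiv.

(* quotmod S is V / <S>, where <S> is the submodule spanned by S *)
Definition quotmod := {eq_quot qmod_equiv_rel}.
HB.instance Definition _ := Choice.on quotmod.
HB.instance Definition _ : EqQuotient V qmod_equiv_rel quotmod :=
  EqQuotient.on quotmod.

Lemma qmodP (u v : V) : reflect (u = v %[mod quotmod]) `[< spanmod S (u - v) >].
Proof. exact: (@eqquotP _ qmod_equiv_rel quotmod). Qed.

Lemma repr_qmod (u : V) : spanmod S (repr (\pi_quotmod u) - u).
Proof. by apply/asboolP/qmodP; rewrite reprK. Qed.

Definition qmod_add (x y : quotmod) : quotmod := \pi_quotmod (repr x + repr y).
Definition qmod_opp (x : quotmod) : quotmod := \pi_quotmod (- repr x).
Definition qmod_scale (a : K) (x : quotmod) : quotmod := \pi_quotmod (a *: repr x).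

Lemma qmod_addE u v :
  qmod_add (\pi_quotmod u) (\pi_quotmod v) = \pi_quotmod (u + v).
Proof.
apply/qmodP/asboolP; rewrite opprD addrACA.
by apply: spanD; apply: repr_qmod.
Qed.

Lemma qmod_oppE u : qmod_opp (\pi_quotmod u) = \pi_quotmod (- u).
Proof.
by apply/qmodP/asboolP; rewrite -opprD; apply/spanN/repr_qmod.
Qed.

Lemma qmod_scaleE a u : qmod_scale a (\pi_quotmod u) = \pi_quotmod (a *: u).
Proof.
by apply/qmodP/asboolP; rewrite -scalerBr; apply/spanZ/repr_qmod.
Qed.

Lemma qmod_ind (P : quotmod -> Prop) : (forall u, P (\pi_quotmod u)) -> forall x, P x.
Proof. by move=> Pu x; rewrite -[x]reprK; apply: Pu. Qed.

Lemma qmod_addA : associative qmod_add.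
Proof.
elim/qmod_ind=> u; elim/qmod_ind=> v; elim/qmod_ind=> w.
by rewrite !qmod_addE addrA.
Qed.

Lemma qmod_addC : commutative qmod_add.
Proof. by elim/qmod_ind=> u; elim/qmod_ind=> v; rewrite !qmod_addE addrC. Qed.

Lemma qmod_add0 : left_id (\pi_quotmod 0) qmod_add.
Proof. by elim/qmod_ind=> u; rewrite qmod_addE add0r. Qed.

Lemma qmod_addN : left_inverse (\pi_quotmod 0) qmod_opp qmod_add.
Proof. by elim/qmod_ind=> u; rewrite qmod_oppE qmod_addE addNr. Qed.

HB.instance Definition _ :=
  GRing.isZmodule.Build quotmod qmod_addA qmod_addC qmod_add0 qmod_addN.

Lemma qmod_scaleA a b x : qmod_scale a (qmod_scale b x) = qmod_scale (a * b) x.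
Proof. by elim/qmod_ind: x => u; rewrite !qmod_scaleE scalerA. Qed.

Lemma qmod_scale1 : left_id 1 qmod_scale.
Proof. by elim/qmod_ind=> u; rewrite qmod_scaleE scale1r. Qed.

Lemma qmod_scaleDr : right_distributive qmod_scale +%R.
Proof.
move=> a; elim/qmod_ind=> u; elim/qmod_ind=> v.
by rewrite [_ + _]qmod_addE !qmod_scaleE scalerDr [RHS]qmod_addE.
Qed.

Lemma qmod_scaleDl x : {morph qmod_scale^~ x : a b / a + b}.
Proof.
by move=> a b; elim/qmod_ind: x => u; rewrite !qmod_scaleE scalerDl [RHS]qmod_addE.
Qed.

HB.instance Definition _ := GRing.Zmodule_isLmodule.Build K quotmod
  qmod_scaleA qmod_scale1 qmod_scaleDr qmod_scaleDl.

Lemma qpi_linear : linear (fun u => \pi_quotmod u).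
Proof. by move=> a u v; rewrite -qmod_addE -qmod_scaleE. Qed.

Definition qpi : {linear V -> quotmod} := mklin qpi_linear.

Lemma qpiP u v : qpi u = qpi v <-> spanmod S (u - v).
Proof. by split=> [/qmodP/asboolP|/asboolP/qmodP]. Qed.

Lemma qpi0P u : qpi u = 0 <-> spanmod S u.
Proof. by rewrite -(linear0 qpi) qpiP subr0. Qed.

Lemma qpi_surj x : exists u, x = qpi u.
Proof. by exists (repr x); rewrite /= reprK. Qed.

Lemma qpi_gen v : S v -> qpi v = 0.
Proof. by move=> Sv; apply/qpi0P/span_gen. Qed.

Section Lift.
Variables (W : lmodType K) (f : {linear V -> W}) (f0 : forall v, S v -> f v = 0).

Lemma lin_span0 v : spanmod S v -> f v = 0.
Proof.
elim=> [|u /f0//|a u w _ fu _ fw]; first exact: linear0.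
by rewrite linearP fu fw scaler0 addr0.
Qed.

Lemma qlift_subE u : f (repr (qpi u)) = f u.
Proof. by apply/eqP; rewrite -subr_eq0 -linearB lin_span0//; apply: repr_qmod. Qed.

Lemma qlift_linear : linear (fun x : quotmod => f (repr x)).
Proof.
move=> a x y; have [u ->] := qpi_surj x; have [v ->] := qpi_surj y.
by rewrite -linearP !qlift_subE linearP.
Qed.

Definition qlift : {linear quotmod -> W} := mklin qlift_linear.

Lemma qliftE u : qlift (qpi u) = f u.
Proof. exact: qlift_subE. Qed.
End Lift.

Lemma qmod_ext W (f g : {linear quotmod -> W}) :
  (forall u, f (qpi u) = g (qpi u)) -> forall x, f x = g x.
Proof. by move=> fg x; have [u ->] := qpi_surj x. Qed.
End Quotient.

(* The free module K[T] on a type T *)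
Definition freemod (T : Type) : lmodType K := {malg K[{classic T}]}.
Definition gen (T : Type) (t : T) : freemod T := mkmalgU (t : {classic T}) 1.

Section FreeLift.
Variables (T : Type) (W : lmodType K) (f : T -> W).

Definition free_lift_fun (g : freemod T) : W :=
  \sum_(t <- msupp g) mcoeff t g *: f t.

Lemma free_lift_funEw (d : {fset {classic T}}) (g : freemod T) :
  {subset msupp g <= d} -> free_lift_fun g = \sum_(t <- d) mcoeff t g *: f t.
Proof.
move=> gd; rewrite /free_lift_fun.
rewrite [RHS](bigID (fun t => t \in msupp g)) /= [X in _ + X]big1 ?addr0; last first.
  by move=> t /mcoeff_outdom ->; rewrite scale0r.
rewrite -[RHS]big_filter; apply: perm_big; apply: uniq_perm.
- exact: fset_uniq.
- exact/filter_uniq/fset_uniq.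
- move=> t; rewrite mem_filter; case: (boolP (t \in msupp g)) => //= /gd.
  by move=> ->.
Qed.

Lemma free_lift_linear : linear free_lift_fun.
Proof.
move=> a g h; set d := (msupp g `|` msupp h)%fset.
have gd : {subset msupp g <= d} by move=> t; rewrite in_fsetU => ->.
have hd : {subset msupp h <= d} by move=> t; rewrite in_fsetU orbC => ->.
have ghd : {subset msupp (a *: g + h) <= d}.
  move=> t; apply: contraLR => /[dup].
  rewrite -!mcoeff_eq0 => td0.
  rewrite in_fsetU negb_or -!mcoeff_eq0 => /andP[/eqP g0 /eqP h0].
  by rewrite mcoeffD mcoeffZ g0 h0 mulr0 addr0.
rewrite (free_lift_funEw gd) (free_lift_funEw hd) (free_lift_funEw ghd).
rewrite scaler_sumr -big_split /=; apply: eq_bigr => t _.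
by rewrite mcoeffD mcoeffZ scalerDl scalerA.
Qed.

Definition free_lift : {linear freemod T -> W} := mklin free_lift_linear.

Lemma free_liftE t : free_lift (gen t) = f t.
Proof.
rewrite /= /free_lift_fun /gen msuppU oner_eq0.
by rewrite big_seq_fset1 mcoeffUU scale1r.
Qed.
End FreeLift.

Lemma free_ext T W (f g : {linear freemod T -> W}) :
  (forall t, f (gen t) = g (gen t)) -> forall x, f x = g x.
Proof.
move=> fg x; rewrite [x]monalgE !linear_sum; apply: eq_bigr => t _.
have -> : mkmalgU t (mcoeff t x) = mcoeff t x *: gen t.
  apply/malgP => s; rewrite mcoeffZ !mcoeffU.
  by case: eqP => _; rewrite ?mulr1n ?mulr0n ?mulr1 ?mulr0.
by rewrite !linearZ fg.
Qed.


Section DirectSum.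
Variables (I : Type) (M : I -> lmodType K).

Inductive dsum_rel : freemod {i & M i} -> Prop :=
| DsumRel i a (x y : M i) : dsum_rel
    (gen (existT M i (a *: x + y)) - (a *: gen (existT M i x) + gen (existT M i y))).

Definition dsum : lmodType K := quotmod dsum_rel.

Lemma dsum_in_linear i : linear (fun x : M i => qpi dsum_rel (gen (existT M i x))).
Proof. by move=> a x y; rewrite -linearP; apply/qpiP/span_gen/DsumRel. Qed.

Definition dsum_in i : {linear M i -> dsum} := mklin (@dsum_in_linear i).

Lemma dsum_ext W (f g : {linear dsum -> W}) :
  (forall i x, f (dsum_in i x) = g (dsum_in i x)) -> forall u, f u = g u.
Proof.
move=> fg; apply: qmod_ext.
apply: (free_ext (f := cmplin f (qpi _)) (g := cmplin g (qpi _))).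
by case=> i x; apply: fg.
Qed.

Variables (W : lmodType K) (f : forall i, {linear M i -> W}).

Lemma dsum_lift_subproof v : dsum_rel v ->
  free_lift (fun p : {i & M i} => f (projT1 p) (projT2 p)) v = 0.
Proof.
by case=> i a x y; rewrite linearB linearP !free_liftE /= linearP subrr.
Qed.

Definition dsum_lift : {linear dsum -> W} := qlift dsum_lift_subproof.

Lemma dsum_liftE i x : dsum_lift (dsum_in i x) = f i x.
Proof. by rewrite /dsum_lift [LHS]qliftE free_liftE. Qed.
End DirectSum.

Definition dsum_map I (M N : I -> lmodType K) (f : forall i, {linear M i -> N i}) :
  {linear dsum M -> dsum N} := dsum_lift (fun i => cmplin (dsum_in N i) (f i)).

Section Tensor.
Variables U V : lmodType K.

Inductive tensor_rel : freemod (U * V) -> Prop :=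
| TensorRelL a x x' y : tensor_rel (gen (a *: x + x', y) - (a *: gen (x, y) + gen (x', y)))
| TensorRelR a x y y' : tensor_rel (gen (x, a *: y + y') - (a *: gen (x, y) + gen (x, y'))).

Definition tensor : lmodType K := quotmod tensor_rel.

Definition tens (x : U) (y : V) : tensor := qpi tensor_rel (gen (x, y)).

Lemma tensPl a x x' y : tens (a *: x + x') y = a *: tens x y + tens x' y.
Proof. by rewrite /tens -linearP; apply/qpiP/span_gen/TensorRelL. Qed.

Lemma tensPr a x y y' : tens x (a *: y + y') = a *: tens x y + tens x y'.
Proof. by rewrite /tens -linearP; apply/qpiP/span_gen/TensorRelR. Qed.
End Tensor.

Section TensorMap.
Variables (U V U' V' : lmodType K) (f : {linear U -> U'}) (g : {linear V -> V'}).

Lemma tensor_map_subproof v : tensor_rel v ->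
  free_lift (fun p : U * V => tens (f p.1) (g p.2)) v = 0.
Proof.
by case=> a *; rewrite linearB linearP !free_liftE /= linearP (tensPl, tensPr) subrr.
Qed.

Definition tensor_map : {linear tensor U V -> tensor U' V'} :=
  qlift tensor_map_subproof.

Lemma tensor_mapE x y : tensor_map (tens x y) = tens (f x) (g y).
Proof. by rewrite /tensor_map [LHS]qliftE free_liftE. Qed.
End TensorMap.

Section Kernel.
Variables (V W : lmodType K) (f : {linear V -> W}).

Definition ker_pred : pred V := fun x => f x == 0.

Lemma ker_submod : submod_closed ker_pred.
Proof.
split=> [|a u v]; rewrite /ker_pred !unfold_in ?linear0 ?eqxx// => /eqP fu /eqP fv.
by rewrite linearP fu fv scaler0 addr0.
Qed.
HB.instance Definition _ := GRing.isSubmodClosed.Build K V ker_pred ker_submod.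

Record kernel := Kernel { kernel_val :> V; kernelP : kernel_val \in ker_pred }.
HB.instance Definition _ := [isSub for kernel_val].
HB.instance Definition _ := [Choice of kernel by <:].
HB.instance Definition _ := [SubChoice_isSubLmodule of kernel by <:].

Lemma ker_in_linear : linear (fun x : kernel => x : V).
Proof. by []. Qed.

Definition ker_in : {linear kernel -> V} := mklin ker_in_linear.

Lemma ker_inP x : f (ker_in x) = 0.
Proof. by case: x => x /= /eqP. Qed.

Section Lift.
Variables (U : lmodType K) (g : {linear U -> V}) (fg : forall u, f (g u) = 0).

Definition ker_lift_fun (u : U) : kernel := @Kernel (g u) (introT eqP (fg u)).

Lemma ker_lift_linear : linear ker_lift_fun.
Proof. by move=> a u v; apply/val_inj; rewrite /= linearP. Qed.

Definition ker_lift : {linear U -> kernel} := mklin ker_lift_linear.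
End Lift.
End Kernel.

(* homology at B of A --d'--> B --d--> C, that is ker d / im d' *)
Section Homology.
Variables (A B C : lmodType K) (d' : {linear A -> B}) (d : {linear B -> C}).

Definition homology : lmodType K :=
  quotmod (fun z : kernel d => exists a : A, d' a = ker_in d z).
End Homology.

Section HomologyMap.
Variables (A B C : lmodType K) (d' : {linear A -> B}) (d : {linear B -> C}).
Variables (A' B' C' : lmodType K) (e' : {linear A' -> B'}) (e : {linear B' -> C'}).
Variables (fA : {linear A -> A'}) (fB : {linear B -> B'}) (fC : {linear C -> C'}).
Hypothesis fd' : forall a, fB (d' a) = e' (fA a).
Hypothesis fd : forall b, fC (d b) = e (fB b).

Lemma homology_map_subproof1 (z : kernel d) : e (cmplin fB (ker_in d) z) = 0.
Proof. by rewrite /= -fd -/(ker_in d z) ker_inP linear0. Qed.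

Lemma homology_map_subproof2 (z : kernel d) : (exists a, d' a = ker_in d z) ->
  cmplin (qpi (fun w : kernel e => exists a, e' a = ker_in e w))
         (ker_lift homology_map_subproof1) z = 0.
Proof.
by move=> [a az]; apply: qpi_gen; exists (fA a); rewrite -fd' /= az.
Qed.

Definition homology_map : {linear homology d' d -> homology e' e} :=
  qlift homology_map_subproof2.
End HomologyMap.

End Modules.

Record category (O : Type) := Category {
  mor : O -> O -> Type;
  idm : forall a, mor a a;
  cmp : forall a b c, mor b c -> mor a b -> mor a c;
  cmp1m : forall a b (f : mor a b), cmp (idm b) f = f;
  cmpm1 : forall a b (f : mor a b), cmp f (idm a) = f;
  cmpA : forall a b c d (h : mor c d) (g : mor b c) (f : mor a b),
    cmp h (cmp g f) = cmp (cmp h g) f }.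

Arguments idm {O} _ a.
Arguments cmp {O} _ {a b c} g f.

Record functor (O O' : Type) (C : category O) (D : category O') := Functor {
  fobj :> O -> O';
  fmap : forall a b, mor C a b -> mor D (fobj a) (fobj b);
  fmap1 : forall a, fmap (idm C a) = idm D (fobj a);
  fmapM : forall a b c (g : mor C b c) (f : mor C a b),
    fmap (cmp C g f) = cmp D (fmap g) (fmap f) }.

Definition functor_id O (C : category O) : functor C C :=
  @Functor O O C C id (fun _ _ f => f) (fun=> erefl) (fun _ _ _ _ _ => erefl).

Definition cat_prod O O' (C : category O) (D : category O') : category (O * O').
Proof.
refine (@Category (O * O') (fun p q => mor C p.1 q.1 * mor D p.2 q.2)%type
  (fun p => (idm C p.1, idm D p.2))
  (fun p q r g f => (cmp C g.1 f.1, cmp D g.2 f.2)) _ _ _).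
- by move=> p q [f f'] /=; rewrite !cmp1m.
- by move=> p q [f f'] /=; rewrite !cmpm1.
- by move=> p q r s h g f /=; rewrite !cmpA.
Defined.

Definition proj2_functor O O' (C : category O) (D : category O') :
  functor (cat_prod C D) D :=
  @Functor _ _ (cat_prod C D) D snd (fun _ _ f => f.2) (fun=> erefl)
    (fun _ _ _ _ _ => erefl).

Definition group_cat (G : groupType) : category unit :=
  @Category unit (fun _ _ => G) (fun _ => 1%g) (fun _ _ _ g f => (g * f)%g)
    (fun _ _ f => mul1g f) (fun _ _ f => mulg1 f)
    (fun _ _ _ _ h g f => mulgA h g f).

Section FunctorHomology.
Variable K : fieldType.

Record kfun (O : Type) (C : category O) := KFun {
  ko :> O -> lmodType K;
  km : forall a b, mor C a b -> {linear ko a -> ko b};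
  km1 : forall a x, km (idm C a) x = x;
  kmM : forall a b c (g : mor C b c) (f : mor C a b) x,
    km (cmp C g f) x = km g (km f x) }.

Definition kpull O O' (C : category O) (D : category O') (phi : functor C D)
  (F : kfun D) : kfun C.
Proof.
refine (@KFun O C (fun a => F (phi a)) (fun a b f => km F (fmap phi f)) _ _).
- by move=> a x; rewrite fmap1 km1.
- by move=> a b c g f x; rewrite fmapM kmM.
Defined.

Definition kconst O (C : category O) (M : lmodType K) : kfun C :=
  @KFun O C (fun=> M) (fun _ _ _ => idlin M) (fun _ _ => erefl)
    (fun _ _ _ _ _ _ => erefl).

(* A morphism of pairs (C, F) -> (D, G) over phi : C -> D is a natural
   transformation F -> G o phi; over phi = functor_id C, these are the natural
   transformations F -> G. *)
Record kmor O O' (C : category O) (D : category O') (phi : functor C D)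
    (F : kfun C) (G : kfun D) := KMor {
  ka :> forall a, {linear F a -> G (phi a)};
  kaN : forall a b (f : mor C a b) x, ka b (km F f x) = km G (fmap phi f) (ka a x) }.

Definition knat O (C : category O) (F G : kfun C) := kmor (functor_id C) F G.

Definition kpull_mor O O' (C : category O) (D : category O') (phi : functor C D)
  (F : kfun D) : kmor phi (kpull phi F) F :=
  @KMor _ _ _ _ phi (kpull phi F) F (fun a => idlin (F (phi a)))
    (fun _ _ _ _ => erefl).

Definition kpull_nat O O' (C : category O) (D : category O') (phi : functor C D)
  (F G : kfun D) (t : knat F G) : knat (kpull phi F) (kpull phi G) :=
  @KMor _ _ _ _ (functor_id C) (kpull phi F) (kpull phi G)
    (fun a => t (phi a)) (fun a b f x => kaN t (fmap phi f) x).

Section Colimit.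
Variables (O : Type) (C : category O) (F : kfun C).

Inductive colim_rel : dsum F -> Prop :=
| ColimRel a b (f : mor C a b) x :
    colim_rel (dsum_in F b (km F f x) - dsum_in F a x).

Definition colim : lmodType K := quotmod colim_rel.

Definition colim_in a : {linear F a -> colim} :=
  cmplin (qpi colim_rel) (dsum_in F a).

Lemma colim_inE a b (f : mor C a b) x : colim_in b (km F f x) = colim_in a x.
Proof. by apply/qpiP/span_gen/ColimRel. Qed.

Lemma colim_ext (W : lmodType K) (f g : {linear colim -> W}) :
  (forall a x, f (colim_in a x) = g (colim_in a x)) -> forall u, f u = g u.
Proof.
move=> fg; apply: qmod_ext.
apply: (dsum_ext (f := cmplin f (qpi _)) (g := cmplin g (qpi _))).
exact: fg.
Qed.

Section Lift.
Variables (W : lmodType K) (h : forall a, {linear F a -> W}).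
Hypothesis hN : forall a b (f : mor C a b) x, h b (km F f x) = h a x.

Lemma colim_lift_subproof v : colim_rel v -> dsum_lift h v = 0.
Proof. by case=> a b f x; rewrite linearB !dsum_liftE hN subrr. Qed.

Definition colim_lift : {linear colim -> W} := qlift colim_lift_subproof.

Lemma colim_liftE a x : colim_lift (colim_in a x) = h a x.
Proof. by rewrite /colim_lift [LHS]qliftE dsum_liftE. Qed.
End Lift.
End Colimit.

Section ColimitMap.
Variables (O O' : Type) (C : category O) (D : category O') (phi : functor C D).
Variables (F : kfun C) (G : kfun D) (t : kmor phi F G).

Lemma colim_map_subproof a b (f : mor C a b) x :
  cmplin (colim_in G (phi b)) (t b) (km F f x) =
  cmplin (colim_in G (phi a)) (t a) x.
Proof. by rewrite [LHS]/= kaN; apply: colim_inE. Qed.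

Definition colim_map : {linear colim F -> colim G} := colim_lift colim_map_subproof.

Lemma colim_mapE a x : colim_map (colim_in F a x) = colim_in G (phi a) (t a x).
Proof. exact: colim_liftE. Qed.
End ColimitMap.

(* The free cover of F, namely the sum over all a and x in F(a) of the projective
   functors K[Hom(a, -)], with its augmentation eps to F and the kernel omega of eps. *)
Section Cover.
Variables (O : Type) (C : category O) (F : kfun C).

Definition cover_gen (c : O) := {a : O & (F a * mor C a c)%type}.

Definition cover_elt c a (x : F a) (f : mor C a c) : cover_gen c := existT _ a (x, f).

Definition cover_km c c' (h : mor C c c') :
  {linear freemod K (cover_gen c) -> freemod K (cover_gen c')} :=
  free_lift (fun p : cover_gen c =>
    gen K (cover_elt (projT2 p).1 (cmp C h (projT2 p).2))).

Lemma cover_kmE c c' (h : mor C c c') a (x : F a) (f : mor C a c) :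
  cover_km h (gen K (cover_elt x f)) = gen K (cover_elt x (cmp C h f)).
Proof. by rewrite /cover_km free_liftE. Qed.

Lemma cover_km1 c x : cover_km (idm C c) x = x.
Proof.
apply: (free_ext (g := idlin _)) => -[a [y f]].
by rewrite cover_kmE cmp1m.
Qed.

Lemma cover_kmM c c' c'' (h : mor C c' c'') (g : mor C c c') x :
  cover_km (cmp C h g) x = cover_km h (cover_km g x).
Proof.
apply: (free_ext (g := cmplin (cover_km h) (cover_km g))) => -[a [y f]].
by rewrite !cmplinE !cover_kmE cmpA.
Qed.

Definition cover : kfun C := KFun cover_km1 cover_kmM.

Definition eps_fun c : {linear cover c -> F c} :=
  free_lift (fun p : cover_gen c => km F (projT2 p).2 (projT2 p).1).

Lemma eps_funE c a (x : F a) (f : mor C a c) :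
  eps_fun c (gen K (cover_elt x f)) = km F f x.
Proof. by rewrite /eps_fun free_liftE. Qed.

Lemma epsN a b (f : mor C a b) x : eps_fun b (km cover f x) = km F f (eps_fun a x).
Proof.
apply: (free_ext (f := cmplin (eps_fun b) (km cover f))
                 (g := cmplin (km F f) (eps_fun a))) => -[c [y g]].
by rewrite !cmplinE cover_kmE !eps_funE kmM.
Qed.

Lemma eps_surj c (y : F c) : exists x, eps_fun c x = y.
Proof. by exists (gen K (cover_elt y (idm C c))); rewrite eps_funE km1. Qed.

Definition eps : knat cover F := @KMor _ _ _ _ (functor_id C) cover F eps_fun epsN.

Lemma omega_subproof a b (f : mor C a b) (x : kernel (eps a)) :
  eps b (cmplin (km cover f) (ker_in (eps a)) x) = 0.
Proof. by rewrite [LHS]epsN ker_inP linear0. Qed.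

Definition omega : kfun C.
Proof.
refine (@KFun O C (fun a => kernel (eps a))
  (fun a b f => ker_lift (@omega_subproof a b f)) _ _).
- by move=> a x; apply/val_inj; apply: cover_km1.
- by move=> a b c g f x; apply/val_inj; apply: cover_kmM.
Defined.

Definition omega_in : knat omega cover :=
  @KMor _ _ _ _ (functor_id C) omega cover (fun a => ker_in (eps a))
    (fun _ _ _ _ => erefl).
End Cover.

Section CoverMap.
Variables (O O' : Type) (C : category O) (D : category O') (phi : functor C D).
Variables (F : kfun C) (G : kfun D) (t : kmor phi F G).

Definition cover_map_fun c : {linear cover F c -> cover G (phi c)} :=
  free_lift (fun p : cover_gen F c =>
    gen K (cover_elt (t _ (projT2 p).1) (fmap phi (projT2 p).2))).

Lemma cover_map_funE c a (x : F a) (f : mor C a c) :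
  cover_map_fun c (gen K (cover_elt x f)) = gen K (cover_elt (t a x) (fmap phi f)).
Proof. by rewrite /cover_map_fun free_liftE. Qed.

Lemma cover_mapN a b (f : mor C a b) x :
  cover_map_fun b (km (cover F) f x) = km (cover G) (fmap phi f) (cover_map_fun a x).
Proof.
apply: (free_ext (f := cmplin (cover_map_fun b) (km (cover F) f))
  (g := cmplin (km (cover G) (fmap phi f)) (cover_map_fun a))) => -[c [y g]].
by rewrite !cmplinE cover_kmE !cover_map_funE fmapM cover_kmE.
Qed.

Definition cover_map : kmor phi (cover F) (cover G) := KMor cover_mapN.

Lemma eps_cover_map c x : eps G (phi c) (cover_map c x) = t c (eps F c x).
Proof.
apply: (free_ext (f := cmplin (eps G (phi c)) (cover_map c))
  (g := cmplin (t c) (eps F c))) => -[a [y g]].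
by rewrite !cmplinE cover_map_funE !eps_funE kaN.
Qed.

Lemma omega_map_subproof c (x : kernel (eps F c)) :
  eps G (phi c) (cmplin (cover_map c) (ker_in (eps F c)) x) = 0.
Proof. by rewrite [LHS]eps_cover_map ker_inP linear0. Qed.

Definition omega_map_fun c : {linear omega F c -> omega G (phi c)} :=
  ker_lift (@omega_map_subproof c).

Lemma omega_mapN a b (f : mor C a b) x :
  omega_map_fun b (km (omega F) f x) = km (omega G) (fmap phi f) (omega_map_fun a x).
Proof. by apply/val_inj; apply: cover_mapN. Qed.

Definition omega_map : kmor phi (omega F) (omega G) := KMor omega_mapN.
End CoverMap.

(* The projective resolution ... -> res F 1 -> res F 0 -> F obtained by iterating
   free covers of syzygies. *)
Section Resolution.
Variables (O : Type) (C : category O) (F : kfun C).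

Fixpoint syz (n : nat) : kfun C := if n is m.+1 then omega (syz m) else F.

Definition res (n : nat) : kfun C := cover (syz n).

Definition res_d_fun n c : {linear res n.+1 c -> res n c} :=
  cmplin (omega_in (syz n) c) (eps (syz n.+1) c).

Lemma res_dN n a b (f : mor C a b) x :
  res_d_fun n b (km (res n.+1) f x) = km (res n) f (res_d_fun n a x).
Proof. by rewrite /res_d_fun cmplinE (kaN (eps (syz n.+1))). Qed.

Definition res_d n : knat (res n.+1) (res n) :=
  @KMor _ _ _ _ (functor_id C) (res n.+1) (res n) (res_d_fun n) (@res_dN n).

Lemma res_exact0 c (x : res 0 c) : eps F c x = 0 <-> exists y, res_d 0 c y = x.
Proof.
split=> [x0|[y <-]]; last exact: (ker_inP (eps (omega F) c y)).
have [y yx] := eps_surj (Kernel (introT eqP x0) : omega F c).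
by exists y; apply: (congr1 (fun z => ker_in _ z) yx).
Qed.

Lemma res_exact n c (x : res n.+1 c) :
  res_d n c x = 0 <-> exists y, res_d n.+1 c y = x.
Proof.
have -> : res_d n c x = 0 <-> eps (syz n.+1) c x = 0.
  split=> [x0|x0]; first exact: val_inj.
  exact: (congr1 (fun z => ker_in _ z) x0).
split=> [x0|[y <-]]; last exact: (ker_inP (eps (syz n.+2) c y)).
have [y yx] := eps_surj (Kernel (introT eqP x0) : omega (syz n.+1) c).
by exists y; apply: (congr1 (fun z => ker_in _ z) yx).
Qed.
End Resolution.

Definition projective O (C : category O) (P : kfun C) :=
  forall (A B : kfun C) (p : knat A B) (f : knat P B),
    (forall c y, exists x, p c x = y) ->
    exists g : knat P A, forall c x, p c (g c x) = f c x.

Lemma cover_projective O (C : category O) (F : kfun C) : projective (cover F).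
Proof.
move=> A B p f p_surj.
have [s sP] : exists s : forall ax : {a : O & F a}, A (projT1 ax),
    forall ax, p _ (s ax) =
      f _ (gen K (cover_elt (projT2 ax) (idm C (projT1 ax)))).
  exists (fun ax => sval (cid (p_surj _ (f _ (gen K (cover_elt (projT2 ax) (idm C _))))))).
  by move=> ax; case: cid.
pose g c : {linear cover F c -> A c} := free_lift (fun q : cover_gen F c =>
  km A (projT2 q).2 (s (existT _ (projT1 q) (projT2 q).1))).
have gE c a (x : F a) (h : mor C a c) :
  g c (gen K (cover_elt x h)) = km A h (s (existT _ a x)).
  by rewrite /g free_liftE.
have gN a b (h : mor C a b) x : g b (km (cover F) h x) = km A h (g a x).
  apply: (free_ext (f := cmplin (g b) (km (cover F) h))
                   (g := cmplin (km A h) (g a))) => -[c [y k]].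
  by rewrite !cmplinE cover_kmE !gE kmM.
exists (@KMor _ _ _ _ (functor_id C) (cover F) A g gN) => c.
apply: (free_ext (f := cmplin (p c) (g c))) => -[a [y h]].
rewrite cmplinE gE kaN [p _ _](sP (existT _ a y)) -kaN cover_kmE.
by rewrite cmpm1.
Qed.

Section Homology.
Variables (O : Type) (C : category O) (F : kfun C).

Definition chain (n : nat) : lmodType K := colim (res F n).

Definition zerolin (V W : lmodType K) : {linear V -> W} := \0.

Definition bdry (n : nat) : {linear chain n -> chain n.-1} :=
  match n with
  | 0 => zerolin (chain 0) (chain 0)
  | m.+1 => colim_map (res_d F m)
  end.

(* H_n(C, F), the n-th left derived functor of the colimit over C at F *)
Definition cat_homology (n : nat) : lmodType K := homology (bdry n.+1) (bdry n).
End Homology.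

Section HomologyInduced.
Variables (O O' : Type) (C : category O) (D : category O') (phi : functor C D).
Variables (F : kfun C) (G : kfun D) (t : kmor phi F G).

Fixpoint syz_map (n : nat) : kmor phi (syz F n) (syz G n) :=
  match n with 0 => t | m.+1 => omega_map (syz_map m) end.

(* A lift of t : F -> G o phi to the resolutions *)
Definition res_map (n : nat) : kmor phi (res F n) (res G n) := cover_map (syz_map n).

Lemma res_mapN n c x : res_map n c (res_d F n c x) = res_d G n (phi c) (res_map n.+1 c x).
Proof.
symmetry.
exact: (congr1 (fun z => ker_in (eps (syz G n) (phi c)) z)
  (eps_cover_map (syz_map n.+1) x)).
Qed.

Definition chain_map (n : nat) : {linear chain F n -> chain G n} :=
  colim_map (res_map n).

Lemma chain_mapN n x : chain_map n.-1 (bdry F n x) = bdry G n (chain_map n x).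
Proof.
case: n x => [|n] x; first exact: linear0.
apply: (colim_ext (f := cmplin (chain_map n) (bdry F n.+1))
                  (g := cmplin (bdry G n.+1) (chain_map n.+1))) => a {}x.
by rewrite !cmplinE /bdry !colim_mapE -res_mapN.
Qed.

Definition cat_homology_map (n : nat) :
  {linear cat_homology F n -> cat_homology G n} :=
  homology_map (@chain_mapN n.+1) (@chain_mapN n).
End HomologyInduced.
End FunctorHomology.

(* The identity of a, seen as a morphism a -> b; it plays the role of the
   coherence isomorphisms of a strict monoidal structure. *)
Definition eqhom O (C : category O) (a b : O) (e : a = b) : mor C a b :=
  match e in _ = y return mor C a y with erefl => idm C a end.

Section Eqhom.
Variables (O : Type) (C : category O).

Lemma eqhom_irr a b (e e' : a = b) : eqhom C e = eqhom C e'.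
Proof. by congr eqhom; apply: Prop_irrelevance. Qed.

Lemma eqhom_id a (e : a = a) : eqhom C e = idm C a.
Proof. by rewrite (Prop_irrelevance e erefl). Qed.

Lemma eqhom_cmp a b c (e : a = b) (e' : b = c) :
  cmp C (eqhom C e') (eqhom C e) = eqhom C (etrans e e').
Proof. by case: c / e'; case: b / e; rewrite cmp1m. Qed.
End Eqhom.

(* Braided strict monoidal groupoids with set of objects O, tensor product T on
   objects and unit object I *)
Record bsm_groupoid (O : Type) (T : O -> O -> O) (I : O) := BsmGroupoid {
  gcat :> category O;
  ginv : forall a b, mor gcat a b -> mor gcat b a;
  ginvl : forall a b (f : mor gcat a b), cmp gcat (ginv f) f = idm gcat a;
  ginvr : forall a b (f : mor gcat a b), cmp gcat f (ginv f) = idm gcat b;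
  otA : forall a b c, T a (T b c) = T (T a b) c;
  ot1l : forall a, T I a = a;
  ot1r : forall a, T a I = a;
  mt : forall a a' b b', mor gcat a a' -> mor gcat b b' -> mor gcat (T a b) (T a' b');
  mt1 : forall a b, mt (idm gcat a) (idm gcat b) = idm gcat (T a b);
  mtM : forall a a' a'' b b' b'' (f' : mor gcat a' a'') (f : mor gcat a a')
    (g' : mor gcat b' b'') (g : mor gcat b b'),
    mt (cmp gcat f' f) (cmp gcat g' g) = cmp gcat (mt f' g') (mt f g);
  mtA : forall a a' b b' c c' (f : mor gcat a a') (g : mor gcat b b') (h : mor gcat c c'),
    cmp gcat (eqhom gcat (otA a' b' c')) (mt f (mt g h)) =
    cmp gcat (mt (mt f g) h) (eqhom gcat (otA a b c));
  mt1l : forall a a' (f : mor gcat a a'),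
    cmp gcat (eqhom gcat (ot1l a')) (mt (idm gcat I) f) =
    cmp gcat f (eqhom gcat (ot1l a));
  mt1r : forall a a' (f : mor gcat a a'),
    cmp gcat (eqhom gcat (ot1r a')) (mt f (idm gcat I)) =
    cmp gcat f (eqhom gcat (ot1r a));
  braid : forall a b, mor gcat (T a b) (T b a);
  braidN : forall a a' b b' (f : mor gcat a a') (g : mor gcat b b'),
    cmp gcat (braid a' b') (mt f g) = cmp gcat (mt g f) (braid a b);
  braid_hexl : forall a b c,
    braid a (T b c) =
    cmp gcat (eqhom gcat (otA b c a))
   (cmp gcat (mt (idm gcat b) (braid a c))
   (cmp gcat (eqhom gcat (esym (otA b a c)))
   (cmp gcat (mt (braid a b) (idm gcat c))
             (eqhom gcat (otA a b c)))));
  braid_hexr : forall a b c,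
    braid (T a b) c =
    cmp gcat (eqhom gcat (esym (otA c a b)))
   (cmp gcat (mt (braid a c) (idm gcat b))
   (cmp gcat (eqhom gcat (otA a c b))
   (cmp gcat (mt (idm gcat a) (braid b c))
             (eqhom gcat (esym (otA a b c)))))) }.

Arguments ginv {O T I _ a b} _.
Arguments otA {O T I} _ a b c.
Arguments ot1l {O T I} _ a.
Arguments ot1r {O T I} _ a.
Arguments mt {O T I} _ {a a' b b'} _ _.
Arguments braid {O T I} _ a b.

Section Quillen.
Variables (O : Type) (T : O -> O -> O) (I : O) (G : bsm_groupoid T I).

Local Notation "g \c f" := (cmp G g f) (at level 40, left associativity).
Local Notation id_ := (idm G).
Local Notation "f \t g" := (mt G f g) (at level 39, left associativity).
Local Notation eqh := (eqhom G).

Lemma mt_eqhom a a' b b' (e : a = a') (e' : b = b') :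
  eqh e \t eqh e' = eqh (f_equal2 T e e').
Proof. by case: a' / e; case: b' / e'; rewrite /= mt1 eqhom_id. Qed.

Lemma mtA' a a' b b' c c' (f : mor G a a') (g : mor G b b') (h : mor G c c') :
  eqh (esym (otA G a' b' c')) \c (f \t g \t h) =
  f \t (g \t h) \c eqh (esym (otA G a b c)).
Proof.
rewrite -[LHS]cmpm1 -(eqhom_id G (etrans (esym (otA G a b c)) (otA G a b c))).
rewrite -eqhom_cmp -[LHS]cmpA [X in _ \c X]cmpA -mtA !cmpA eqhom_cmp.
by rewrite eqhom_id cmp1m.
Qed.

Lemma mtMr a b b' b'' (v : mor G b' b'') (u : mor G b b') :
  id_ a \t (v \c u) = (id_ a \t v) \c (id_ a \t u).
Proof. by rewrite -mtM cmp1m. Qed.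

Lemma ginv_natural a b c d (u : mor G a b) (v : mor G c d) (f : mor G a c) (g : mor G b d) :
  v \c f = g \c u -> ginv v \c g = f \c ginv u.
Proof.
move=> E; rewrite -[LHS]cmpm1 -(ginvr u) [LHS]cmpA -[X in X \c _]cmpA -E.
by rewrite !cmpA ginvl cmp1m.
Qed.

Definition qpair (A B : O) := {classic {X : O & mor G (T X A) B}}.

Definition Qpair A B X (f : mor G (T X A) B) : qpair A B :=
  existT (fun X => mor G (T X A) B) X f.

Definition qpair_eq A B (p q : qpair A B) : Prop :=
  exists g : mor G (projT1 p) (projT1 q), projT2 q \c (g \t id_ A) = projT2 p.

Lemma qpair_equiv A B : equiv_class_of (fun p q : qpair A B => `[< qpair_eq p q >]).
Proof.
split=> [p|p q|q p r].
- by apply/asboolP; exists (id_ _); rewrite mt1 cmpm1.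
- have sym (u v : qpair A B) : qpair_eq u v -> qpair_eq v u.
    move=> [g gE]; exists (ginv g).
    by rewrite -gE -cmpA -mtM cmp1m ginvr mt1 cmpm1.
  by apply/asbool_equiv_eq; split; apply: sym.
- move=> /asboolP[g gE] /asboolP[h hE]; apply/asboolP; exists (h \c g).
  by rewrite -gE -hE -cmpA -mtM cmp1m.
Qed.

Canonical qpair_equiv_rel A B := EquivRelPack (@qpair_equiv A B).

Definition qhom (A B : O) : Type := {eq_quot @qpair_equiv_rel A B}.

Definition qcl A B X (f : mor G (T X A) B) : qhom A B :=
  \pi_({eq_quot @qpair_equiv_rel A B}) (Qpair f).

Lemma qclP A B X (f : mor G (T X A) B) X' (f' : mor G (T X' A) B) :
  qcl f = qcl f' <-> exists g : mor G X X', f' \c (g \t id_ A) = f.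
Proof. by split=> [/eqmodP/asboolP|H]; last apply/eqmodP/asboolP. Qed.

Lemma qcl_ind A B (P : qhom A B -> Prop) :
  (forall X (f : mor G (T X A) B), P (qcl f)) -> forall u, P u.
Proof.
move=> Pcl u; rewrite -[u]reprK; case: (repr u) => X f; exact: Pcl.
Qed.

Lemma qcl_repr A B X (f : mor G (T X A) B) (p := repr (qcl f)) :
  exists g : mor G (projT1 p) X, f \c (g \t id_ A) = projT2 p.
Proof.
apply/qclP; rewrite -[RHS]reprK -/p; by case: (p).
Qed.

Definition qid A : qhom A A := qcl (eqh (ot1l G A)).

Definition qcmp_raw A B C (q : qpair B C) (p : qpair A B) : qhom A C :=
  qcl (projT2 q \c (id_ (projT1 q) \t projT2 p) \c
       eqh (esym (otA G (projT1 q) (projT1 p) A))).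

Definition qcmp A B C (v : qhom B C) (u : qhom A B) : qhom A C :=
  qcmp_raw (repr v) (repr u).

Lemma qcmpE A B C Y (g : mor G (T Y B) C) X (f : mor G (T X A) B) :
  qcmp (qcl g) (qcl f) = qcl (g \c (id_ Y \t f) \c eqh (esym (otA G Y X A))).
Proof.
rewrite /qcmp /qcmp_raw.
have [k <-] := qcl_repr g; have [l <-] := qcl_repr f.
apply/qclP; exists (k \t l).
rewrite -[LHS]cmpA mtA' !cmpA; congr (_ \c _).
by rewrite -!cmpA -!mtM !cmp1m cmpm1.
Qed.

Lemma qcmp1m A B (u : qhom A B) : qcmp (qid B) u = u.
Proof.
elim/qcl_ind: u => X f; rewrite qcmpE.
apply/qclP; exists (eqh (ot1l G X)); rewrite mt1l -cmpA; congr (_ \c _).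
by rewrite -(eqhom_id G erefl) mt_eqhom eqhom_cmp; apply: eqhom_irr.
Qed.

Lemma qcmpm1 A B (u : qhom A B) : qcmp u (qid A) = u.
Proof.
elim/qcl_ind: u => X f; rewrite qcmpE.
apply/qclP; exists (eqh (ot1r G X)); rewrite -cmpA; congr (_ \c _).
by rewrite -!(eqhom_id G erefl) !mt_eqhom eqhom_cmp; apply: eqhom_irr.
Qed.

Lemma qcmpA A B C D (w : qhom C D) (v : qhom B C) (u : qhom A B) :
  qcmp w (qcmp v u) = qcmp (qcmp w v) u.
Proof.
elim/qcl_ind: u => X f; elim/qcl_ind: v => Y g; elim/qcl_ind: w => Z h.
rewrite !qcmpE; apply/qclP; exists (eqh (otA G Z Y X)).
rewrite !mtMr -!cmpA; congr (_ \c (_ \c _)).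
rewrite -(eqhom_id G (erefl Z)) -(eqhom_id G (erefl A)) !mt_eqhom !eqhom_cmp.
rewrite -(mt1 G Z Y) [LHS]cmpA mtA' -[LHS]cmpA eqhom_cmp; congr (_ \c _).
exact: eqhom_irr.
Qed.

Definition quillen : category O := Category qcmp1m qcmpm1 qcmpA.

Definition qemb_fun A B (f : mor G A B) : mor quillen A B := qcl (f \c eqh (ot1l G A)).

Lemma qcl_embl A B C (h : mor G B C) X (f : mor G (T X A) B) :
  cmp quillen (qemb_fun h) (qcl f) = qcl (h \c f).
Proof.
rewrite [LHS]qcmpE; apply/qclP; exists (eqh (ot1l G X)).
rewrite -!cmpA; congr (_ \c _).
rewrite [RHS]cmpA mt1l -cmpA; congr (_ \c _).
by rewrite -(eqhom_id G erefl) mt_eqhom eqhom_cmp; apply: eqhom_irr.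
Qed.

Lemma qcl_embr A B C (h : mor G A B) X (f : mor G (T X B) C) :
  cmp quillen (qcl f) (qemb_fun h) = qcl (f \c (id_ X \t h)).
Proof.
rewrite [LHS]qcmpE; apply/qclP; exists (eqh (ot1r G X)).
rewrite mtMr -!cmpA; congr (_ \c (_ \c _)).
rewrite -(eqhom_id G (erefl X)) -(eqhom_id G (erefl A)) !mt_eqhom eqhom_cmp.
exact: eqhom_irr.
Qed.

Lemma qemb1 A : qemb_fun (id_ A) = idm quillen A.
Proof. by rewrite /qemb_fun cmp1m. Qed.

Lemma qembM A B C (g : mor G B C) (f : mor G A B) :
  qemb_fun (g \c f) = cmp quillen (qemb_fun g) (qemb_fun f).
Proof. by rewrite qcl_embl /qemb_fun cmpA. Qed.

(* G -> UG, f |-> [I, f] *)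
Definition qemb : functor G quillen := Functor qemb1 qembM.

Definition qiota A : mor quillen I A := qcl (eqh (ot1r G A)).

Lemma qtensor_dom X Y A C : T (T X Y) (T A C) = T (T X (T Y A)) C.
Proof. by rewrite (otA G _ A C) -(otA G X Y A). Qed.

Lemma qtensor_cod X Y A C : T (T X (T A Y)) C = T (T X A) (T Y C).
Proof. by rewrite (otA G X A Y) -(otA G _ Y C). Qed.

Definition qtensor_raw A B C D (p : qpair A B) (q : qpair C D) :
    mor quillen (T A C) (T B D) :=
  let: existT X f := p in let: existT Y g := q in
  qcl ((f \t g) \c eqh (qtensor_cod X Y A C) \c
       (id_ X \t ginv (braid G A Y) \t id_ C) \c eqh (qtensor_dom X Y A C)).

Definition qtensor A B C D (u : mor quillen A B) (v : mor quillen C D) :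
  mor quillen (T A C) (T B D) := qtensor_raw (repr u) (repr v).

Lemma qtensor_domN X X' Y Y' A A' C C' (k : mor G X X') (l : mor G Y Y')
    (a : mor G A A') (c : mor G C C') :
  eqh (qtensor_dom X' Y' A' C') \c (k \t l \t (a \t c)) =
  (k \t (l \t a) \t c) \c eqh (qtensor_dom X Y A C).
Proof.
rewrite (eqhom_irr G (qtensor_dom X' Y' A' C') (etrans (otA G _ A' C')
  (f_equal2 T (esym (otA G X' Y' A')) (erefl C')))) -eqhom_cmp -cmpA mtA cmpA.
rewrite -mt_eqhom -mtM mtA' eqhom_id cmp1m -[c in LHS]cmpm1 mtM -cmpA.
congr (_ \c _); rewrite -(eqhom_id G erefl) mt_eqhom eqhom_cmp.
exact: eqhom_irr.
Qed.

Lemma qtensor_codN X X' Y Y' A A' C C' (k : mor G X X') (l : mor G Y Y')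
    (a : mor G A A') (c : mor G C C') :
  eqh (qtensor_cod X' Y' A' C') \c (k \t (a \t l) \t c) =
  (k \t a \t (l \t c)) \c eqh (qtensor_cod X Y A C).
Proof.
rewrite (eqhom_irr G (qtensor_cod X' Y' A' C') (etrans
  (f_equal2 T (otA G X' A' Y') (erefl C')) (esym (otA G _ Y' C')))).
rewrite -eqhom_cmp -mt_eqhom -cmpA -mtM mtA eqhom_id cmp1m -[c in LHS]cmpm1 mtM.
rewrite cmpA mtA' -cmpA; congr (_ \c _).
rewrite -(eqhom_id G erefl) mt_eqhom eqhom_cmp; exact: eqhom_irr.
Qed.

Lemma qtensorE A B C D X (f : mor G (T X A) B) Y (g : mor G (T Y C) D) :
  qtensor (qcl f) (qcl g) =
  qcl ((f \t g) \c eqh (qtensor_cod X Y A C) \c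
       (id_ X \t ginv (braid G A Y) \t id_ C) \c eqh (qtensor_dom X Y A C)).
Proof.
rewrite /qtensor; have := qcl_repr f; have := qcl_repr g.
case: (repr (qcl f)) (repr (qcl g)) => [X' f'] [Y' g'] /= [l <-] [k <-].
apply/qclP; exists (k \t l); rewrite -mt1 -!cmpA qtensor_domN mtM -!cmpA.
congr (_ \c _); rewrite !cmpA; congr (_ \c _).
rewrite -qtensor_codN -!cmpA; congr (_ \c _); rewrite -!mtM.
by rewrite !cmp1m !cmpm1 (ginv_natural (braidN _ _)).
Qed.
End Quillen.

(* Colimit of a sequence of sets T 0 -> T 1 -> T 2 -> ... *)
Section SeqColim.
Variables (T : nat -> Type) (s : forall n, T n -> T n.+1).

Definition sc_pre := {classic {n : nat & T n}}.
Definition sc_pair n (x : T n) : sc_pre := existT T n x.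
Definition sc_step (p : sc_pre) : sc_pre := sc_pair (s (projT2 p)).

Definition sc_eq (p q : sc_pre) : Prop := exists i j, iter i sc_step p = iter j sc_step q.

Lemma sc_equiv : equiv_class_of (fun p q => `[< sc_eq p q >]).
Proof.
split=> [p|p q|q p r]; first by apply/asboolP; exists 0%N, 0%N.
  by apply/asbool_equiv_eq; split=> -[i [j ij]]; exists j, i.
move=> /asboolP[i [j ij]] /asboolP[k [l kl]]; apply/asboolP.
by exists (k + i)%N, (j + l)%N; rewrite !iterD ij -kl -!iterD addnC.
Qed.

Canonical sc_equiv_rel := EquivRelPack sc_equiv.

Definition scolim : Type := {eq_quot sc_equiv_rel}.

Definition sc_in n (x : T n) : scolim := \pi_({eq_quot sc_equiv_rel}) (sc_pair x).

Lemma sc_inP n (x : T n) m (y : T m) :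
  sc_in x = sc_in y <->
  exists i j, iter i sc_step (sc_pair x) = iter j sc_step (sc_pair y).
Proof. by split=> [/eqmodP/asboolP|H]; last apply/eqmodP/asboolP. Qed.

Lemma sc_in_step n (x : T n) : sc_in (s x) = sc_in x.
Proof. by apply/sc_inP; exists 0%N, 1%N. Qed.

Lemma sc_ind (P : scolim -> Prop) : (forall n (x : T n), P (sc_in x)) -> forall x, P x.
Proof. by move=> Px x; rewrite -[x]reprK; case: (repr x) => n y; apply: Px. Qed.

Fixpoint sc_up k n (x : T n) : T (k + n)%N :=
  if k is k'.+1 then s (sc_up k' x) else x.

Lemma sc_iter k n (x : T n) : iter k sc_step (sc_pair x) = sc_pair (sc_up k x).
Proof. by elim: k => //= k ->. Qed.

Lemma sc_in_up k n (x : T n) : sc_in (sc_up k x) = sc_in x.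
Proof. by elim: k => //= k <-; apply: sc_in_step. Qed.

Lemma sc_pair_inj n (x y : T n) : sc_pair x = sc_pair y -> x = y.
Proof.
by move=> e; have := projT2_eq e; rewrite (Prop_irrelevance (projT1_eq e) erefl).
Qed.

Lemma sc_in_eq n (x y : T n) : sc_in x = sc_in y <-> exists k, sc_up k x = sc_up k y.
Proof.
split=> [/sc_inP[i [j]]|[k xy]]; last by rewrite -(sc_in_up k) xy sc_in_up.
rewrite !sc_iter => ij.
have ij' : i = j by apply/(@addIn n); apply: (congr1 (@projT1 _ _) ij).
by exists j; move: ij; rewrite ij' => /sc_pair_inj.
Qed.

Lemma sc_level n (x : T n) m : (n <= m)%N -> exists y : T m, sc_in x = sc_in y.
Proof.
move=> nm; rewrite -(subnK nm); exists (sc_up (m - n) x).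
by rewrite sc_in_up.
Qed.
End SeqColim.

Section SeqColimOp.
Variables (T U V : nat -> Type).
Variables (s : forall n, T n -> T n.+1) (t : forall n, U n -> U n.+1).
Variables (w : forall n, V n -> V n.+1).

Lemma sc_ind2 (P : scolim s -> scolim t -> Prop) :
  (forall n (x : T n) (y : U n), P (sc_in s x) (sc_in t y)) -> forall x y, P x y.
Proof.
move=> Pxy x y; move: x; apply: sc_ind => n x; move: y; apply: sc_ind => m y.
have [x' ->] := sc_level s x (leq_maxl n m).
have [y' ->] := sc_level t y (leq_maxr n m).
exact: Pxy.
Qed.

Lemma sc_ind3 (P : scolim s -> scolim t -> scolim w -> Prop) :
  (forall n (x : T n) (y : U n) (z : V n), P (sc_in s x) (sc_in t y) (sc_in w z)) ->
  forall x y z, P x y z.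
Proof.
move=> Pxyz x y z; move: x y; apply: sc_ind2 => n x y; move: z; apply: sc_ind => m z.
have [x' ->] := sc_level s x (leq_maxl n m).
have [y' ->] := sc_level t y (leq_maxl n m).
have [z' ->] := sc_level w z (leq_maxr n m).
exact: Pxyz.
Qed.

Variables (f : forall n, T n -> U n -> V n).
Hypothesis fS : forall n x y, f (s x) (t y) = w (f (n := n) x y).

Lemma sc_op2_exists (x : scolim s) (y : scolim t) :
  exists z, exists n (a : T n) (b : U n),
    [/\ x = sc_in s a, y = sc_in t b & z = sc_in w (f a b)].
Proof.
move: x y; apply: sc_ind2 => n a b.
by exists (sc_in w (f a b)), n, a, b.
Qed.

Definition sc_op2 (x : scolim s) (y : scolim t) : scolim w :=
  sval (cid (sc_op2_exists x y)).

Lemma sc_up_op2 k n (a : T n) (b : U n) :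
  f (sc_up s k a) (sc_up t k b) = sc_up w k (f a b).
Proof. by elim: k => //= k IH; rewrite fS IH. Qed.

Lemma sc_op2E n (a : T n) (b : U n) :
  sc_op2 (sc_in s a) (sc_in t b) = sc_in w (f a b).
Proof.
rewrite /sc_op2; case: cid => z /= [m [a' [b' [aa' bb' ->]]]].
pose N := maxn n m.
have same_level : forall l (c c' : T l) (d d' : U l),
    sc_in s c = sc_in s c' -> sc_in t d = sc_in t d' ->
    sc_in w (f c d) = sc_in w (f c' d').
  move=> l c c' d d' /sc_in_eq[i ci] /sc_in_eq[j dj].
  rewrite -(sc_in_up w (j + i)%N) -[RHS](sc_in_up w (j + i)%N) -!sc_up_op2.
  have upL (X : nat -> Type) (u : forall n, X n -> X n.+1) p r (x y : X l) :
      (p <= r)%N -> sc_up u p x = sc_up u p y -> sc_up u r x = sc_up u r y.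
    by move=> /subnK <- E; elim: (r - p)%N => //= q IH; rewrite IH.
  by rewrite (upL _ _ _ _ _ _ (leq_addl j i) ci) (upL _ _ _ _ _ _ (leq_addr i j) dj).
have raise : forall l (c : T l) (d : U l) r, (l <= r)%N ->
    exists c' d', [/\ sc_in s c = sc_in s c', sc_in t d = sc_in t d' &
      sc_in w (f c d) = sc_in w (f (n := r) c' d')].
  move=> l c d r lr; rewrite -(subnK lr).
  exists (sc_up s (r - l) c), (sc_up t (r - l) d).
  by rewrite sc_up_op2 !sc_in_up.
have [c [d [ac bd ->]]] := raise _ a b N (leq_maxl _ _).
have [c' [d' [ac' bd' ->]]] := raise _ a' b' N (leq_maxr _ _).
by apply: same_level; [rewrite -ac' -aa' ac|rewrite -bd' -bb' bd].
Qed.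
End SeqColimOp.

Section GroupColim.
Variables (T : nat -> groupType) (s : forall n, {multiplicative T n -> T n.+1}).

Definition gcolim : Type := scolim (fun n => s n).
Definition gc_in n (x : T n) : gcolim := sc_in (fun n => s n) x.

Definition gc_mul : gcolim -> gcolim -> gcolim :=
  sc_op2 (fun n => s n) (fun n (x y : T n) => x * y)%g.

Lemma gc_mulE n (x y : T n) : gc_mul (gc_in x) (gc_in y) = gc_in (x * y)%g.
Proof. by apply: sc_op2E => m a b; rewrite gmulfM. Qed.

Definition gc_inv (x : gcolim) : gcolim :=
  sc_op2 (fun n => s n) (fun n (x _ : T n) => x^-1)%g x x.

Lemma gc_s1 n : s n 1%g = 1%g.
Proof. by apply: (mulgI (s n 1%g)); rewrite -gmulfM !mulg1. Qed.

Lemma gc_sV n x : s n x^-1%g = (s n x)^-1%g.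
Proof. by apply: (mulgI (s n x)); rewrite -gmulfM !mulgV gc_s1. Qed.

Lemma gc_invE n (x : T n) : gc_inv (gc_in x) = gc_in x^-1%g.
Proof. by apply: sc_op2E => m a b; rewrite gc_sV. Qed.

Lemma gc_in_step n (x : T n) : gc_in (s n x) = gc_in x.
Proof. exact: sc_in_step. Qed.

Definition gc_one : gcolim := gc_in (1%g : T 0%N).

Lemma gc_oneE n : gc_one = gc_in (1%g : T n).
Proof. by elim: n => // n ->; rewrite -gc_in_step gc_s1. Qed.

Lemma gc_mulA : associative gc_mul.
Proof. by apply: sc_ind3 => n x y z; rewrite -!/(gc_in _) !gc_mulE mulgA. Qed.

Lemma gc_mul1 : left_id gc_one gc_mul.
Proof. by apply: sc_ind => n x; rewrite (gc_oneE n) gc_mulE mul1g. Qed.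

Lemma gc_mulg1 : right_id gc_one gc_mul.
Proof. by apply: sc_ind => n x; rewrite (gc_oneE n) gc_mulE mulg1. Qed.

Lemma gc_mulV : left_inverse gc_one gc_inv gc_mul.
Proof. by apply: sc_ind => n x; rewrite gc_invE gc_mulE mulVg -gc_oneE. Qed.

Lemma gc_mulgV : right_inverse gc_one gc_inv gc_mul.
Proof. by apply: sc_ind => n x; rewrite gc_invE gc_mulE mulgV -gc_oneE. Qed.

HB.instance Definition _ := gen_eqMixin gcolim.
HB.instance Definition _ := gen_choiceMixin gcolim.
HB.instance Definition _ :=
  isGroup.Build gcolim gc_mulA gc_mul1 gc_mulg1 gc_mulV gc_mulgV.

Lemma gc_inM n (x y : T n) : gc_in (x * y)%g = (gc_in x * gc_in y)%g.
Proof. by rewrite -gc_mulE. Qed.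

Lemma gc_in1 n : gc_in (1%g : T n) = 1%g.
Proof. by rewrite -gc_oneE. Qed.
End GroupColim.

Section ModColim.
Variables (K : fieldType) (M : nat -> lmodType K).
Variable (s : forall n, {linear M n -> M n.+1}).

Definition mcolim : Type := scolim (fun n => s n).
Definition mc_in_fun n (x : M n) : mcolim := sc_in (fun n => s n) x.

Definition mc_add : mcolim -> mcolim -> mcolim :=
  sc_op2 (fun n => s n) (fun n (x y : M n) => x + y).

Lemma mc_addE n (x y : M n) : mc_add (mc_in_fun x) (mc_in_fun y) = mc_in_fun (x + y).
Proof. by apply: sc_op2E => m a b; rewrite linearD. Qed.

Definition mc_scale (c : K) (x : mcolim) : mcolim :=
  sc_op2 (fun n => s n) (fun n (x _ : M n) => c *: x) x x.

Lemma mc_scaleE c n (x : M n) : mc_scale c (mc_in_fun x) = mc_in_fun (c *: x).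
Proof. by apply: sc_op2E => m a b; rewrite linearZ. Qed.

Definition mc_opp : mcolim -> mcolim := mc_scale (-1).

Definition mc_zero : mcolim := mc_in_fun (0 : M 0%N).

Lemma mc_zeroE n : mc_zero = mc_in_fun (0 : M n).
Proof. by elim: n => // n ->; rewrite -[LHS]sc_in_step linear0. Qed.

Lemma mc_addA : associative mc_add.
Proof. by apply: sc_ind3 => n x y z; rewrite -!/(mc_in_fun _) !mc_addE addrA. Qed.

Lemma mc_addC : commutative mc_add.
Proof. by apply: sc_ind2 => n x y; rewrite -!/(mc_in_fun _) !mc_addE addrC. Qed.

Lemma mc_add0 : left_id mc_zero mc_add.
Proof. by apply: sc_ind => n x; rewrite (mc_zeroE n) mc_addE add0r. Qed.

Lemma mc_addN : left_inverse mc_zero mc_opp mc_add.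
Proof.
by apply: sc_ind => n x; rewrite /mc_opp mc_scaleE mc_addE scaleN1r addNr -mc_zeroE.
Qed.

HB.instance Definition _ := gen_eqMixin mcolim.
HB.instance Definition _ := gen_choiceMixin mcolim.
HB.instance Definition _ :=
  GRing.isZmodule.Build mcolim mc_addA mc_addC mc_add0 mc_addN.

Lemma mc_scaleA a b x : mc_scale a (mc_scale b x) = mc_scale (a * b) x.
Proof. by move: x; apply: sc_ind => n x; rewrite !mc_scaleE scalerA. Qed.

Lemma mc_scale1 : left_id 1 mc_scale.
Proof. by apply: sc_ind => n x; rewrite mc_scaleE scale1r. Qed.

Lemma mc_scaleDr : right_distributive mc_scale +%R.
Proof.
move=> a; apply: sc_ind2 => n x y.
by rewrite -!/(mc_in_fun _) [_ + _]mc_addE !mc_scaleE scalerDr [RHS]mc_addE.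
Qed.

Lemma mc_scaleDl x : {morph mc_scale^~ x : a b / a + b}.
Proof.
by move=> a b; move: x; apply: sc_ind => n x; rewrite !mc_scaleE scalerDl [RHS]mc_addE.
Qed.

HB.instance Definition _ := GRing.Zmodule_isLmodule.Build K mcolim
  mc_scaleA mc_scale1 mc_scaleDr mc_scaleDl.

Lemma mc_in_linear n : linear (@mc_in_fun n).
Proof. by move=> a x y; rewrite -mc_addE -mc_scaleE. Qed.

Definition mc_in n : {linear M n -> mcolim} := mklin (@mc_in_linear n).

Lemma mc_in_step n (x : M n) : mc_in n.+1 (s n x) = mc_in n x.
Proof. exact: sc_in_step. Qed.

Lemma mc_ind (P : mcolim -> Prop) : (forall n x, P (mc_in n x)) -> forall x, P x.
Proof. exact: sc_ind. Qed.
End ModColim.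

Section Aut.
Variables (O : Type) (T : O -> O -> O) (I : O) (G : bsm_groupoid T I) (A : O).

Definition aut : Type := mor G A A.
HB.instance Definition _ := gen_eqMixin aut.
HB.instance Definition _ := gen_choiceMixin aut.
HB.instance Definition _ := @isGroup.Build aut (idm G A) (@ginv _ _ _ G A A)
  (@cmp _ G A A A) (@cmpA _ G A A A A) (@cmp1m _ G A A) (@cmpm1 _ G A A)
  (@ginvl _ _ _ G A A) (@ginvr _ _ _ G A A).

Definition aut_functor : functor (group_cat aut) (quillen G) :=
  @Functor unit O (group_cat aut) (quillen G) (fun _ => A)
    (fun _ _ (f : aut) => fmap (qemb G) f) (fun _ => fmap1 (qemb G) A)
    (fun _ _ _ (g f : aut) => fmapM (qemb G) g f).
End Aut.

Lemma qtensor_id_iotaN (O : Type) (T : O -> O -> O) (I : O) (G : bsm_groupoid T I)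
    (A A' B : O) (f : mor G A A') :
  cmp (quillen G) (qtensor (idm (quillen G) A') (qiota G B))
    (fmap (qemb G) (mt G f (idm G I))) =
  cmp (quillen G) (fmap (qemb G) (mt G f (idm G B)))
    (qtensor (idm (quillen G) A) (qiota G B)).
Proof.
rewrite [qtensor (idm _ A') _]qtensorE [qtensor (idm _ A) _]qtensorE.
rewrite [LHS]qcl_embr [RHS]qcl_embl; congr qcl.
rewrite -(mt1 G I B) -!cmpA qtensor_domN !cmpA; congr cmp.
rewrite -!cmpA -mtM -mtM (ginv_natural (braidN _ _)) mtM mtM.
rewrite [X in cmp G _ X]cmpA qtensor_codN !cmpA; congr cmp; congr cmp.
by rewrite -!mtM mt1l mt1 cmp1m cmpm1.
Qed.

Section Stabilization.
Variable G : bsm_groupoid addn 0%N.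

Local Notation UG := (quillen G).

Definition stab_aut_fun n (f : aut G n) : aut G n.+1 :=
  cmp G (cmp G (eqhom G (addn1 n)) (mt G f (idm G 1%N))) (eqhom G (esym (addn1 n))).

Lemma stab_autM n : {morph @stab_aut_fun n : f g / (f * g)%g}.
Proof.
move=> f g; have H : idm G 1%N = cmp G (idm G 1%N) (idm G 1%N) by rewrite cmp1m.
rewrite /stab_aut_fun {1}H mtM [RHS]cmpA; congr cmp.
rewrite -!cmpA; congr cmp; congr cmp.
by rewrite cmpA eqhom_cmp eqhom_id cmp1m.
Qed.

(* G_n -> G_(n+1), f |-> f \natural id_1; the identifications of n + 1 with n.+1 and
   of n + 0 with n are not definitional. *)
Definition stab_aut n : {multiplicative aut G n -> aut G n.+1} :=
  HB.pack (@stab_aut_fun n) (isMultiplicative.Build _ _ _ (@stab_autM n)).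

(* id_n \natural iota_1 : n -> n.+1 *)
Definition stab_hom n : mor UG n n.+1 :=
  cmp UG (fmap (qemb G) (eqhom G (addn1 n)))
 (cmp UG (qtensor (idm UG n) (qiota G 1%N))
         (fmap (qemb G) (eqhom G (esym (ot1r G n))))).

Lemma stab_homN n (f : aut G n) :
  cmp UG (stab_hom n) (fmap (qemb G) f) =
  cmp UG (fmap (qemb G) (stab_aut n f : mor G n.+1 n.+1)) (stab_hom n).
Proof.
have E : cmp G (eqhom G (esym (ot1r G n))) f =
    cmp G (mt G f (idm G 0%N)) (eqhom G (esym (ot1r G n))).
  rewrite -[LHS]cmpm1 -(eqhom_id G (etrans (esym (ot1r G n)) (ot1r G n))).
  rewrite -eqhom_cmp -[LHS]cmpA [X in cmp G _ X]cmpA -mt1r !cmpA eqhom_cmp.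
  by rewrite eqhom_id cmp1m.
rewrite /stab_hom -!cmpA -fmapM E fmapM [X in cmp UG _ X]cmpA qtensor_id_iotaN.
rewrite !cmpA; congr cmp; congr cmp; rewrite -!fmapM; congr fmap.
by rewrite -[RHS]cmpA eqhom_cmp eqhom_id cmpm1.
Qed.

Definition Ginf : groupType := gcolim stab_aut.

Definition to_Ginf n (f : aut G n) : Ginf := gc_in stab_aut f.

Section Coefficients.
Variable K : fieldType.

Section OneFunctor.
Variable F : kfun K UG.

(* F(n) as a functor on G_n *)
Definition Fn n : kfun K (group_cat (aut G n)) := kpull (aut_functor G n) F.

Definition Finf_mod : lmodType K := mcolim (fun n => km F (stab_hom n)).

Definition to_Finf n : {linear F n -> Finf_mod} := mc_in (fun n => km F (stab_hom n)) n.

Definition Finf_act_fun (g : Ginf) (x : Finf_mod) : Finf_mod :=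
  sc_op2 (fun n => km F (stab_hom n))
    (fun n (f : aut G n) (y : F n) => km F (fmap (qemb G) f) y) g x.

Lemma Finf_actE n (f : aut G n) (y : F n) :
  Finf_act_fun (to_Ginf f) (to_Finf n y) = to_Finf n (km F (fmap (qemb G) f) y).
Proof. by apply: sc_op2E => m h z; rewrite -!kmM stab_homN. Qed.

Lemma Finf_act_linear g : linear (Finf_act_fun g).
Proof.
move=> a x y; move: g x y; apply: sc_ind3 => n f x y.
rewrite -/(to_Ginf f) -[sc_in _ x]/(to_Finf n x) -[sc_in _ y]/(to_Finf n y).
have -> : a *: to_Finf n x + to_Finf n y = to_Finf n (a *: x + y) by rewrite linearP.
by rewrite !Finf_actE linearP [LHS]linearP.
Qed.

Definition Finf_act g : {linear Finf_mod -> Finf_mod} := mklin (@Finf_act_linear g).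

Lemma Finf_act1 x : Finf_act 1%g x = x.
Proof.
move: x; apply: mc_ind => n x; rewrite -(gc_in1 stab_aut n).
by rewrite [LHS]Finf_actE fmap1 km1.
Qed.

Lemma Finf_actM g h x : Finf_act (g * h)%g x = Finf_act g (Finf_act h x).
Proof.
move: g h x; apply: sc_ind3 => n g h x.
rewrite -!/(to_Ginf _) -[sc_in _ x]/(to_Finf n x) /to_Ginf -gc_inM.
by rewrite [LHS]Finf_actE [in RHS]/= !Finf_actE -kmM -fmapM.
Qed.

(* F_oo as a functor on G_oo *)
Definition Finf : kfun K (group_cat Ginf) :=
  @KFun K unit (group_cat Ginf) (fun _ => Finf_mod) (fun _ _ g => Finf_act g)
    (fun _ => Finf_act1) (fun _ _ _ => Finf_actM).

Definition Pi_pull : kfun K (cat_prod (group_cat Ginf) UG) :=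
  kpull (proj2_functor (group_cat Ginf) UG) F.
End OneFunctor.

Definition to_Ginf_functor n : functor (group_cat (aut G n)) (group_cat Ginf) :=
  @Functor unit unit (group_cat (aut G n)) (group_cat Ginf) (fun _ => tt)
    (fun _ _ => @to_Ginf n) (fun _ => gc_in1 stab_aut n)
    (fun _ _ _ => @gc_inM _ stab_aut n).

Definition to_Finf_mor (F : kfun K UG) n : kmor (to_Ginf_functor n) (Fn F n) (Finf F) :=
  @KMor K _ _ _ _ (to_Ginf_functor n) (Fn F n) (Finf F) (fun _ => to_Finf F n)
    (fun _ _ f x => esym (Finf_actE f x)).

(* H_k(G_n, F(n)) -> H_k(G_oo, F_oo) *)
Definition to_stable (F : kfun K UG) n k :
  {linear cat_homology (Fn F n) k -> cat_homology (Finf F) k} :=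
  cat_homology_map (to_Finf_mor F n) k.

Definition Psi_functor n :
    functor (group_cat (aut G n)) (cat_prod (group_cat Ginf) UG).
Proof.
refine (@Functor unit (unit * nat) (group_cat (aut G n))
  (cat_prod (group_cat Ginf) UG) (fun _ => (tt, n))
  (fun _ _ f => (to_Ginf f, fmap (qemb G) f)) _ _).
- by move=> u; exact: (f_equal2 pair (gc_in1 stab_aut n) (fmap1 (qemb G) n)).
- by move=> u v w g f; exact: (f_equal2 pair (gc_inM stab_aut g f) (fmapM (qemb G) g f)).
Defined.

Definition Psi_mor (F : kfun K UG) n : kmor (Psi_functor n) (Fn F n) (Pi_pull F) :=
  @KMor K _ _ _ _ (Psi_functor n) (Fn F n) (Pi_pull F)
    (fun _ => idlin (F n)) (fun _ _ _ _ => erefl).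

(* Psi_(F,n) : H_k(G_n, F(n)) -> H_k(G_oo x UG, Pi^* F) *)
Definition Psi_n (F : kfun K UG) n k :
  {linear cat_homology (Fn F n) k -> cat_homology (Pi_pull F) k} :=
  cat_homology_map (Psi_mor F n) k.

Section Naturality.
Variables (F F' : kfun K UG) (t : knat F F').

Definition Finf_nat_fun (x : Finf_mod F) : Finf_mod F' :=
  sc_op2 (fun n => km F' (stab_hom n)) (fun n y (_ : F n) => t n y) x x.

Lemma Finf_nat_funE n x : Finf_nat_fun (to_Finf F n x) = to_Finf F' n (t n x).
Proof. by apply: sc_op2E => m y z; apply: (kaN t). Qed.

Lemma Finf_nat_linear : linear Finf_nat_fun.
Proof.
move=> a; apply: sc_ind2 => n x y.
rewrite -[sc_in _ x]/(to_Finf F n x) -[sc_in _ y]/(to_Finf F n y).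
have -> : a *: to_Finf F n x + to_Finf F n y = to_Finf F n (a *: x + y).
  by rewrite linearP.
by rewrite !Finf_nat_funE linearP [LHS]linearP.
Qed.

Lemma Finf_natN (g : Ginf) x :
  mklin Finf_nat_linear (Finf_act F g x) = Finf_act F' g (mklin Finf_nat_linear x).
Proof.
move: g x; apply: sc_ind2 => n g x.
rewrite -/(to_Ginf g) -/(to_Finf F n x) [in LHS]/= Finf_actE [LHS]Finf_nat_funE.
by rewrite [in RHS]/= Finf_nat_funE Finf_actE (kaN t).
Qed.

(* F_oo -> F'_oo *)
Definition Finf_nat : knat (Finf F) (Finf F') :=
  @KMor K _ _ _ _ (functor_id (group_cat Ginf)) (Finf F) (Finf F')
    (fun _ => mklin Finf_nat_linear) (fun _ _ => Finf_natN).

Definition stable_map k :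
  {linear cat_homology (Finf F) k -> cat_homology (Finf F') k} :=
  cat_homology_map Finf_nat k.
End Naturality.

(* The direct sum of the H_k(G_oo, K) (x) H_l(UG, F) over k + l = m *)
Definition kunneth_index (m : nat) := {p : nat * nat | (p.1 + p.2)%N = m}.

Definition kunneth_term (F : kfun K UG) m (p : kunneth_index m) : lmodType K :=
  tensor (cat_homology (kconst (group_cat Ginf) (K^o : lmodType K)) (sval p).1)
         (cat_homology F (sval p).2).

Definition kunneth (F : kfun K UG) (m : nat) : lmodType K := dsum (@kunneth_term F m).

Definition kunneth_map (F F' : kfun K UG) (t : knat F F') (m : nat) :
  {linear kunneth F m -> kunneth F' m} :=
  dsum_map (fun p : kunneth_index m =>
    tensor_map (idlin (cat_homology (kconst (group_cat Ginf) (K^o : lmodType K)) (sval p).1))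
               (cat_homology_map t (sval p).2)).
End Coefficients.
End Stabilization.

Definition isomorphic O (C : category O) (a b : O) : Prop :=
  exists (f : mor C a b) (g : mor C b a), cmp C g f = idm C a /\ cmp C f g = idm C b.

(* Psi : H_k(G_oo, F_oo) -> H_k(G_oo x UG, Pi^* F) is the map induced by the Psi_(F,n)
   on the colimit, H_k(G_oo, F_oo) being the colimit of the H_k(G_n, F(n)) along the
   maps to_stable. *)
Definition induced_by_Psi_n (G : bsm_groupoid addn 0%N) (K : fieldType)
    (F : kfun K (quillen G)) (k : nat)
    (Psi : {linear cat_homology (Finf F) k -> cat_homology (Pi_pull F) k}) : Prop :=
  forall n x, Psi (to_stable F n k x) = Psi_n F n k x.

(* Main.v *)
(* Group homology and functor homology are both computed by dimension shifting along the cover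
   L F c = (+)_{a -> c} F a of a functor F, with kernel Omega F -> L F.  Since L is exact and
   linear in F, a short exact sequence of functors has a long exact sequence by the snake lemma,
   and the result agrees naturally with [cat_homology].

   Psi.  Both sides map to H(G_oo, colim F), with trivial coefficients colim F, compatibly with
   Psi.  For F = L F0 both maps are isomorphisms.  On the left, homogeneity makes Colim_n Hom(a, n)
   a transitive G_oo-set, the stabiliser of its base point is the increasing union of the subgroups
   G_m (+) id_a, and the braiding conjugates these at each finite stage to the standard
   G_m in G_{m+a}; Shapiro's lemma for discrete opfibrations then applies.  Dimension shifting and
   the five lemma pass from L F0 to every F.

   Kuenneth.  The (k, l) component of H_{k+l}(C x D, Pi^* F) is the image under l connecting maps
   in H_k(C x D, Pi^* Omega^l F), followed by the augmentation to H_k(C, colim Omega^l F).  It lands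
   in H_k(C, H_l(D, F)), because H_l(D, F) is the kernel of colim Omega^l F -> colim L Omega^(l-1) F
   and every exact sequence of K-modules splits; for the same reason H_k(C, V) = H_k(C, K) (x) V. *)

From mathcomp Require Import all_boot all_algebra.
From mathcomp Require Import boolp.
From mathcomp Require classical_sets.
Require Import Defs.

Set Implicit Arguments.
Unset Strict Implicit.
Unset Printing Implicit Defensive.

Import GRing.Theory.

(** * Stabilisers in the bracket construction *)

(** The bracket construction adds objects on the left, so the stabilisers of base points grow by
    left stabilisation, while [G_oo] is a colimit along right stabilisation. The braiding relates
    the two by conjugations that depend on the stage and are not chosen compatibly. This is
    harmless: homology ignores conjugation at each finite stage and commutes with sequential
    colimits, so it is enough that the transition maps agree on homology. The invariance of [hmap]
    under natural transformations that this uses also contracts coslices to their initial objects,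
    and compares composites of functors without any equality between functors. The cover [cover],
    which defines [cat_homology], has the elements of [F a] as generators and is not additive in
    [F]; hence the second, linear cover. Splittings of exact sequences over a field are not natural,
    so they only serve to prove exactness, injectivity or surjectivity. *)

Section StableGeometry.
Variable G : bsm_groupoid addn 0%N.
Local Notation UG := (quillen G).
Local Notation "g \c f" := (cmp G g f) (at level 40, left associativity).
Local Notation id_ := (idm G).
Local Notation "f \t g" := (mt G f g) (at level 39, left associativity).
Local Notation eqh := (eqhom G).

Lemma cmp_rinj a b c (u : mor G a b) (f g : mor G b c) : f \c u = g \c u -> f = g.
Proof. by move=> /(congr1 (fun w => w \c ginv u)); rewrite -!cmpA ginvr !cmpm1. Qed.

Lemma cmp_linj a b c (u : mor G b c) (f g : mor G a b) : u \c f = u \c g -> f = g.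
Proof. by move=> /(congr1 (fun w => ginv u \c w)); rewrite !cmpA ginvl !cmp1m. Qed.

(** The bracket construction adds objects on the left, while [stab_aut] stabilises on the right. On
    the left no cast occurs, since [1 + n] reduces to [n.+1]. *)
Definition lstab n (f : mor G n n) : mor G n.+1 n.+1 := id_ 1%N \t f.

Lemma lstabM n (g f : mor G n n) : lstab (g \c f) = lstab g \c lstab f.
Proof. exact: (@mtMr _ _ _ G 1%N n n n g f). Qed.

(** The inverse braiding of [n] past [1]. It has two roles: it conjugates left stabilisation into
    right stabilisation, and it represents the morphism [stab_hom]. *)
Definition cstab n : mor G n.+1 n.+1 := eqh (addn1 n) \c ginv (braid G n 1%N).

Lemma cstab_lstab n (f : mor G n n) : cstab n \c lstab f = stab_aut_fun f \c cstab n.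
Proof.
rewrite /cstab /stab_aut_fun /lstab -[LHS]cmpA (ginv_natural (braidN f (id_ 1%N))).
rewrite -!cmpA; congr cmp; congr cmp.
by rewrite cmpA eqhom_cmp eqhom_id cmp1m.
Qed.

Lemma mt_0l a b (w : mor G a b) :
  id_ 0%N \t w = eqh (esym (ot1l G b)) \c w \c eqh (ot1l G a).
Proof. by rewrite -cmpA -mt1l cmpA eqhom_cmp eqhom_id cmp1m. Qed.

Lemma mt_0r a b (w : mor G a b) :
  w \t id_ 0%N = eqh (esym (ot1r G b)) \c w \c eqh (ot1r G a).
Proof. by rewrite -cmpA -mt1r cmpA eqhom_cmp eqhom_id cmp1m. Qed.

(** In the formula for the product of [[0, id_n]] and [[1, id_1]], all factors are identities except
    the inverse braiding. *)
Lemma stab_homE n : stab_hom G n = qcl (X := 1%N) (cstab n).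
Proof.
rewrite /stab_hom -[idm UG n]/(qcl (eqh (ot1l G n))) /qiota qtensorE qcl_embr qcl_embl.
congr qcl; rewrite mt_eqhom mt_0r mt_0l.
rewrite -(eqhom_id G erefl) mt_eqhom /cstab !cmpA !eqhom_cmp -!cmpA.
rewrite !eqhom_cmp [X in _ \c (_ \c X)]eqhom_id cmpm1; congr cmp; exact: eqhom_irr.
Qed.

Section Base.
Variable a : nat.

(** Representative of the [m]-fold stabilisation of [a], one [cstab] for each step; [m.+1 + a]
    reduces to [(m + a).+1]. *)
Fixpoint fstab m : mor G (m + a) (m + a) :=
  match m return mor G (m + a) (m + a) with
  | 0 => idm G a
  | m'.+1 => cstab (m' + a) \c lstab (fstab m')
  end.

(* The composite a -> a + 1 -> ... -> m + a of the stabilization morphisms *)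
Definition xstab m : mor UG a (m + a) := qcl (X := m) (fstab m).

Lemma xstab0 : xstab 0 = idm UG a.
Proof. by rewrite /xstab -[RHS]/(qcl (eqh (ot1l G a))) eqhom_id. Qed.

Lemma xstabS m : cmp UG (stab_hom G (m + a)) (xstab m) = xstab m.+1.
Proof.
rewrite stab_homE [LHS]qcmpE /xstab; congr qcl.
by rewrite (eqhom_id G) cmpm1.
Qed.

Lemma lstab_mt m (k : mor G m m) : lstab k \t id_ a = lstab (k \t id_ a).
Proof.
have := mtA (id_ 1%N) k (id_ a).
by rewrite (eqhom_id G) cmp1m cmpm1.
Qed.

(** The automorphism [k] of the complement, conjugated by [fstab m] so that it fixes [xstab m]
    rather than [[m, id]]. *)
Definition sstab m (k : mor G m m) : mor G (m + a) (m + a) :=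
  fstab m \c (k \t id_ a) \c ginv (fstab m).

Lemma sstabE m (k : mor G m m) : sstab k \c fstab m = fstab m \c (k \t id_ a).
Proof. by rewrite /sstab -cmpA ginvl cmpm1. Qed.

Lemma sstabM m (g f : mor G m m) : sstab (g \c f) = sstab g \c sstab f.
Proof.
apply: (cmp_rinj (u := fstab m)); rewrite sstabE -cmpA sstabE cmpA sstabE -cmpA -mtM.
by rewrite cmp1m.
Qed.

Lemma sstab1 m : sstab (id_ m) = id_ (m + a).
Proof. by rewrite /sstab mt1 cmpm1 ginvr. Qed.

(** By [cstab_lstab], enlarging the complement on the left matches right stabilisation of the
    stabiliser. The stabiliser in [G_oo] is therefore a colimit along [lstab]. *)
Lemma sstabS m (k : mor G m m) : sstab (lstab k) = stab_aut_fun (sstab k).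
Proof.
apply: (cmp_rinj (u := fstab m.+1)); rewrite sstabE lstab_mt.
transitivity (cstab (m + a) \c lstab (fstab m \c (k \t id_ a))).
  by rewrite lstabM cmpA.
by rewrite -sstabE lstabM cmpA cstab_lstab -cmpA.
Qed.

Hypothesis stab_inj : forall a b : nat, injective (fun f : mor G a a => mt G f (idm G b)).

Lemma sstab_inj m : injective (@sstab m).
Proof.
move=> f g /(congr1 (fun w => w \c fstab m)); rewrite !sstabE => /cmp_linj.
exact: stab_inj.
Qed.

(** Read off from the equivalence relation on brackets: [[m, g \c fstab m] = [m, fstab m]] means
    that the two representatives differ by some [k \t id_a]. *)
Lemma xstab_stabilizer m (g : mor G (m + a) (m + a)) :
  cmp UG (fmap (qemb G) g) (xstab m) = xstab m <-> exists k, sstab k = g.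
Proof.
rewrite [X in X = _]qcl_embl qclP; split=> -[k kE]; exists k.
  by apply: (cmp_rinj (u := fstab m)); rewrite sstabE.
by rewrite -kE sstabE.
Qed.

Hypothesis no_hom : forall a b : nat, mor G a b -> a = b.

(** A representative [f : m + a -> n] is a morphism of the groupoid, which forces [m + a = n]; then
    [f] and [fstab m] differ by an automorphism of [n]. *)
Lemma xstab_transitive n (u : mor UG a n) : exists m (e : (m + a)%N = n) (g : mor G n n),
  u = cmp UG (fmap (qemb G) g) (eq_rect _ (mor UG a) (xstab m) _ e).
Proof.
elim/qcl_ind: u => m f; exists m; have e := no_hom f; subst n.
exists erefl, (f \c ginv (fstab m)).
by rewrite [RHS]qcl_embl -cmpA ginvl cmpm1.
Qed.
End Base.

Local Open Scope group_scope.

Lemma to_Ginf_lstab n (f : aut G n) :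
  to_Ginf (lstab f : aut G n.+1) =
  (to_Ginf (cstab n : aut G n.+1))^-1 * to_Ginf f * to_Ginf (cstab n : aut G n.+1).
Proof.
have <- : to_Ginf (stab_aut_fun f : aut G n.+1) = to_Ginf f by apply: gc_in_step.
apply: (mulgI (to_Ginf (cstab n : aut G n.+1))).
rewrite -[X in _ = _ * X]mulgA mulVKg -!gc_inM; congr gc_in; exact: cstab_lstab.
Qed.

(** One conjugation by [cstab] for each added object. The element [c] depends on [a] and [m] but not
    on [k]. *)
Lemma to_Ginf_mt0 a m : exists c : Ginf G, forall k : aut G m,
  to_Ginf (id_ a \t k : aut G (a + m)) = c * to_Ginf k * c^-1.
Proof.
elim: a => [|a [c cP]].
  exists 1 => k; rewrite invg1 mulg1 mul1g; congr gc_in.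
  by rewrite [_ \t _]mt_0l !(eqhom_id G) cmp1m cmpm1.
exists ((to_Ginf (cstab (a + m) : aut G (a + m).+1))^-1 * c) => k.
have -> : to_Ginf (id_ a.+1 \t k : aut G (a.+1 + m)) = to_Ginf (lstab (id_ a \t k) : aut G (a + m).+1).
  congr gc_in; have := mtA (id_ 1%N) (id_ a) k.
  by rewrite !(eqhom_id G) cmp1m cmpm1 mt1 => <-.
by rewrite to_Ginf_lstab cP invgM invgK !mulgA.
Qed.

Lemma to_Ginf_conj n n' (e : n = n') (w : mor G n n') : exists c : Ginf G, forall f : aut G n',
  to_Ginf (ginv w \c f \c w : aut G n) = c * to_Ginf f * c^-1.
Proof.
subst n'; exists (to_Ginf (ginv w : aut G n)) => f.
have <- : to_Ginf (w : aut G n) = (to_Ginf (ginv w : aut G n))^-1.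
  apply: (mulgI (to_Ginf (ginv w : aut G n))); rewrite mulgV -gc_inM -(gc_in1 _ n).
  by congr gc_in; apply: ginvl.
by rewrite -!gc_inM.
Qed.

(** The braiding of [m] and [a] moves [k \t id_a] to [id_a \t k], and [to_Ginf_mt0] removes the
    [id_a]. Nothing relates the conjugating elements for different [m]. *)
Lemma to_Ginf_sstab a m : exists c : Ginf G, forall k : aut G m,
  to_Ginf (sstab a k : aut G (m + a)) = c * to_Ginf k * c^-1.
Proof.
have [c cP] := to_Ginf_mt0 a m.
have [d dP] := to_Ginf_conj (addnC m a) (braid G m a \c ginv (fstab a m)).
exists (d * c) => k; rewrite invgM !mulgA -[d * c * _]mulgA -[d * (c * _) * _]mulgA -cP -dP.
congr gc_in; apply: (cmp_rinj (u := fstab a m)); rewrite sstabE.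
have E : ginv (braid G m a \c ginv (fstab a m)) = fstab a m \c ginv (braid G m a).
  apply: (cmp_rinj (u := braid G m a \c ginv (fstab a m))).
  by rewrite ginvl -cmpA [X in _ \c X]cmpA ginvl cmp1m ginvr.
rewrite E -!cmpA ginvl cmpm1; congr cmp.
rewrite -(braidN k (id_ a)); by rewrite cmpA ginvl cmp1m.
Qed.
End StableGeometry.

Local Open Scope ring_scope.

Lemma depchoice (T : Type) (U : T -> Type) (P : forall t, U t -> Prop) :
  (forall t, exists u, P t u) -> exists f : forall t, U t, forall t, P t (f t).
Proof. by move=> ex; exists (fun t => sval (cid (ex t))) => t; case: cid. Qed.

(** * Linear algebra *)

Section LinearAlgebra.
Variable K : fieldType.
Implicit Types U V W A B D : lmodType K.

Definition linj U V (f : {linear U -> V}) := forall x, f x = 0 -> x = 0.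
Definition lsurj U V (f : {linear U -> V}) := forall y, exists x, f x = y.
Definition lbij U V (f : {linear U -> V}) := linj f /\ lsurj f.
Definition lexact U V W (f : {linear U -> V}) (g : {linear V -> W}) :=
  forall y, g y = 0 <-> exists x, f x = y.

Lemma linj_eq U V (f : {linear U -> V}) x y : linj f -> f x = f y -> x = y.
Proof. by move=> fi e; apply/eqP; rewrite -subr_eq0; apply/eqP/fi; rewrite linearB e subrr. Qed.

Lemma lbij_ext U V (f g : {linear U -> V}) : (forall x, f x = g x) -> lbij f -> lbij g.
Proof.
move=> fg [fi fs]; split=> [x|y]; first by rewrite -fg; apply: fi.
by have [x <-] := fs y; exists x.
Qed.

Lemma lbij_of_inv U V (f : {linear U -> V}) (g : {linear V -> U}) :
  (forall x, g (f x) = x) -> (forall y, f (g y) = y) -> lbij f.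
Proof. by move=> gf fg; split=> [x x0|y]; [rewrite -(gf x) x0 linear0|exists (g y)]. Qed.

(** A total linear relation in which [0] is related only to [0] is the graph of a linear map.
    Inverses, connecting maps and maps out of sequential colimits are defined this way, without a
    linear choice of preimages. *)
Lemma lin_of_rel U V (R : U -> V -> Prop) :
  (forall a u u' v v', R u v -> R u' v' -> R (a *: u + u') (a *: v + v')) ->
  (forall u, exists v, R u v) -> (forall v, R 0 v -> v = 0) ->
  exists f : {linear U -> V}, forall u v, R u v <-> f u = v.
Proof.
move=> RL Rtot R0.
have Runiq u v v' : R u v -> R u v' -> v = v'.
  move=> uv uv'; have /R0 : R 0 ((-1) *: v + v').
    by rewrite -[0](addNr u) -scaleN1r; apply: RL.
  by rewrite scaleN1r addrC => /eqP; rewrite subr_eq0 => /eqP.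
pose f u := sval (cid (Rtot u)).
have fR u : R u (f u) by rewrite /f; case: cid.
have fL : linear f by move=> a u v; apply: (Runiq (a *: u + v)); [exact: fR|apply: RL; exact: fR].
exists (mklin fL) => u v; split=> [uv|<-]; last exact: fR.
exact: (Runiq u).
Qed.

Lemma linv_exists U V (f : {linear U -> V}) : lbij f ->
  exists g : {linear V -> U}, (forall x, g (f x) = x) /\ (forall y, f (g y) = y).
Proof.
move=> [fi fs].
have [||v /fi//|g gP] := @lin_of_rel V U (fun v u => f u = v); rewrite /=.
- by move=> a u u' v v' <- <-; rewrite linearP.
- exact: fs.
by exists g; split=> x; [apply/gP|apply/gP].
Qed.

Lemma spanmod_mono V (S T : V -> Prop) v :
  (forall u, S u -> T u) -> spanmod S v -> spanmod T v.
Proof.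
move=> ST; elim=> [|u /ST|a u w _ Su _ Sw]; [exact: span0|exact: span_gen|exact: spanP].
Qed.

Lemma complement_exists V (S : V -> Prop) :
  (forall a u v, S u -> S v -> S (a *: u + v)) -> S 0 ->
  exists p : {linear V -> V}, (forall v, S (p v)) /\ (forall v, S v -> p v = v).
Proof.
move=> SL S0.
pose P (A : V -> Prop) := forall v, spanmod A v -> S v -> v = 0.
have [|A [PA maxA]] := @classical_sets.Zorn_bigcup V P.
  move=> F FP Ftot v; move: v => v Fv Sv.
  suff [->//|[B FB Bv]] : v = 0 \/ exists2 B, F B & spanmod B v.
    exact: (FP B FB).
  elim: Fv {Sv} => [|u [B FB Bu]|a u w _ IHu _ IHw]; first by left.
    by right; exists B => //; apply: span_gen.
  case: IHu => [->|[B FB Bu]]; case: IHw => [->|[B' FB' Bw]].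
  - by left; rewrite scaler0 addr0.
  - by right; exists B' => //; rewrite scaler0 add0r.
  - by right; exists B => //; rewrite addr0; apply: spanZ.
  - right; have [BB'|B'B] := Ftot _ _ FB FB'.
      by exists B' => //; apply: spanP => //; apply: (spanmod_mono _ Bu).
    by exists B => //; apply: spanP => //; apply: (spanmod_mono _ Bw).
have SN u : S u -> S (- u) by move=> Su; rewrite -[- u]addr0 -scaleN1r; apply: SL.
have SD u v : S u -> S v -> S (u + v) by move=> Su Sv; rewrite -[u]scale1r; apply: SL.
have SZ a u : S u -> S (a *: u) by move=> Su; rewrite -[_ *: _]addr0; apply: SL.
(* By maximality [S] and the span of [A] fill [V]: otherwise [A] together with [v] would still have
   a span meeting [S] in [0]. *)
have tot v : exists s, S s /\ spanmod A (v - s).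
  apply: contrapT => vN.
  pose B : V -> Prop := fun w => A w \/ w = v.
  apply: (maxA B).
    split; first by move=> w Aw; left.
    move=> BA; apply: vN; exists 0; split=> //; rewrite subr0.
    by apply/span_gen/BA; right.
  move=> w Bw Sw.
  have [c [t [At wE]]] : exists c t, spanmod A t /\ w = c *: v + t.
    elim: Bw {Sw} => [|u [Au|->]|a u x _ [c [t [At ->]]] _ [d [t' [At' ->]]]].
    - by exists 0, 0; rewrite scale0r addr0; split=> //; apply: span0.
    - by exists 0, u; rewrite scale0r add0r; split=> //; apply: span_gen.
    - by exists 1, 0; rewrite scale1r addr0; split=> //; apply: span0.
    - exists (a * c + d), (a *: t + t'); split; first exact: spanP.
      by rewrite scalerDr scalerDl scalerA addrACA.
  have [c0|cN0] := eqVneq c 0.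
    by apply: PA => //; rewrite wE c0 scale0r add0r.
  case: vN; exists (c^-1 *: w); split; first exact: SZ.
  rewrite wE scalerDr scalerA mulVf// scale1r opprD addNKr.
  exact/spanN/spanZ.
have [|//||p pP] := @lin_of_rel V V (fun v s => S s /\ spanmod A (v - s)).
- move=> a u u' v v' [Sv Auv] [Sv' Auv']; split; first exact: SL.
  by rewrite opprD addrACA -scalerBr; apply: spanP.
- by move=> v [Sv]; rewrite sub0r => /spanN; rewrite opprK => Av; apply: PA.
exists p; split=> [v|v Sv]; first by have /pP[] := erefl (p v).
by apply/pP; rewrite subrr; split=> //; apply: span0.
Qed.

(** [p y] is the only [x] with [f x = q y] and [k x = 0], where [q] projects onto the image of [f]
    and [k] onto its kernel. *)
Lemma pinv_exists U V (f : {linear U -> V}) :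
  exists p : {linear V -> U}, forall x, f (p (f x)) = f x.
Proof.
have [||k [kf kid]] := @complement_exists U (fun x => f x = 0).
- by move=> a u v fu fv; rewrite linearP fu fv scaler0 addr0.
- exact: linear0.
have [||q [qf qid]] := @complement_exists V (fun y => exists x, f x = y).
- by move=> a u v [x <-] [y <-]; exists (a *: x + y); rewrite linearP.
- by exists 0; rewrite linear0.
have [||v|p pP] := @lin_of_rel V U (fun y x => f x = q y /\ k x = 0).
- by move=> a u u' v v' [fv kv] [fv' kv']; rewrite !linearP fv fv' kv kv' scaler0 addr0.
- move=> y; have [x xy] := qf y; exists (x - k x).
  by rewrite linearB kf subr0 xy linearB [k (k x)]kid ?subrr.
- by move=> [fv kv]; rewrite -kv kid// fv linear0.
exists p => x; have /pP[-> _] := erefl (p (f x)).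
by apply: qid; exists x.
Qed.

Lemma linj_retract U V (f : {linear U -> V}) : linj f ->
  exists r : {linear V -> U}, forall x, r (f x) = x.
Proof.
move=> fi; have [p pP] := pinv_exists f; exists p => x.
by apply/(linj_eq fi)/pP.
Qed.

Lemma addlin_subproof U V (f g : {linear U -> V}) : linear (fun x => f x + g x).
Proof. by move=> a x y; rewrite !linearP scalerDr addrACA. Qed.
Definition addlin U V (f g : {linear U -> V}) : {linear U -> V} := mklin (addlin_subproof f g).
Lemma addlinE U V (f g : {linear U -> V}) x : addlin f g x = f x + g x.
Proof. by []. Qed.

Lemma lincomb_subproof U V (c : K) (f g : {linear U -> V}) : linear (fun x => c *: f x + g x).
Proof.
move=> a x y; rewrite (linearP f) (linearP g) !scalerDr !scalerA (mulrC c).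
by rewrite addrACA.
Qed.
Definition lincomb U V c (f g : {linear U -> V}) : {linear U -> V} :=
  mklin (lincomb_subproof c f g).
Lemma lincombE U V c (f g : {linear U -> V}) x : lincomb c f g x = c *: f x + g x.
Proof. by []. Qed.

Lemma sublin_subproof U V (f g : {linear U -> V}) : linear (fun x => f x - g x).
Proof. by move=> a x y; rewrite !linearP scalerDr addrACA. Qed.
Definition sublin U V (f g : {linear U -> V}) : {linear U -> V} := mklin (sublin_subproof f g).
Lemma idlinE V (x : V) : idlin V x = x.
Proof. by []. Qed.

Lemma lexact_split U V W (f : {linear U -> V}) (g : {linear V -> W}) : lexact f g ->
  exists (s : {linear V -> U}) (t : {linear W -> V}), forall y, y = f (s y) + t (g y).
Proof.
move=> ex; have [p pP] := pinv_exists f; have [q qP] := pinv_exists g.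
have L : linear (fun y => p (y - q (g y))).
  move=> a x y; rewrite -linearP; congr (p _).
  by rewrite !linearP scalerDr addrACA.
exists (mklin L), q => y /=.
have [x xE] : exists x, f x = y - q (g y) by apply/ex; rewrite linearB qP subrr.
by rewrite -xE pP xE subrK.
Qed.

(* An exact sequence over a field splits, so it is preserved by additive functors. *)
Lemma split_lexact U V W (f : {linear U -> V}) (g : {linear V -> W})
  (s : {linear V -> U}) (t : {linear W -> V}) :
  (forall x, g (f x) = 0) -> (forall y, y = f (s y) + t (g y)) -> lexact f g.
Proof.
move=> gf st y; split=> [y0|[x <-]//]; exists (s y).
by rewrite {2}(st y) y0 linear0 addr0.
Qed.

Lemma ker_in_inj V W (f : {linear V -> W}) : linj (ker_in f).
Proof. by move=> x x0; apply: val_inj. Qed.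

Lemma ker_inE V W (f : {linear V -> W}) y : f y = 0 -> exists x, ker_in f x = y.
Proof. by move=> y0; exists (Kernel (introT eqP y0)). Qed.

Lemma ker_lexact V W (f : {linear V -> W}) : lexact (ker_in f) f.
Proof. by move=> y; split=> [/ker_inE|[x <-]]//; exact: ker_inP. Qed.

(** Transfers a bijection to kernels; it carries the comparisons below from a functor to its
    syzygy. *)
Lemma ker_lbij A B D (A' B' D' : lmodType K) (i : {linear A -> B}) (f : {linear B -> D})
    (i' : {linear A' -> B'}) (f' : {linear B' -> D'})
    (al : {linear A -> A'}) (be : {linear B -> B'}) (ga : {linear D -> D'}) :
  linj i -> lexact i f -> linj i' -> lexact i' f' ->
  (forall x, i' (al x) = be (i x)) -> (forall x, f' (be x) = ga (f x)) ->
  lbij be -> linj ga -> lbij al.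
Proof.
move=> ii ex ii' ex' ial fbe [bi bs] gi; split=> [x x0|y].
  by apply/ii/bi; rewrite -ial x0 linear0.
have [b bE] := bs (i' y); have [x xb] : exists x, i x = b.
  by apply/ex/gi; rewrite -fbe bE; apply/ex'; exists y.
by exists x; apply: (linj_eq ii'); rewrite ial xb bE.
Qed.

Section Ker.
Variables (V W V' W' : lmodType K) (f : {linear V -> W}) (f' : {linear V' -> W'}).
Variables (s : {linear V -> V'}) (t : {linear W -> W'}).
Hypothesis st : forall x, f' (s x) = t (f x).

Lemma ker_map_subproof (x : kernel f) : f' (cmplin s (ker_in f) x) = 0.
Proof. by rewrite cmplinE st ker_inP linear0. Qed.
Definition ker_map : {linear kernel f -> kernel f'} := ker_lift ker_map_subproof.
Lemma ker_mapE x : ker_in f' (ker_map x) = s (ker_in f x).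
Proof. by []. Qed.
End Ker.

Section Dsum.
Variables (I : Type).
Implicit Types M N : I -> lmodType K.

Lemma dsum_mapE M N (f : forall i, {linear M i -> N i}) i x :
  dsum_map f (dsum_in M i x) = dsum_in N i (f i x).
Proof. exact: dsum_liftE. Qed.

Lemma dsum_map_lexact M N (P : I -> lmodType K) (f : forall i, {linear M i -> N i})
    (g : forall i, {linear N i -> P i}) :
  (forall i, lexact (f i) (g i)) -> lexact (dsum_map f) (dsum_map g).
Proof.
move=> ex; have /depchoice[st stP] : forall i, exists st : {linear N i -> M i} * {linear P i -> N i},
    forall y, y = f i (st.1 y) + st.2 (g i y).
  by move=> i; have [s [t st]] := lexact_split (ex i); exists (s, t).
apply: (@split_lexact _ _ _ _ _ (dsum_map (fun i => (st i).1)) (dsum_map (fun i => (st i).2))).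
  apply: (dsum_ext (f := cmplin (dsum_map g) (dsum_map f)) (g := zerolin _ _)) => i x.
  rewrite cmplinE !dsum_mapE (_ : g i _ = 0) ?linear0//.
  by apply/ex; exists x.
apply: (dsum_ext (f := idlin _) (g := addlin (cmplin (dsum_map f) (dsum_map (fun i => (st i).1)))
  (cmplin (dsum_map (fun i => (st i).2)) (dsum_map g)))) => i x.
by rewrite addlinE !cmplinE !dsum_mapE -linearD -stP.
Qed.

Lemma dsum_map_linj M N (f : forall i, {linear M i -> N i}) :
  (forall i, linj (f i)) -> linj (dsum_map f).
Proof.
move=> fi; have /depchoice[r rP] : forall i, exists r : {linear N i -> M i}, forall x, r (f i x) = x.
  by move=> i; exact: linj_retract.
move=> x x0; rewrite -[x](dsum_ext (f := cmplin (dsum_map r) (dsum_map f)) (g := idlin _)).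
  by rewrite cmplinE x0 linear0.
by move=> i y; rewrite cmplinE !dsum_mapE rP.
Qed.

Lemma dsum_ind M (P : dsum M -> Prop) :
  P 0 -> (forall a u v, P u -> P v -> P (a *: u + v)) ->
  (forall i x, P (dsum_in M i x)) -> forall u, P u.
Proof.
move=> P0 PL Pin u; have [{}u ->] := qpi_surj u.
rewrite [u]monalg.monalgE linear_sum; elim/big_ind: _ => //.
  by move=> x y Px Py; rewrite -[x]scale1r; apply: PL.
move=> [i x] _; set c := monalg.mcoeff _ _.
have -> : monalg.mkmalgU (existT _ i x : {classic _}) c = c *: gen K (existT (fun i => M i) i x).
  apply/monalg.malgP => s; rewrite monalg.mcoeffZ !monalg.mcoeffU.
  by case: eqP => _; rewrite ?mulr1n ?mulr0n ?mulr1 ?mulr0.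
rewrite linearZ -[X in P X]addr0; apply: PL => //.
exact: Pin.
Qed.

Lemma dsum_map_lsurj M N (f : forall i, {linear M i -> N i}) :
  (forall i, lsurj (f i)) -> lsurj (dsum_map f).
Proof.
move=> fs; apply: dsum_ind => [|a u v [x <-] [y <-]|i y].
- by exists 0; rewrite linear0.
- by exists (a *: x + y); rewrite linearP.
- by have [x <-] := fs i y; exists (dsum_in M i x); rewrite dsum_mapE.
Qed.
End Dsum.

Section Tensor.
Variable V : lmodType K.
Implicit Types M N P : lmodType K.

Lemma tens_linear_subproof M (v : V) : linear (fun x : M => tens x v).
Proof. by move=> a x y; rewrite tensPl. Qed.
Definition tensl M v : {linear M -> tensor M V} := mklin (@tens_linear_subproof M v).
Lemma tensr_subproof M (x : M) : linear (fun v : V => tens x v).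
Proof. by move=> a u v; rewrite tensPr. Qed.
Definition tensr M x : {linear V -> tensor M V} := mklin (@tensr_subproof M x).

Lemma tensor_ext M N (f g : {linear tensor M V -> N}) :
  (forall x v, f (tens x v) = g (tens x v)) -> forall u, f u = g u.
Proof.
move=> fg; apply: qmod_ext.
by apply: (free_ext (f := cmplin f (qpi _)) (g := cmplin g (qpi _))) => -[x v]; apply: fg.
Qed.

Section Lift.
Variables (M N : lmodType K) (f : V -> {linear M -> N}).
Hypothesis fL : forall a u v x, f (a *: u + v) x = a *: f u x + f v x.
Lemma tensor_lift_subproof w : tensor_rel w -> free_lift (fun p : M * V => f p.2 p.1) w = 0.
Proof.
case=> a x x' y; rewrite linearB linearP !free_liftE [X in X - _]/=.
  by rewrite linearP subrr.
by rewrite fL subrr.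
Qed.
Definition tensor_lift : {linear tensor M V -> N} := qlift tensor_lift_subproof.
Lemma tensor_liftE x v : tensor_lift (tens x v) = f v x.
Proof. by rewrite /tensor_lift [LHS]qliftE free_liftE. Qed.
End Lift.

Definition tmap M N (f : {linear M -> N}) : {linear tensor M V -> tensor N V} :=
  tensor_map f (idlin V).
Lemma tmapE M N (f : {linear M -> N}) x v : tmap f (tens x v) = tens (f x) v.
Proof. exact: tensor_mapE. Qed.

Lemma tmap_lexact M N P (f : {linear M -> N}) (g : {linear N -> P}) :
  lexact f g -> lexact (tmap f) (tmap g).
Proof.
move=> ex; have [s [t st]] := lexact_split ex.
apply: (@split_lexact _ _ _ _ _ (tmap s) (tmap t)).
  apply: (tensor_ext (f := cmplin (tmap g) (tmap f)) (g := zerolin _ _)) => x v.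
  rewrite cmplinE !tmapE (_ : g _ = 0); first exact: (linear0 (tensl _ v)).
  by apply/ex; exists x.
apply: (tensor_ext (f := idlin _) (g := addlin (cmplin (tmap f) (tmap s)) (cmplin (tmap t) (tmap g)))).
move=> x v; rewrite addlinE !cmplinE !tmapE [RHS]/= -(linearD (tensl _ v)) /= -st //.
Qed.

Lemma tmap_linj M N (f : {linear M -> N}) : linj f -> linj (tmap f).
Proof.
move=> /linj_retract[r rP] x x0.
rewrite -[x](tensor_ext (f := cmplin (tmap r) (tmap f)) (g := idlin _)).
  by rewrite cmplinE x0 linear0.
by move=> y v; rewrite cmplinE !tmapE rP.
Qed.
End Tensor.
End LinearAlgebra.

Definition fcomp O O' O'' (C : category O) (D : category O') (E : category O'')
  (psi : functor D E) (phi : functor C D) : functor C E.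
Proof.
refine (@Functor O O'' C E (fun a => psi (phi a)) (fun a b f => fmap psi (fmap phi f)) _ _).
- by move=> a; rewrite !fmap1.
- by move=> a b c g f; rewrite !fmapM.
Defined.

(** * Homology by linear covers *)

Section LinearCover.
Variable K : fieldType.
Implicit Type W : lmodType K.

Definition kcomp O O' O'' (C : category O) (D : category O') (E : category O'')
  (psi : functor D E) (phi : functor C D) (F : kfun K C) (G : kfun K D) (H : kfun K E)
  (u : kmor psi G H) (t : kmor phi F G) : kmor (fcomp psi phi) F H.
Proof.
refine (@KMor K _ _ _ _ (fcomp psi phi) F H (fun a => cmplin (u (phi a)) (t a)) _).
by move=> a b f x; rewrite !cmplinE !kaN.
Defined.

Lemma colim_ind O (C : category O) (F : kfun K C) (P : colim F -> Prop) :
  P 0 -> (forall a u v, P u -> P v -> P (a *: u + v)) ->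
  (forall a x, P (colim_in F a x)) -> forall u, P u.
Proof.
move=> P0 PL Pin u; have [{}u ->] := qpi_surj u.
move: u; apply: dsum_ind => [|a u v Pu Pv|a x]; first by rewrite linear0.
  by rewrite linearP; apply: PL.
exact: Pin.
Qed.

Section ColimTools.
Variables (O : Type) (C : category O).

Lemma colim_map_lsurj O' (D : category O') (phi : functor C D) (A : kfun K C) (B : kfun K D)
    (q : kmor phi A B) :
  (forall c (y : B c), exists a x, colim_in B (phi a) (q a x) = colim_in B c y) ->
  lsurj (colim_map q).
Proof.
move=> qs; apply: colim_ind => [|a u v [x <-] [y <-]|c y].
- by exists 0; rewrite linear0.
- by exists (a *: x + y); rewrite linearP.
- by have [a [x <-]] := qs c y; exists (colim_in A a x); rewrite colim_mapE.
Qed.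

Lemma colim_map_lsurjN (A B : kfun K C) (q : knat A B) :
  (forall c, lsurj (q c)) -> lsurj (colim_map q).
Proof.
move=> qs; apply: colim_map_lsurj => c y.
by have [x <-] := qs c y; exists c, x.
Qed.

(** Right exactness of the colimit: the quotient of [colim B] by the image of [colim A] receives a
    map from [colim D], so what dies in [colim D] dies in this quotient. *)
Lemma colim_map_lexact (A B D : kfun K C) (i : knat A B) (q : knat B D) :
  (forall c, lexact (i c) (q c)) -> (forall c, lsurj (q c)) ->
  lexact (colim_map i) (colim_map q).
Proof.
move=> ex qs y; split=> [y0|[x <-]]; last first.
  move: x; apply: (colim_ext (f := cmplin (colim_map q) (colim_map i)) (g := zerolin _ _)) => a x.
  rewrite cmplinE !colim_mapE (_ : q _ _ = 0) ?linear0//.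
  by apply/ex; exists x.
have /depchoice[s sP] : forall c, exists s : {linear D c -> B c}, forall d, q c (s d) = d.
  move=> c; have [p pP] := pinv_exists (q c); exists p => d.
  by have [b <-] := qs c d.
pose S := fun u => exists x, colim_map i x = u.
have SL u : spanmod S u -> S u.
  elim=> [|//|a v w _ [x <-] _ [x' <-]]; first by exists 0; rewrite linear0.
  by exists (a *: x + x'); rewrite linearP.
have piE c u v : q c u = q c v ->
    qpi S (colim_in B c u) = qpi S (colim_in B c v).
  move=> uv; apply/eqP; rewrite -subr_eq0 -!linearB; apply/eqP/qpi_gen.
  have [x xE] : exists x, i c x = u - v by apply/ex; rewrite linearB uv subrr.
  by exists (colim_in A c x); rewrite colim_mapE xE.
(* The sections [s c] need not be natural; their defect lies in the image of [A] and disappears in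
   the quotient. *)
pose w c := cmplin (qpi S) (cmplin (colim_in B c) (s c)).
have wN a b (f : mor C a b) x : w b (km D f x) = w a x.
  rewrite -[RHS]/(qpi S (colim_in B a (s a x))) -(colim_inE f); apply: piE.
  by rewrite sP (kaN q) sP.
apply/SL/qpi0P.
have <- : colim_lift wN (colim_map q y) = qpi S y.
  apply: (colim_ext (f := cmplin (colim_lift wN) (colim_map q))) => a x.
  by rewrite cmplinE colim_mapE colim_liftE /w !cmplinE; apply: piE; rewrite sP.
by rewrite y0 linear0.
Qed.
End ColimTools.

Section Cover.
Variables (O : Type) (C : category O).

Definition lidx c := {a : O & mor C a c}.

Section OneFunctor.
Variable F : kfun K C.

(** This is [i_! i^* F] for the inclusion [i] of the discrete category of objects, and [leps] is the
    counit. Unlike in [cover], [F a] enters as a coefficient space and not as a set of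
    generators. *)
Definition lcov_obj c : lmodType K := dsum (fun p : lidx c => F (projT1 p)).

Definition lcov_in c a (f : mor C a c) : {linear F a -> lcov_obj c} :=
  dsum_in (fun p : lidx c => F (projT1 p)) (existT _ a f).

Lemma lcov_ext c W (u v : {linear lcov_obj c -> W}) :
  (forall a f x, u (@lcov_in c a f x) = v (lcov_in f x)) -> forall y, u y = v y.
Proof. by move=> uv; apply: dsum_ext => -[a f] x; apply: uv. Qed.

Definition lcov_lift c W (k : forall a, mor C a c -> {linear F a -> W}) :
  {linear lcov_obj c -> W} := dsum_lift (fun p : lidx c => k (projT1 p) (projT2 p)).

Lemma lcov_liftE c W (k : forall a, mor C a c -> {linear F a -> W}) a (f : mor C a c) x :
  lcov_lift k (lcov_in f x) = k a f x.
Proof. exact: dsum_liftE. Qed.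

Definition lcov_km c c' (g : mor C c c') : {linear lcov_obj c -> lcov_obj c'} :=
  lcov_lift (fun a f => lcov_in (cmp C g f)).

Lemma lcov_kmE c c' (g : mor C c c') a (f : mor C a c) x :
  lcov_km g (lcov_in f x) = lcov_in (cmp C g f) x.
Proof. exact: lcov_liftE. Qed.

Lemma lcov_km1 c x : lcov_km (idm C c) x = x.
Proof. by apply: (lcov_ext (v := idlin _)) => a f y; rewrite lcov_kmE cmp1m. Qed.

Lemma lcov_kmM c c' c'' (k : mor C c' c'') (g : mor C c c') x :
  lcov_km (cmp C k g) x = lcov_km k (lcov_km g x).
Proof.
apply: (lcov_ext (v := cmplin (lcov_km k) (lcov_km g))) => a f y.
by rewrite cmplinE !lcov_kmE cmpA.
Qed.

Definition lcov : kfun K C := KFun lcov_km1 lcov_kmM.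

Definition leps_fun c : {linear lcov c -> F c} := lcov_lift (fun a f => km F f).

Lemma leps_funE c a (f : mor C a c) x : leps_fun c (lcov_in f x) = km F f x.
Proof. exact: lcov_liftE. Qed.

Lemma lepsN a b (f : mor C a b) x : leps_fun b (km lcov f x) = km F f (leps_fun a x).
Proof.
apply: (lcov_ext (u := cmplin (leps_fun b) (km lcov f))
                 (v := cmplin (km F f) (leps_fun a))) => c g y.
by rewrite !cmplinE lcov_kmE !leps_funE kmM.
Qed.

Definition leps : knat lcov F := @KMor K _ _ _ _ (functor_id C) lcov F leps_fun lepsN.

Lemma leps_surj c : lsurj (leps c).
Proof. by move=> y; exists (lcov_in (idm C c) y); rewrite leps_funE km1. Qed.

Lemma lomega_subproof a b (f : mor C a b) (x : kernel (leps a)) :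
  leps b (cmplin (km lcov f) (ker_in (leps a)) x) = 0.
Proof. by rewrite [LHS]lepsN ker_inP linear0. Qed.

Definition lomega : kfun K C.
Proof.
refine (@KFun K O C (fun a => kernel (leps a))
  (fun a b f => ker_lift (@lomega_subproof a b f)) _ _).
- by move=> a x; apply/val_inj; apply: lcov_km1.
- by move=> a b c g f x; apply/val_inj; apply: lcov_kmM.
Defined.

Definition lomega_in : knat lomega lcov :=
  @KMor K _ _ _ _ (functor_id C) lomega lcov (fun a => ker_in (leps a))
    (fun _ _ _ _ => erefl).

Lemma lomega_lexact c : lexact (lomega_in c) (leps c).
Proof. exact: ker_lexact. Qed.

Lemma lomega_inj c : linj (lomega_in c).
Proof. exact: ker_in_inj. Qed.

(** Dimension shift in degree one: the first homology of the linear cover is zero, which leaves the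
    kernel of [colim (lomega F) -> colim (lcov F)]. *)
Definition homol1 : lmodType K := kernel (colim_map lomega_in).
End OneFunctor.
End Cover.

Section CoverMap.
Variables (O O' : Type) (C : category O) (D : category O') (phi : functor C D).
Variables (F : kfun K C) (G : kfun K D) (t : kmor phi F G).

Definition lcov_map_fun c : {linear lcov F c -> lcov G (phi c)} :=
  lcov_lift (fun a f => cmplin (lcov_in G (fmap phi f)) (t a)).

Lemma lcov_map_funE c a (f : mor C a c) x :
  lcov_map_fun c (lcov_in F f x) = lcov_in G (fmap phi f) (t a x).
Proof. exact: lcov_liftE. Qed.

Lemma lcov_mapN a b (f : mor C a b) x :
  lcov_map_fun b (km (lcov F) f x) = km (lcov G) (fmap phi f) (lcov_map_fun a x).
Proof.
apply: (lcov_ext (u := cmplin (lcov_map_fun b) (km (lcov F) f))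
  (v := cmplin (km (lcov G) (fmap phi f)) (lcov_map_fun a))) => c g y.
by rewrite !cmplinE lcov_kmE !lcov_map_funE fmapM lcov_kmE.
Qed.

Definition lcov_map : kmor phi (lcov F) (lcov G) := KMor lcov_mapN.

Lemma lcov_mapE c a (f : mor C a c) x :
  lcov_map c (lcov_in F f x) = lcov_in G (fmap phi f) (t a x).
Proof. exact: lcov_map_funE. Qed.

Lemma leps_lcov_map c x : leps G (phi c) (lcov_map c x) = t c (leps F c x).
Proof.
apply: (lcov_ext (u := cmplin (leps G (phi c)) (lcov_map c))
  (v := cmplin (t c) (leps F c))) => a f y.
by rewrite !cmplinE lcov_map_funE !leps_funE kaN.
Qed.

Definition lomega_map_fun c : {linear lomega F c -> lomega G (phi c)} :=
  ker_map (leps_lcov_map (c := c)).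

Lemma lomega_mapN a b (f : mor C a b) x :
  lomega_map_fun b (km (lomega F) f x) = km (lomega G) (fmap phi f) (lomega_map_fun a x).
Proof. by apply/val_inj; apply: lcov_mapN. Qed.

Definition lomega_map : kmor phi (lomega F) (lomega G) := KMor lomega_mapN.

Lemma lomega_mapE c x : lomega_in G (phi c) (lomega_map c x) = lcov_map c (lomega_in F c x).
Proof. by []. Qed.

Lemma homol1_map_subproof x :
  colim_map (lomega_in G) (colim_map lomega_map x) = colim_map lcov_map (colim_map (lomega_in F) x).
Proof.
apply: (colim_ext (f := cmplin (colim_map (lomega_in G)) (colim_map lomega_map))
  (g := cmplin (colim_map lcov_map) (colim_map (lomega_in F)))) => a y.
by rewrite !cmplinE !colim_mapE.
Qed.

Definition homol1_map : {linear homol1 F -> homol1 G} := ker_map homol1_map_subproof.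

Lemma homol1_mapE x : ker_in _ (homol1_map x) = colim_map lomega_map (ker_in _ x).
Proof. by []. Qed.
End CoverMap.

Section Homology.
Variables (O : Type) (C : category O).

(** The recursion acts on the argument, so that [homol n.+2 F] is convertible to
    [homol n.+1 (lomega F)]; inductions on the degree rely on this. *)
Fixpoint lsyz n (F : kfun K C) : kfun K C := if n is m.+1 then lsyz m (lomega F) else F.

Definition homol n (F : kfun K C) : lmodType K := if n is m.+1 then homol1 (lsyz m F) else colim F.
End Homology.

Section HomologyMap.
Variables (O O' : Type) (C : category O) (D : category O') (phi : functor C D).

Fixpoint lsyz_map n (F : kfun K C) (G : kfun K D) (t : kmor phi F G) :
    kmor phi (lsyz n F) (lsyz n G) :=
  match n with 0 => t | m.+1 => lsyz_map m (lomega_map t) end.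

Definition hmap n (F : kfun K C) (G : kfun K D) (t : kmor phi F G) :
    {linear homol n F -> homol n G} :=
  match n with 0 => colim_map t | m.+1 => homol1_map (lsyz_map m t) end.

Lemma colim_map_lin (F : kfun K C) (G : kfun K D) c (t u v : kmor phi F G) :
  (forall a x, t a x = c *: u a x + v a x) -> forall z,
  colim_map t z = c *: colim_map u z + colim_map v z.
Proof.
move=> tuv; apply: (colim_ext (f := colim_map t)
  (g := lincomb c (colim_map u) (colim_map v))) => a x.
by rewrite lincombE !colim_mapE tuv linearP.
Qed.

Lemma lomega_map_lin (F : kfun K C) (G : kfun K D) c (t u v : kmor phi F G) :
  (forall a x, t a x = c *: u a x + v a x) ->
  forall a x, lomega_map t a x = c *: lomega_map u a x + lomega_map v a x.
Proof.
move=> tuv a x; apply: (linj_eq (@lomega_inj _ _ _ _)).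
rewrite linearP !lomega_mapE; apply: (lcov_ext (u := lcov_map t a)
  (v := lincomb c (lcov_map u a) (lcov_map v a))) => b f y.
by rewrite lincombE !lcov_mapE tuv linearP.
Qed.

Lemma hmap_lin n (F : kfun K C) (G : kfun K D) c (t u v : kmor phi F G) :
  (forall a x, t a x = c *: u a x + v a x) ->
  forall z, hmap n t z = c *: hmap n u z + hmap n v z.
Proof.
case: n => [|n]; first exact: colim_map_lin.
elim: n F G t u v => [|n IH] F G t u v tuv z; last exact/IH/lomega_map_lin.
apply: (linj_eq (@ker_in_inj _ _ _ _)).
by rewrite linearP !homol1_mapE; apply/colim_map_lin/lomega_map_lin.
Qed.

Lemma hmap_add n (F : kfun K C) (G : kfun K D) (t u v : kmor phi F G) :
  (forall a x, t a x = u a x + v a x) -> forall z, hmap n t z = hmap n u z + hmap n v z.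
Proof.
move=> tuv z; rewrite -[hmap n u z]scale1r; apply: hmap_lin => a x.
by rewrite scale1r tuv.
Qed.

Lemma hmap_zero n (F : kfun K C) (G : kfun K D) (t : kmor phi F G) :
  (forall a x, t a x = 0) -> forall z, hmap n t z = 0.
Proof.
move=> t0 z; rewrite [LHS](hmap_lin (c := -1) (u := t) (v := t)); last first.
  by move=> a x; rewrite t0 scaler0 addr0.
by rewrite scaleN1r addNr.
Qed.

Lemma colim_map_ext (F : kfun K C) (G : kfun K D) (t u : kmor phi F G) :
  (forall a x, t a x = u a x) -> forall z, colim_map t z = colim_map u z.
Proof.
by move=> tu; apply: colim_ext => a x; rewrite !colim_mapE tu.
Qed.

Lemma lomega_map_ext (F : kfun K C) (G : kfun K D) (t u : kmor phi F G) :
  (forall a x, t a x = u a x) -> forall a x, lomega_map t a x = lomega_map u a x.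
Proof.
move=> tu a x; apply: (linj_eq (@lomega_inj _ _ _ _)); rewrite !lomega_mapE.
by apply: lcov_ext => b f y; rewrite !lcov_mapE tu.
Qed.

Lemma hmap_ext n (F : kfun K C) (G : kfun K D) (t u : kmor phi F G) :
  (forall a x, t a x = u a x) -> forall z, hmap n t z = hmap n u z.
Proof.
case: n => [|n]; first exact: colim_map_ext.
elim: n F G t u => [|n IH] F G t u tu z; last exact/IH/lomega_map_ext.
apply: (linj_eq (@ker_in_inj _ _ _ _)).
by rewrite !homol1_mapE; apply/colim_map_ext/lomega_map_ext.
Qed.
End HomologyMap.

Lemma hmap_id O (C : category O) n (F : kfun K C) (t : knat F F) :
  (forall a x, t a x = x) -> forall z, hmap n t z = z.
Proof.
have cid (G : kfun K C) (u : knat G G) : (forall a x, u a x = x) -> forall z, colim_map u z = z.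
  by move=> u1; apply: (colim_ext (g := idlin _)) => a x; rewrite colim_mapE u1.
have oid (G : kfun K C) (u : knat G G) :
    (forall a x, u a x = x) -> forall a x, lomega_map u a x = x.
  move=> u1 a x; apply: (linj_eq (@lomega_inj _ _ _ _)); rewrite lomega_mapE.
  by apply: (lcov_ext (v := idlin _)) => b f y; rewrite lcov_mapE u1.
case: n => [|n]; first exact: cid.
elim: n F t => [|n IH] F t t1 z; last exact/IH/oid.
apply: (linj_eq (@ker_in_inj _ _ _ _)).
by rewrite homol1_mapE; apply/cid/oid.
Qed.

Section Compose.
Variables (O O' O'' : Type) (C : category O) (D : category O') (E : category O'').

Lemma hmap_compr n (psi : functor C D) (F G : kfun K C) (H : kfun K D)
    (u : kmor psi G H) (i : knat F G) (t : kmor psi F H) :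
  (forall a x, t a x = u a (i a x)) -> forall z, hmap n t z = hmap n u (hmap n i z).
Proof.
have ccomp (F' G' : kfun K C) (H' : kfun K D) (u' : kmor psi G' H') (i' : knat F' G')
    (t' : kmor psi F' H') : (forall a x, t' a x = u' a (i' a x)) ->
    forall z, colim_map t' z = colim_map u' (colim_map i' z).
  move=> tui; apply: (colim_ext (g := cmplin (colim_map u') (colim_map i'))) => a x.
  by rewrite cmplinE !colim_mapE tui.
have ocomp (F' G' : kfun K C) (H' : kfun K D) (u' : kmor psi G' H') (i' : knat F' G')
    (t' : kmor psi F' H') : (forall a x, t' a x = u' a (i' a x)) ->
    forall a x, lomega_map t' a x = lomega_map u' a (lomega_map i' a x).
  move=> tui a x; apply: (linj_eq (@lomega_inj _ _ _ _)); rewrite !lomega_mapE.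
  by apply: (lcov_ext (v := cmplin (lcov_map u' _) (lcov_map i' _))) => b f y;
     rewrite cmplinE !lcov_mapE tui.
case: n => [|n]; first exact: ccomp.
elim: n F G H u i t => [|n IH] F G H u i t tui z; last exact/IH/ocomp.
apply: (linj_eq (@ker_in_inj _ _ _ _)).
by rewrite !homol1_mapE; apply/ccomp/ocomp.
Qed.

Lemma hmap_comp n (psi : functor D E) (phi : functor C D) (F : kfun K C) (G : kfun K D)
    (H : kfun K E) (u : kmor psi G H) (t : kmor phi F G) z :
  hmap n (kcomp u t) z = hmap n u (hmap n t z).
Proof.
have ccomp (F' : kfun K C) (G' : kfun K D) (H' : kfun K E) (u' : kmor psi G' H')
    (t' : kmor phi F' G') w : colim_map (kcomp u' t') w = colim_map u' (colim_map t' w).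
  move: w; apply: (colim_ext (g := cmplin (colim_map u') (colim_map t'))) => a x.
  by rewrite cmplinE !colim_mapE.
have ocomp (F' : kfun K C) (G' : kfun K D) (H' : kfun K E) (u' : kmor psi G' H')
    (t' : kmor phi F' G') a x :
    lomega_map (kcomp u' t') a x = kcomp (lomega_map u') (lomega_map t') a x.
  apply: (linj_eq (@lomega_inj _ _ _ _)); rewrite lomega_mapE [RHS]/=.
  by apply: (lcov_ext (v := cmplin (lcov_map u' _) (lcov_map t' _))) => b f y;
     rewrite cmplinE !lcov_mapE.
case: n z => [|n] z; first exact: ccomp.
elim: n F G H u t z => [|n IH] F G H u t z.
  apply: (linj_eq (@ker_in_inj _ _ _ _)).
  by rewrite !homol1_mapE -ccomp; apply/colim_map_ext/ocomp.
by rewrite -[LHS]/(hmap n.+1 (lomega_map (kcomp u t)) z) (hmap_ext (ocomp _ _ _ u t)) IH.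
Qed.
End Compose.

Section Split.
Variables (O : Type) (C : category O).

(** Relative projectivity with respect to the counit; it is the criterion for acyclicity used
    here. *)
Definition lsplit (F : kfun K C) :=
  exists s : knat F (lcov F), forall c x, leps F c (s c x) = x.

(** The section is the comultiplication of the comonad: the summand of [f : a -> c] goes to the
    summand of [f], and inside it to the summand of [id_a]. *)
Lemma lsplit_lcov (F : kfun K C) : lsplit (lcov F).
Proof.
pose s c : {linear lcov F c -> lcov (lcov F) c} :=
  lcov_lift (fun a f => cmplin (lcov_in (lcov F) f) (lcov_in F (idm C a))).
have sE c a (f : mor C a c) x :
  s c (lcov_in F f x) = lcov_in (lcov F) f (lcov_in F (idm C a) x) by exact: lcov_liftE.
have sN a b (f : mor C a b) x : s b (km (lcov F) f x) = km (lcov (lcov F)) f (s a x).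
  apply: (lcov_ext (u := cmplin (s b) (km (lcov F) f))
    (v := cmplin (km (lcov (lcov F)) f) (s a))) => c g y.
  by rewrite !cmplinE lcov_kmE !sE lcov_kmE.
exists (@KMor K _ _ _ _ (functor_id C) (lcov F) (lcov (lcov F)) s sN) => c.
apply: (lcov_ext (u := cmplin (leps (lcov F) c) (s c)) (v := idlin _)) => a f x.
by rewrite cmplinE sE leps_funE lcov_kmE cmpm1.
Qed.

Section OneSplit.
Variable F : kfun K C.

(** [1 - s leps] takes values in the kernel of [leps] and is the identity there. *)
Lemma lsplit_retraction : lsplit F ->
  exists r : knat (lcov F) (lomega F), forall c x, r c (lomega_in F c x) = x.
Proof.
move=> [s sP].
pose r c := sublin (idlin (lcov F c)) (cmplin (s c) (leps F c)).
have rE c x : r c x = x - s c (leps F c x) by [].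
have rk c x : leps F c (r c x) = 0 by rewrite rE linearB sP subrr.
have rN a b (f : mor C a b) x :
    ker_lift (@rk b) (km (lcov F) f x) = km (lomega F) f (ker_lift (@rk a) x).
  apply: val_inj; rewrite -[LHS]/(r b (km (lcov F) f x)) -[RHS]/(km (lcov F) f (r a x)) !rE.
  by rewrite linearB (kaN (leps F)) (kaN s).
exists (@KMor K _ _ _ _ (functor_id C) (lcov F) (lomega F) (fun c => ker_lift (@rk c)) rN) => c x.
apply: val_inj; rewrite -[LHS]/(r c (lomega_in F c x)) rE.
by rewrite [leps F c _](ker_inP x) linear0 subr0.
Qed.

Lemma lsplit_lomega : lsplit F -> lsplit (lomega F).
Proof.
move=> /lsplit_retraction[r rP]; have [s sP] := lsplit_lcov F.
have tN a b (f : mor C a b) x :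
    cmplin (lcov_map r b) (cmplin (s b) (lomega_in F b)) (km (lomega F) f x) =
    km (lcov (lomega F)) f (cmplin (lcov_map r a) (cmplin (s a) (lomega_in F a)) x).
  by rewrite !cmplinE (kaN (lomega_in F)) (kaN s) (kaN (lcov_map r)).
exists (@KMor K _ _ _ _ (functor_id C) (lomega F) (lcov (lomega F)) _ tN) => c x.
have := leps_lcov_map r (s c (lomega_in F c x)); rewrite sP rP => E.
exact: E.
Qed.
End OneSplit.

(** The retraction of [lcov F] onto [lomega F] makes [colim (lomega F) -> colim (lcov F)] injective,
    and [lsplit_lomega] carries this to higher degrees. *)
Lemma lsplit_h n F : lsplit F -> forall z : homol n.+1 F, z = 0.
Proof.
elim: n F => [|n IH] F sF z; last exact: (IH _ (lsplit_lomega sF)).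
have [r rP] := lsplit_retraction sF.
apply: ker_in_inj; rewrite -[LHS](colim_ext (f := cmplin (colim_map r) (colim_map (lomega_in F))) (g := idlin _)).
  by rewrite cmplinE ker_inP linear0.
by move=> a x; rewrite cmplinE !colim_mapE rP.
Qed.
End Split.

(** * Invariance of homology under natural transformations of functors *)

Section Invariance.
Variables (O O' : Type) (C : category O) (D : category O').
Variables (phi psi : functor C D) (theta : forall a, mor D (phi a) (psi a)).
Hypothesis thetaN : forall a b (f : mor C a b),
  cmp D (theta b) (fmap phi f) = cmp D (fmap psi f) (theta a).

(** On covers, [theta] after [lcov_map t] and [lcov_map t'] hit different summands, but they agree
    after [leps]. Their difference is [d], which is defined on all of [lcov F]. *)
Lemma lomega_map_homotopy (F : kfun K C) (G : kfun K D) (t : kmor phi F G) (t' : kmor psi F G) :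
  (forall a x, t' a x = km G (theta a) (t a x)) ->
  exists d : kmor psi (lcov F) (lomega G),
    forall c x, km (lomega G) (theta c) (lomega_map t c x) =
                lomega_map t' c x + d c (lomega_in F c x).
Proof.
move=> tt'.
pose L c := sublin (cmplin (km (lcov G) (theta c)) (lcov_map t c)) (lcov_map t' c).
have LE c x : L c x = km (lcov G) (theta c) (lcov_map t c x) - lcov_map t' c x by [].
have Lk c x : leps G (psi c) (L c x) = 0.
  rewrite LE linearB (kaN (leps G)) !leps_lcov_map -[X in X - _]/(km G (theta c) _).
  by rewrite -tt' subrr.
have dN a b (f : mor C a b) x :
    ker_lift (@Lk b) (km (lcov F) f x) = km (lomega G) (fmap psi f) (ker_lift (@Lk a) x).
  apply: val_inj.
  rewrite -[RHS]/(km (lcov G) (fmap psi f) (L a x)) -[LHS]/(L b (km (lcov F) f x)) !LE.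
  by rewrite !kaN linearB; congr (_ - _); rewrite -!kmM thetaN.
exists (@KMor K _ _ _ _ psi (lcov F) (lomega G) (fun c => ker_lift (@Lk c)) dN) => c x.
by apply: (linj_eq (@lomega_inj _ _ _ _)); rewrite linearD addrC -[X in X + _]/(L c (lomega_in F c x)) LE subrK.
Qed.

(** The two maps on syzygies differ by one that factors through [lcov F], which is acyclic. For
    groups this says that conjugation acts trivially; with identity components it compares two
    composites of functors. *)
Lemma hmap_nat n (F : kfun K C) (G : kfun K D) (t : kmor phi F G) (t' : kmor psi F G) :
  (forall a x, t' a x = km G (theta a) (t a x)) -> forall z, hmap n t z = hmap n t' z.
Proof.
have c0 (F' : kfun K C) (G' : kfun K D) (u : kmor phi F' G') (u' : kmor psi F' G') :
    (forall a x, u' a x = km G' (theta a) (u a x)) -> forall z, colim_map u z = colim_map u' z.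
  by move=> uu'; apply: colim_ext => a x; rewrite !colim_mapE uu' colim_inE.
case: n => [|n]; first exact: c0.
elim: n F G t t' => [|n IH] F G t t' tt' z.
(* Both cases of the induction decompose [u], the transport of [lomega_map t] along [theta], as
   [lomega_map t'] plus a term [v] through [lcov F]. *)
all: have [d dP] := lomega_map_homotopy tt'.
all: have uN a b (f : mor C a b) x :
    cmplin (km (lomega G) (theta b)) (lomega_map t b) (km (lomega F) f x) =
    km (lomega G) (fmap psi f) (cmplin (km (lomega G) (theta a)) (lomega_map t a) x)
  by rewrite !cmplinE kaN -!kmM thetaN.
all: pose u := @KMor K _ _ _ _ psi (lomega F) (lomega G) _ uN.
all: have vN a b (f : mor C a b) x : cmplin (d b) (lomega_in F b) (km (lomega F) f x) =
    km (lomega G) (fmap psi f) (cmplin (d a) (lomega_in F a) x)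
  by rewrite !cmplinE (kaN (lomega_in F)) kaN.
all: pose v := @KMor K _ _ _ _ psi (lomega F) (lomega G) _ vN.
all: have uv a x : u a x = lomega_map t' a x + v a x by exact: dP.
  apply: (linj_eq (@ker_in_inj _ _ _ _)); rewrite !homol1_mapE (c0 _ _ _ u)//.
  rewrite [LHS](hmap_add (n := 0) uv) -[RHS]addr0; congr (_ + _).
  have -> : colim_map v (ker_in _ z) = colim_map d (colim_map (lomega_in F) (ker_in _ z)).
    by apply: (hmap_compr (n := 0)).
  by rewrite ker_inP linear0.
rewrite -[LHS]/(hmap n.+1 (lomega_map t) z) (IH _ _ _ u)// (hmap_add uv).
rewrite -[RHS]addr0; congr (_ + _).
rewrite (hmap_compr (n := n.+1) (u := d) (i := lomega_in F))//.
by rewrite (lsplit_h (lsplit_lcov F) (hmap n.+1 _ _)) linear0.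
Qed.
End Invariance.
End LinearCover.

(** * The long exact sequence of a short exact sequence of functors *)

Section LongExact.
Variable K : fieldType.

Section ExactCover.
Variables (O : Type) (C : category O).

Lemma lcov_map_dsum (A B : kfun K C) (i : knat A B) c x :
  lcov_map i c x = dsum_map (fun p : lidx C c => i (projT1 p)) x.
Proof.
by apply: lcov_ext => a f y; rewrite lcov_mapE [RHS]dsum_mapE.
Qed.

Lemma lcov_map_linj (A B : kfun K C) (i : knat A B) :
  (forall c, linj (i c)) -> forall c, linj (lcov_map i c).
Proof. by move=> ii c x; rewrite lcov_map_dsum; apply: dsum_map_linj => p; apply: ii. Qed.

Lemma lcov_map_lexact (A B D : kfun K C) (i : knat A B) (q : knat B D) :
  (forall c, lexact (i c) (q c)) -> forall c, lexact (lcov_map i c) (lcov_map q c).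
Proof.
move=> ex c y; rewrite lcov_map_dsum.
have := @dsum_map_lexact K _ _ _ _ (fun p : lidx C c => i (projT1 p))
  (fun p : lidx C c => q (projT1 p)) (fun p => ex _) y.
move=> ->; split=> -[x <-]; exists x; by rewrite lcov_map_dsum.
Qed.

Lemma lcov_map_lsurj (B D : kfun K C) (q : knat B D) :
  (forall c, lsurj (q c)) -> forall c, lsurj (lcov_map q c).
Proof.
move=> qs c y.
have [x <-] := @dsum_map_lsurj K _ _ _ (fun p : lidx C c => q (projT1 p)) (fun p => qs _) y.
by exists x; rewrite lcov_map_dsum.
Qed.

Section ColimCover.
Variable F : kfun K C.

Definition lcov_colim_fun c : {linear lcov F c -> dsum F} := lcov_lift (fun a f => dsum_in F a).
Lemma lcov_colim_subproof a b (f : mor C a b) x :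
  lcov_colim_fun b (km (lcov F) f x) = lcov_colim_fun a x.
Proof.
apply: (lcov_ext (u := cmplin (lcov_colim_fun b) (km (lcov F) f))) => c g y.
by rewrite cmplinE lcov_kmE /lcov_colim_fun !lcov_liftE.
Qed.
Definition lcov_colim : {linear colim (lcov F) -> dsum F} := colim_lift lcov_colim_subproof.
Lemma lcov_colimE c a (f : mor C a c) x :
  lcov_colim (colim_in (lcov F) c (lcov_in F f x)) = dsum_in F a x.
Proof. by rewrite /lcov_colim colim_liftE /lcov_colim_fun lcov_liftE. Qed.

Lemma colim_lcov_in c a (f : mor C a c) x :
  colim_in (lcov F) c (lcov_in F f x) = colim_in (lcov F) a (lcov_in F (idm C a) x).
Proof. by rewrite -[in RHS](colim_inE f) lcov_kmE cmpm1. Qed.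

(** In the colimit the summand of [f : a -> c] is identified with that of [id_a], so sending [F a]
    to the latter is a left inverse. *)
Lemma lcov_colim_inj : linj lcov_colim.
Proof.
pose g : {linear dsum F -> colim (lcov F)} :=
  dsum_lift (fun a => cmplin (colim_in (lcov F) a) (lcov_in F (idm C a))).
move=> x x0; rewrite -[x](colim_ext (f := cmplin g lcov_colim) (g := idlin _)).
  by rewrite cmplinE x0 linear0.
move=> c y; rewrite cmplinE idlinE.
apply: (lcov_ext (u := cmplin g (cmplin lcov_colim (colim_in (lcov F) c)))
  (v := colim_in (lcov F) c)) => a f {}y.
by rewrite !cmplinE lcov_colimE /g dsum_liftE cmplinE [RHS]colim_lcov_in.
Qed.
End ColimCover.

(** Colimits do not preserve injectivity in general, but [colim (lcov F)] is the direct sum of the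
    [F a], and direct sums do. *)
Lemma colim_lcov_map_linj (A B : kfun K C) (i : knat A B) :
  (forall c, linj (i c)) -> linj (colim_map (lcov_map i)).
Proof.
move=> ii x x0; apply: lcov_colim_inj; apply: (dsum_map_linj ii).
rewrite -[RHS](linear0 (lcov_colim B)) -x0.
apply: (colim_ext (f := cmplin (dsum_map i) (lcov_colim A))
  (g := cmplin (lcov_colim B) (colim_map (lcov_map i)))) => c {x0}x.
rewrite !cmplinE colim_mapE.
apply: (lcov_ext (u := cmplin (dsum_map i) (cmplin (lcov_colim A) (colim_in (lcov A) c)))
  (v := cmplin (lcov_colim B) (cmplin (colim_in (lcov B) c) (lcov_map i c)))) => a f {}x.
by rewrite !cmplinE lcov_mapE !lcov_colimE dsum_mapE.
Qed.

Definition kses (A B D : kfun K C) (i : knat A B) (q : knat B D) :=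
  forall c, [/\ linj (i c), lexact (i c) (q c) & lsurj (q c)].

Section Ses.
Variables (A B D : kfun K C) (i : knat A B) (q : knat B D).
Hypothesis S : kses i q.

Let ii c : linj (i c). Proof. by have [] := S c. Qed.
Let iq c : lexact (i c) (q c). Proof. by have [] := S c. Qed.
Let qs c : lsurj (q c). Proof. by have [] := S c. Qed.

(** The nine lemma: the given sequence and that of the covers are exact, hence so is that of the
    kernels. *)
Lemma lomega_kses : kses (lomega_map i) (lomega_map q).
Proof.
have Lz c z : lcov_map q c (lcov_map i c z) = 0 by apply/lcov_map_lexact => //; exists z.
move=> c; split.
- move=> x x0; apply: lomega_inj; apply: (lcov_map_linj ii).
  by rewrite -lomega_mapE x0 linear0.
- move=> z; split=> [z0|[x <-]]; last by apply: lomega_inj; rewrite !lomega_mapE Lz.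
  have [w wz] : exists w, lcov_map i c w = lomega_in B c z.
    by apply/lcov_map_lexact => //; rewrite -lomega_mapE z0 linear0.
  have [x xw] : exists x, lomega_in A c x = w.
    apply/lomega_lexact/ii; rewrite -leps_lcov_map wz.
    exact: (ker_inP z).
  by exists x; apply: (linj_eq (@lomega_inj _ _ _ _ _)); rewrite lomega_mapE xw wz.
- move=> z; have [y yz] := lcov_map_lsurj qs (lomega_in D c z).
  have [a ay] : exists a, i c a = leps B c y.
    by apply/iq; rewrite -leps_lcov_map yz; exact: (ker_inP z).
  have [a' aa'] := leps_surj a.
  have [x xE] : exists x, lomega_in B c x = y - lcov_map i c a'.
    by apply/lomega_lexact; rewrite linearB leps_lcov_map aa' ay subrr.
  exists x; apply: (linj_eq (@lomega_inj _ _ _ _ _)).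
  by rewrite lomega_mapE xE linearB Lz subr0 yz.
Qed.

Let cmLi := colim_lcov_map_linj ii.
Let oiq : kses (lomega_map i) (lomega_map q) := lomega_kses.

Lemma colim_lcov_lexact : lexact (colim_map (lcov_map i)) (colim_map (lcov_map q)).
Proof. by apply: colim_map_lexact; [apply: lcov_map_lexact|apply: lcov_map_lsurj]. Qed.

Lemma colim_lomega_lexact : lexact (colim_map (lomega_map i)) (colim_map (lomega_map q)).
Proof. by apply: colim_map_lexact => c; have [] := oiq c. Qed.

Lemma colim_lomega_lsurj : lsurj (colim_map (lomega_map q)).
Proof. by apply: colim_map_lsurjN => c; have [] := oiq c. Qed.

Lemma colim_leps_lexact (F : kfun K C) : lexact (colim_map (lomega_in F)) (colim_map (leps F)).
Proof. by apply: colim_map_lexact; [apply: lomega_lexact|apply: leps_surj]. Qed.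

Lemma colim_leps_lsurj (F : kfun K C) : lsurj (colim_map (leps F)).
Proof. exact/colim_map_lsurjN/leps_surj. Qed.

Lemma colim_leps_lcov_map O' (D' : category O') (phi : functor C D') (F : kfun K C) (G : kfun K D')
    (t : kmor phi F G) x :
  colim_map (leps G) (colim_map (lcov_map t) x) = colim_map t (colim_map (leps F) x).
Proof.
apply: (colim_ext (f := cmplin (colim_map (leps G)) (colim_map (lcov_map t)))
  (g := cmplin (colim_map t) (colim_map (leps F)))) => a {}x.
by rewrite !cmplinE !colim_mapE leps_lcov_map.
Qed.

(** The graph of the snake map for the rows [colim (lomega _)] and [colim (lcov _)]; [y] and [a']
    are the intermediate elements of the chase. *)
Definition snake_rel (z : homol1 D) (a : colim A) := exists y a',
  [/\ colim_map (lomega_map q) y = ker_in _ z,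
      colim_map (lcov_map i) a' = colim_map (lomega_in B) y &
      colim_map (leps A) a' = a].

Lemma snake_exists : exists f : {linear homol1 D -> colim A}, forall z a, snake_rel z a <-> f z = a.
Proof.
apply: lin_of_rel.
- move=> c z z' a a' [y [b [yz by_ ba]]] [y' [b' [yz' by' ba']]].
  by exists (c *: y + y'), (c *: b + b'); rewrite !linearP yz yz' by_ by' ba ba'.
- move=> z; have [y yz] := colim_lomega_lsurj (ker_in _ z).
  have [a' a'y] : exists a', colim_map (lcov_map i) a' = colim_map (lomega_in B) y.
    by apply/colim_lcov_lexact; rewrite -homol1_map_subproof yz ker_inP.
  by exists (colim_map (leps A) a'), y, a'.
- move=> a [y [a' [y0 a'y <-]]]; move: y0; rewrite linear0 => /colim_lomega_lexact[w wy].
  apply/colim_leps_lexact; exists w; apply: (linj_eq cmLi).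
  by rewrite a'y -wy homol1_map_subproof.
Qed.

Definition delta0 : {linear homol1 D -> colim A} := sval (cid snake_exists).
Lemma delta0P z a : snake_rel z a <-> delta0 z = a.
Proof. by rewrite /delta0; case: cid. Qed.

Lemma exact0A a : colim_map i a = 0 <-> exists z, delta0 z = a.
Proof.
split=> [|[z /delta0P[y [a' [yz a'y <-]]]]]; last first.
  by rewrite -colim_leps_lcov_map a'y; apply/colim_leps_lexact; exists y.
have [a' <-] := colim_leps_lsurj a; rewrite -colim_leps_lcov_map => /colim_leps_lexact[y ya'].
have [z zy] : exists z, ker_in (colim_map (lomega_in D)) z = colim_map (lomega_map q) y.
  apply: ker_inE; rewrite homol1_map_subproof ya'.
  by apply/colim_lcov_lexact; exists a'.
by exists z; apply/delta0P; exists y, a'; rewrite zy ya'.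
Qed.

Lemma exact0D z : delta0 z = 0 <-> exists b, homol1_map q b = z.
Proof.
split=> [/delta0P[y [a' [yz a'y /colim_leps_lexact[w wa']]]]|[b <-]]; last first.
  by apply/delta0P; exists (ker_in _ b), 0; rewrite ker_inP !linear0.
have [b bE] : exists b, ker_in (colim_map (lomega_in B)) b = y - colim_map (lomega_map i) w.
  by apply: ker_inE; rewrite linearB homol1_map_subproof wa' a'y subrr.
exists b; apply: (linj_eq (@ker_in_inj _ _ _ _)); rewrite homol1_mapE bE linearB yz.
by rewrite (_ : colim_map _ (colim_map _ w) = 0) ?subr0//; apply/colim_lomega_lexact; exists w.
Qed.

Lemma exact1B b : homol1_map q b = 0 <-> exists a, homol1_map i a = b.
Proof.
split=> [b0|[a <-]]; last first.
  apply: ker_in_inj; rewrite !homol1_mapE; apply/colim_lomega_lexact.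
  by exists (ker_in _ a).
have [w wb] : exists w, colim_map (lomega_map i) w = ker_in _ b.
  by apply/colim_lomega_lexact; rewrite -homol1_mapE b0 linear0.
have [a aw] : exists a, ker_in (colim_map (lomega_in A)) a = w.
  by apply/ker_inE/cmLi; rewrite -homol1_map_subproof wb ker_inP.
by exists a; apply: (linj_eq (@ker_in_inj _ _ _ _)); rewrite homol1_mapE aw.
Qed.
End Ses.

Lemma delta1_subproof (A B D : kfun K C) (i : knat A B) (q : knat B D) (S : kses i q)
  (z : homol 2 D) : colim_map (lomega_in A) (delta0 (lomega_kses S) z) = 0.
Proof.
apply: (colim_lcov_map_linj (i := i)) => [c|]; first by have [] := S c.
rewrite -homol1_map_subproof (_ : colim_map (lomega_map i) _ = 0) ?linear0//.
by apply/(exact0A (lomega_kses S)); exists z.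
Qed.

(** Into degree one the target [homol 1 A] is a kernel inside [colim (lomega A)], so the snake map
    of the syzygies is corestricted to it. Above that the types of the recursive call are
    convertible to the required ones. The call is passed as an argument so that the inner match can
    refine [m]. *)
Fixpoint delta n (A B D : kfun K C) (i : knat A B) (q : knat B D) (S : kses i q) :
    {linear homol n.+1 D -> homol n A} :=
  match n with
  | 0 => delta0 S
  | m.+1 =>
    match m return (forall A B D (i : knat A B) (q : knat B D), kses i q ->
        {linear homol m.+1 D -> homol m A}) -> {linear homol m.+2 D -> homol m.+1 A} with
    | 0 => fun _ => ker_lift (delta1_subproof S)
    | k.+1 => fun rec => rec _ _ _ _ _ (lomega_kses S)
    end (delta m)
  end.

Section Exactness.
Variables (A B D : kfun K C) (i : knat A B) (q : knat B D) (S : kses i q).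
Lemma kses_h_lexactB n : lexact (hmap n i) (hmap n q).
Proof.
case: n => [|n]; first by apply: colim_map_lexact => c; have [] := S c.
elim: n A B D i q S => [|n IH] A' B' D' i' q' S'; first by move=> b; apply: exact1B.
exact: (IH _ _ _ _ _ (lomega_kses S')).
Qed.

Lemma kses_h_lexactD n : lexact (hmap n.+1 q) (delta n S).
Proof.
case: n => [|n]; first by move=> z; apply: exact0D.
elim: n A B D i q S => [|n IH] A' B' D' i' q' S'; last exact: (IH _ _ _ _ _ (lomega_kses S')).
move=> z; have := exact0D (lomega_kses S') z.
move=> E; apply: iff_trans E; split=> [z0|z0]; last exact: ker_in_inj.
exact: (congr1 (fun x => ker_in _ x) z0).
Qed.

Lemma kses_h_lexactA n : lexact (delta n S) (hmap n i).
Proof.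
case: n => [|n]; first by move=> z; apply: exact0A.
elim: n A B D i q S => [|n IH] A' B' D' i' q' S'; last exact: (IH _ _ _ _ _ (lomega_kses S')).
move=> a; split=> [a0|[z <-]].
  have [|z zE] := (exact0A (lomega_kses S') (ker_in _ a)).1.
    by rewrite -homol1_mapE [homol1_map _ _]a0 linear0.
  by exists z; apply: (linj_eq (@ker_in_inj _ _ _ _)); rewrite -zE.
apply: ker_in_inj; rewrite [LHS]homol1_mapE; apply/(exact0A (lomega_kses S')).
by exists z.
Qed.

Lemma kses_h_lsurj : lsurj (hmap 0 q).
Proof. by apply: colim_map_lsurjN => c; have [] := S c. Qed.
End Exactness.
End ExactCover.

Section Naturality.
Variables (O O' : Type) (C : category O) (C' : category O') (phi : functor C C').

Lemma delta_nat n (A B D : kfun K C) (i : knat A B) (q : knat B D) (S : kses i q)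
    (A' B' D' : kfun K C') (i' : knat A' B') (q' : knat B' D') (S' : kses i' q')
    (tA : kmor phi A A') (tB : kmor phi B B') (tD : kmor phi D D') :
  (forall a x, tB a (i a x) = i' _ (tA a x)) ->
  (forall a x, tD a (q a x) = q' _ (tB a x)) ->
  forall z, delta n S' (hmap n.+1 tD z) = hmap n tA (delta n S z).
Proof.
have csq (F G : kfun K C) (F' G' : kfun K C') (j : knat F G) (j' : knat F' G')
    (tF : kmor phi F F') (tG : kmor phi G G') :
    (forall a x, tG a (j a x) = j' _ (tF a x)) ->
    forall x, colim_map tG (colim_map j x) = colim_map j' (colim_map tF x).
  move=> sq; apply: (colim_ext (f := cmplin (colim_map tG) (colim_map j))
    (g := cmplin (colim_map j') (colim_map tF))) => a x.
  by rewrite !cmplinE !colim_mapE sq.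
have lsq (F G : kfun K C) (F' G' : kfun K C') (j : knat F G) (j' : knat F' G')
    (tF : kmor phi F F') (tG : kmor phi G G') :
    (forall a x, tG a (j a x) = j' _ (tF a x)) ->
    forall a x, lcov_map tG a (lcov_map j a x) = lcov_map j' _ (lcov_map tF a x).
  move=> sq a; apply: (lcov_ext (u := cmplin (lcov_map tG a) (lcov_map j a))
    (v := cmplin (lcov_map j' _) (lcov_map tF a))) => b f x.
  by rewrite !cmplinE !lcov_mapE sq.
have osq (F G : kfun K C) (F' G' : kfun K C') (j : knat F G) (j' : knat F' G')
    (tF : kmor phi F F') (tG : kmor phi G G') :
    (forall a x, tG a (j a x) = j' _ (tF a x)) ->
    forall a x, lomega_map tG a (lomega_map j a x) = lomega_map j' _ (lomega_map tF a x).
  move=> sq a x; apply: (linj_eq (@lomega_inj _ _ _ _ _)).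
  by rewrite !lomega_mapE; apply: lsq.
have nat0 (F G H : kfun K C) (i0 : knat F G) (q0 : knat G H) (S0 : kses i0 q0)
    (F' G' H' : kfun K C') (i0' : knat F' G') (q0' : knat G' H') (S0' : kses i0' q0')
    (tF : kmor phi F F') (tG : kmor phi G G') (tH : kmor phi H H') :
    (forall a x, tG a (i0 a x) = i0' _ (tF a x)) ->
    (forall a x, tH a (q0 a x) = q0' _ (tG a x)) ->
    forall z, delta0 S0' (homol1_map tH z) = colim_map tF (delta0 S0 z).
  move=> sqi sqq z; apply/delta0P.
  have /delta0P[y [a' [yz a'y <-]]] := erefl (delta0 S0 z).
  exists (colim_map (lomega_map tG) y), (colim_map (lcov_map tF) a'); split.
  - by rewrite homol1_mapE -yz; symmetry; apply: (csq); apply: osq.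
  - rewrite homol1_map_subproof -a'y; symmetry; apply: csq; exact: lsq.
  - exact: colim_leps_lcov_map.
case: n => [|n] sqi sqq z; first exact: nat0 sqi sqq z.
elim: n A B D i q S A' B' D' i' q' S' tA tB tD sqi sqq z => [|n IH].
  move=> A B D i q S A' B' D' i' q' S' tA tB tD sqi sqq z.
  apply: (linj_eq (@ker_in_inj _ _ _ _)); rewrite [RHS]homol1_mapE.
  exact: (nat0 _ _ _ _ _ (lomega_kses S) _ _ _ _ _ (lomega_kses S') _ _ _ (osq _ _ _ _ _ _ _ _ sqi)
    (osq _ _ _ _ _ _ _ _ sqq)).
move=> A B D i q S A' B' D' i' q' S' tA tB tD sqi sqq z.
exact: (IH _ _ _ _ _ (lomega_kses S) _ _ _ _ _ (lomega_kses S') _ _ _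
  (osq _ _ _ _ _ _ _ _ sqi) (osq _ _ _ _ _ _ _ _ sqq)).
Qed.
End Naturality.
End LongExact.

(** * Agreement with [cat_homology] *)

Section Comparison.
Variable K : fieldType.

Definition hfam := forall O (C : category O), kfun K C -> lmodType K.
Definition hmaps (A : hfam) := forall O O' (C : category O) (D : category O')
  (phi : functor C D) (F : kfun K C) (G : kfun K D), kmor phi F G -> {linear A _ _ F -> A _ _ G}.

(** The families range over all categories at once, so that naturality covers change of category
    along [phi]; the maps [Psi_n] and [to_stable] are of this kind. *)
Definition natiso (A : hfam) (Am : hmaps A) (B : hfam) (Bm : hmaps B) :=
  exists b : forall O (C : category O) (F : kfun K C), {linear A _ _ F -> B _ _ F},
    (forall O (C : category O) (F : kfun K C), lbij (b _ _ F)) /\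
    (forall O O' (C : category O) (D : category O') (phi : functor C D) (F : kfun K C)
       (G : kfun K D) (t : kmor phi F G) x, b _ _ G (Am _ _ _ _ _ _ _ t x) = Bm _ _ _ _ _ _ _ t (b _ _ F x)).

Lemma natiso_trans A Am B Bm D Dm : @natiso A Am B Bm -> @natiso B Bm D Dm -> @natiso A Am D Dm.
Proof.
move=> [b [bb bN]] [c [cb cN]]; exists (fun O C F => cmplin (c O C F) (b O C F)); split.
  move=> O C F; split=> [x x0|y]; first exact/(bb _ _ _).1/(cb _ _ _).1.
  by have [z <-] := (cb _ _ F).2 y; have [x <-] := (bb _ _ F).2 z; exists x.
by move=> *; rewrite !cmplinE bN cN.
Qed.

Lemma natiso_sym A Am B Bm : @natiso A Am B Bm -> @natiso B Bm A Am.
Proof.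
move=> [b [bb bN]].
have ex O (C : category O) (F : kfun K C) := linv_exists (bb _ _ F).
exists (fun O C F => sval (cid (ex O C F))); split.
  move=> O C F; case: cid => g [gl gr] /=; split=> [x x0|y].
    by rewrite -(gr x) x0 linear0.
  by exists (b _ _ F y).
move=> O O' C D phi F G t x; case: cid => g [gl gr] /=; case: cid => g' [gl' gr'] /=.
by rewrite -{1}(gr' x) -bN gl.
Qed.

Section Cover.
Variables (O : Type) (C : category O) (F : kfun K C).

Lemma cover_kses : kses (omega_in F) (eps F).
Proof.
by move=> c; split; [apply: ker_in_inj|apply: ker_lexact|move=> y; apply: eps_surj].
Qed.

(** [cover F] is a sum of representable functors: the generator of [x] and [f] goes to the summand
    of [f], at the generator of [x] and an identity. Hence [cover F] is acyclic for [homol] too. *)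
Lemma lsplit_cover : lsplit (cover F).
Proof.
pose s c : {linear cover F c -> lcov (cover F) c} :=
  free_lift (fun p : cover_gen F c => lcov_in (cover F) (projT2 p).2
    (gen K (cover_elt (projT2 p).1 (idm C (projT1 p))))).
have sE c a (x : F a) (f : mor C a c) : s c (gen K (cover_elt x f)) =
    lcov_in (cover F) f (gen K (cover_elt x (idm C a))) by rewrite /s free_liftE.
have sN a b (f : mor C a b) x : s b (km (cover F) f x) = km (lcov (cover F)) f (s a x).
  apply: (free_ext (f := cmplin (s b) (km (cover F) f))
    (g := cmplin (km (lcov (cover F)) f) (s a))) => -[c [y g]].
  by rewrite !cmplinE cover_kmE !sE lcov_kmE.
exists (@KMor K _ _ _ _ (functor_id C) (cover F) (lcov (cover F)) s sN) => c.
apply: (free_ext (f := cmplin (leps (cover F) c) (s c)) (g := idlin _)) => -[a [y f]].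
by rewrite cmplinE sE leps_funE cover_kmE cmpm1.
Qed.

Lemma delta_cover_bij n : lbij (delta n.+1 (cover_kses)).
Proof.
split=> [z z0|y].
  have [x <-] := (kses_h_lexactD cover_kses z).1 z0.
  have -> := @lsplit_h K _ _ n.+1 (cover F) lsplit_cover x.
  exact: linear0.
apply/(kses_h_lexactA cover_kses).
exact: (lsplit_h lsplit_cover).
Qed.

Definition ker0 : lmodType K := kernel (colim_map (omega_in F)).

Lemma delta_cover0_subproof z : colim_map (omega_in F) (delta 0 cover_kses z) = 0.
Proof. by apply/(kses_h_lexactA cover_kses (n := 0)); exists z. Qed.

Definition delta_cover0 : {linear homol 1 F -> ker0} := ker_lift delta_cover0_subproof.

Lemma delta_cover0_bij : lbij delta_cover0.
Proof.
split=> [z z0|y].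
  have [|x <-] := (kses_h_lexactD cover_kses (n := 0) z).1.
    exact: (congr1 (fun u => ker_in _ u) z0).
  by rewrite (lsplit_h lsplit_cover x) linear0.
have [z zy] := (kses_h_lexactA cover_kses (n := 0) (ker_in _ y)).1 (ker_inP y).
by exists z; apply: (linj_eq (@ker_in_inj _ _ _ _)).
Qed.
End Cover.

Section CoverMap.
Variables (O O' : Type) (C : category O) (D : category O') (phi : functor C D).
Variables (F : kfun K C) (G : kfun K D) (t : kmor phi F G).

Lemma ker0_map_subproof x : colim_map (omega_in G) (colim_map (omega_map t) x) =
  colim_map (cover_map t) (colim_map (omega_in F) x).
Proof.
apply: (colim_ext (f := cmplin (colim_map (omega_in G)) (colim_map (omega_map t)))
  (g := cmplin (colim_map (cover_map t)) (colim_map (omega_in F)))) => a y.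
by rewrite !cmplinE !colim_mapE.
Qed.
Definition ker0_map : {linear ker0 F -> ker0 G} := ker_map ker0_map_subproof.

Lemma delta_cover_nat n z :
  delta n (cover_kses G) (hmap n.+1 t z) = hmap n (omega_map t) (delta n (cover_kses F) z).
Proof.
apply: (@delta_nat K _ _ _ _ phi n _ _ _ _ _ _ _ _ _ _ _ _ (omega_map t) (cover_map t) t) => // a x.
by rewrite eps_cover_map.
Qed.
End CoverMap.

(** Iterated dimension shift along the free covers, each step trading one degree for one syzygy. *)
Lemma h_syz_natiso j r m : (j + r.+1)%N = m ->
  @natiso (fun O C F => homol m F) (fun O O' C D phi F G t => hmap m t)
    (fun O C F => homol r.+1 (syz F j)) (fun O O' C D phi F G t => hmap r.+1 (syz_map t j)).
Proof.
elim: j r => [|j IH] r.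
  by move=> <-; exists (fun O C F => idlin _); split=> // O C F; split=> // y; exists y.
rewrite addSnnS => /IH/natiso_trans; apply.
exists (fun O C F => delta r.+1 (cover_kses (syz F j))); split=> *; first exact: delta_cover_bij.
exact: delta_cover_nat.
Qed.

Lemma h_ker0_natiso n :
  @natiso (fun O C F => homol n.+1 F) (fun O O' C D phi F G t => hmap n.+1 t)
    (fun O C F => ker0 (syz F n)) (fun O O' C D phi F G t => ker0_map (syz_map t n)).
Proof.
apply: (natiso_trans (h_syz_natiso (addn1 n))).
exists (fun O C F => delta_cover0 (syz F n)); split=> [*|O O' C D phi F G t x].
  exact: delta_cover0_bij.
by apply: (linj_eq (@ker_in_inj _ _ _ _)); apply: (@delta_cover_nat _ _ _ _ _ _ _ (syz_map t n) 0 x).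
Qed.

Section HomologyKer0.
Variables (O : Type) (C : category O) (F : kfun K C).

Lemma bdryE n x : bdry F n.+1 x =
  colim_map (omega_in (syz F n)) (colim_map (eps (syz F n.+1)) x).
Proof.
apply: (colim_ext (f := bdry F n.+1) (g := cmplin (colim_map (omega_in (syz F n)))
  (colim_map (eps (syz F n.+1))))) => a y.
rewrite [LHS](colim_mapE (res_d F n)).
rewrite -[RHS]/(colim_map (omega_in (syz F n)) (colim_map (eps (syz F n.+1))
  (colim_in (cover (syz F n.+1)) a y))).
by rewrite !colim_mapE.
Qed.

Lemma colim_eps_omega (G : kfun K C) x : colim_map (eps G) (colim_map (omega_in G) x) = 0.
Proof.
by apply/(kses_h_lexactB (cover_kses G) (n := 0)); exists x.
Qed.

Lemma hker_subproof n (z : kernel (bdry F n.+1)) :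
  colim_map (omega_in (syz F n)) (cmplin (colim_map (eps (syz F n.+1))) (ker_in _) z) = 0.
Proof. by rewrite cmplinE -bdryE ker_inP. Qed.

Lemma hker_subproof2 n (z : kernel (bdry F n.+1)) :
  (exists a, bdry F n.+2 a = ker_in _ z) -> ker_lift (@hker_subproof n) z = 0.
Proof.
move=> [a az]; apply: ker_in_inj.
rewrite -[LHS]/(colim_map (eps (syz F n.+1)) (ker_in _ z)) -az bdryE.
exact: colim_eps_omega.
Qed.

Definition hker n : {linear cat_homology F n.+1 -> ker0 (syz F n)} := qlift (@hker_subproof2 n).

Lemma hkerE n (z : kernel (bdry F n.+1)) :
  ker_in _ (hker n (qpi _ z)) = colim_map (eps (syz F n.+1)) (ker_in _ z).
Proof. by rewrite /hker qliftE. Qed.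

(** By [bdryE] the boundary factors through [eps] and [omega_in]. As [colim_map eps] is surjective
    with kernel the image of the next syzygy, cycles modulo boundaries are [ker0]. *)
Lemma hker_bij n : lbij (hker n).
Proof.
split=> [x|y].
  have [z ->] := qpi_surj x => z0; apply: qpi_gen.
  have : colim_map (eps (syz F n.+1)) (ker_in _ z) = 0 by rewrite -hkerE z0 linear0.
  move=> /(kses_h_lexactB (cover_kses _) (n := 0))[u uz].
  have [v vu] := kses_h_lsurj (cover_kses (syz F n.+2)) u.
  by exists v; rewrite bdryE -uz -vu.
have [w wy] := kses_h_lsurj (cover_kses (syz F n.+1)) (ker_in _ y).
have [z zw] : exists z, ker_in (bdry F n.+1) z = w.
  by apply: ker_inE; rewrite bdryE; move: wy => ->; apply: ker_inP.
by exists (qpi _ z); apply: (linj_eq (@ker_in_inj _ _ _ _)); rewrite hkerE zw.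
Qed.

Lemma hcolim_subproof (z : kernel (bdry F 0)) :
  (exists a, bdry F 1 a = ker_in _ z) -> cmplin (colim_map (eps F)) (ker_in _) z = 0.
Proof. by move=> [a az]; rewrite cmplinE -az bdryE; apply: colim_eps_omega. Qed.

Definition hcolim : {linear cat_homology F 0 -> colim F} := qlift hcolim_subproof.

Lemma hcolimE (z : kernel (bdry F 0)) : hcolim (qpi _ z) = colim_map (eps F) (ker_in _ z).
Proof. by rewrite /hcolim qliftE. Qed.

Lemma hcolim_bij : lbij hcolim.
Proof.
split=> [x|y].
  have [z ->] := qpi_surj x; rewrite hcolimE => z0; apply: qpi_gen.
  move: z0 => /(kses_h_lexactB (cover_kses _) (n := 0))[u uz].
  have [v vu] := kses_h_lsurj (cover_kses (syz F 1)) u.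
  by exists v; rewrite bdryE -uz -vu.
have [w wy] := kses_h_lsurj (cover_kses F) y.
have [z zw] : exists z, ker_in (bdry F 0) z = w by apply: ker_inE.
by exists (qpi _ z); rewrite hcolimE zw.
Qed.
End HomologyKer0.

Lemma colim_map_eps O O' (C : category O) (D : category O') (phi : functor C D)
    (F : kfun K C) (G : kfun K D) (t : kmor phi F G) x :
  colim_map (eps G) (colim_map (cover_map t) x) = colim_map t (colim_map (eps F) x).
Proof.
apply: (colim_ext (f := cmplin (colim_map (eps G)) (colim_map (cover_map t)))
  (g := cmplin (colim_map t) (colim_map (eps F)))) => a y.
by rewrite !cmplinE !colim_mapE eps_cover_map.
Qed.

Theorem cat_homology_natiso n :
  @natiso (fun O C F => homol n F) (fun O O' C D phi F G t => hmap n t)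
    (fun O C F => cat_homology F n) (fun O O' C D phi F G t => cat_homology_map t n).
Proof.
case: n => [|n].
  apply: natiso_sym; exists (fun O C F => hcolim F); split=> [*|O O' C D phi F G t x].
    exact: hcolim_bij.
  have [z ->] := qpi_surj x; rewrite [X in hcolim G X]qliftE cmplinE !hcolimE.
  exact: colim_map_eps.
apply: (natiso_trans (h_ker0_natiso n)); apply: natiso_sym.
exists (fun O C F => hker F n); split=> [*|O O' C D phi F G t x]; first exact: hker_bij.
have [z ->] := qpi_surj x; rewrite [X in hker G n X]qliftE cmplinE.
apply: (linj_eq (@ker_in_inj _ _ _ _)); rewrite hkerE [RHS]ker_mapE hkerE.
exact: colim_map_eps.
Qed.
End Comparison.

Lemma seq_raise (X : nat -> Type) (s : forall n, X n -> X n.+1) (P : forall n, X n -> Prop) :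
  (forall n x, P n x -> P n.+1 (s n x)) ->
  forall n m x, (n <= m)%N -> P n x -> exists x', P m x'.
Proof.
move=> Ps n m x /subnK <- Px; elim: (m - n)%N => [|k [x' Px']]; first by exists x.
by exists (s _ x'); apply: Ps.
Qed.

(** * Sequential colimits *)

Section ModuleSystems.
Variable K : fieldType.
Implicit Types (M N : nat -> lmodType K).

(** Vanishing after finitely many transition maps. The inductive form avoids transports between
    modules with propositionally equal indices. *)
Inductive evz M (s : forall n, {linear M n -> M n.+1}) : forall n, M n -> Prop :=
| evz_now n : evz s (0 : M n)
| evz_step n (x : M n) : evz s (s n x) -> evz s x.

(** Sequential colimits through their elementwise characterisation, which passes to kernels and
    covers without fixing a construction of the colimit. *)
Definition mcsys M (s : forall n, {linear M n -> M n.+1}) (Minf : lmodType K)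
    (t : forall n, {linear M n -> Minf}) :=
  [/\ forall n x, t n.+1 (s n x) = t n x,
      forall y, exists n x, t n x = y &
      forall n x, t n x = 0 -> evz s x].

Section OneSystem.
Variables (M : nat -> lmodType K) (s : forall n, {linear M n -> M n.+1}).

Lemma evz_sc_up k n (x : M n) : evz s (sc_up (fun n => s n) k x) -> evz s x.
Proof. by elim: k => //= k IH /evz_step/IH. Qed.

Lemma mc_in_evz n (x : M n) : mc_in s n x = 0 -> evz s x.
Proof.
rewrite -(linear0 (mc_in s n)) => /sc_in_eq[k]; set z := sc_up _ k 0.
have -> : z = 0 by rewrite /z; elim: {z} k => //= k ->; rewrite linear0.
by move=> E; apply: (evz_sc_up (k := k)); rewrite E; apply: evz_now.
Qed.

Variables (Minf : lmodType K) (t : forall n, {linear M n -> Minf}) (S : mcsys s t).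

Lemma mcsys_lift (W : lmodType K) (w : forall n, {linear M n -> W}) :
  (forall n x, w n.+1 (s n x) = w n x) ->
  exists f : {linear Minf -> W}, forall n x, f (t n x) = w n x.
Proof.
have [ts tsurj tinj] := S => ws.
have [||v|f fP] := @lin_of_rel K Minf W (fun y v => exists n x, t n x = y /\ w n x = v).
- move=> a u u' v v' [n [x [<- <-]]] [m [x' [<- <-]]].
  pose P y v n (x : M n) := t n x = y /\ w n x = v.
  have PS y v0 n' (x0 : M n') : P y v0 n' x0 -> P y v0 n'.+1 (s n' x0).
    by rewrite /P ts ws.
  have [x1 [<- <-]] := seq_raise (PS (t n x) (w n x)) (leq_maxl n m) (conj erefl erefl).
  have [x2 [<- <-]] := seq_raise (PS (t m x') (w m x')) (leq_maxr n m) (conj erefl erefl).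
  by exists (maxn n m), (a *: x1 + x2); rewrite !linearP.
- by move=> y; have [n [x <-]] := tsurj y; exists (w n x), n, x.
- move=> [n [x [/tinj x0 <-]]]; elim: x0 => [k|k {}x _ <-]; first exact: linear0.
  by rewrite ws.
by exists f => n x; apply/fP; exists n, x.
Qed.
End OneSystem.

Section KernelSystem.
Variables (M N : nat -> lmodType K).
Variables (s : forall n, {linear M n -> M n.+1}) (r : forall n, {linear N n -> N n.+1}).
Variables (Minf Ninf : lmodType K).
Variables (t : forall n, {linear M n -> Minf}) (u : forall n, {linear N n -> Ninf}).
Variables (f : forall n, {linear M n -> N n}) (finf : {linear Minf -> Ninf}).
Hypothesis fs : forall n x, f n.+1 (s n x) = r n (f n x).
Hypothesis ft : forall n x, finf (t n x) = u n (f n x).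

(** Exactness of sequential colimits: if the image of [x] vanishes in [Ninf], it vanishes at a later
    stage, and there [x] is in the kernel. *)
Lemma kernel_mcsys : mcsys s t -> mcsys r u ->
  mcsys (fun n => ker_map (fs (n := n))) (fun n => ker_map (ft (n := n))).
Proof.
move=> [ts tsurj tinj] [ur usurj uinj]; split.
- by move=> n x; apply: (linj_eq (@ker_in_inj _ _ _ _)); rewrite !ker_mapE ts.
- move=> y; have [n [x xy]] := tsurj (ker_in _ y).
  have /uinj fx0 : u n (f n x) = 0 by rewrite -ft xy ker_inP.
  move: fx0 xy; move zE : (f n x) => z fx0.
  elim: fx0 x zE => [k|k {}z _ IH] x zE xy.
    have [x' x'E] := ker_inE zE; exists k, x'.
    by apply: (linj_eq (@ker_in_inj _ _ _ _)); rewrite ker_mapE x'E.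
  by apply: (IH (s k x)); rewrite ?fs ?zE// ts.
- move=> n x /(congr1 (ker_in _)); rewrite ker_mapE linear0 => /tinj.
  move vE : (ker_in _ x) => v ev; elim: ev x vE => [k|k {}v _ IH] x vE.
    by rewrite (ker_in_inj vE); apply: evz_now.
  by apply/evz_step/IH; rewrite ker_mapE vE.
Qed.
End KernelSystem.
End ModuleSystems.

Definition ifunctor (O : Type) (C D : category O) (f : forall a b, mor C a b -> mor D a b)
  (f1 : forall a, f a a (idm C a) = idm D a)
  (fM : forall a b c (g : mor C b c) (e : mor C a b), f a c (cmp C g e) = cmp D (f b c g) (f a b e)) :
  functor C D := @Functor O O C D (fun a => a) f f1 fM.

Section CategorySystems.
Variables (K : fieldType) (O : Type) (C : nat -> category O) (Cinf : category O).
Variables (sm : forall n a b, mor (C n) a b -> mor (C n.+1) a b).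
Hypothesis sm1 : forall n a, sm (idm (C n) a) = idm (C n.+1) a.
Hypothesis smM : forall n a b c (g : mor (C n) b c) (e : mor (C n) a b),
  sm (cmp (C n) g e) = cmp (C n.+1) (sm g) (sm e).
Variables (tm : forall n a b, mor (C n) a b -> mor Cinf a b).
Hypothesis tm1 : forall n a, tm (idm (C n) a) = idm Cinf a.
Hypothesis tmM : forall n a b c (g : mor (C n) b c) (e : mor (C n) a b),
  tm (cmp (C n) g e) = cmp Cinf (tm g) (tm e).

Inductive eveq a b : forall n, mor (C n) a b -> mor (C n) a b -> Prop :=
| eveq_now n (f : mor (C n) a b) : eveq f f
| eveq_step n (f g : mor (C n) a b) : eveq (sm f) (sm g) -> eveq f g.

Hypothesis tms : forall n a b (f : mor (C n) a b), tm (sm f) = tm f.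
Hypothesis tm_surj : forall a b (g : mor Cinf a b), exists n (f : mor (C n) a b), tm f = g.
Hypothesis tm_inj : forall n a b (f g : mor (C n) a b), tm f = tm g -> eveq f g.

Definition sys_s n : functor (C n) (C n.+1) := ifunctor (sm1 n) (@smM n).
Definition sys_t n : functor (C n) Cinf := ifunctor (tm1 n) (@tmM n).

Section OneSystem.
Variables (F : forall n, kfun K (C n)) (Finf : kfun K Cinf).
Variables (s : forall n, kmor (sys_s n) (F n) (F n.+1)) (t : forall n, kmor (sys_t n) (F n) Finf).

Definition kcsys := forall a, @mcsys K (fun n => F n a) (fun n => s n a) (Finf a) (fun n => t n a).

Hypothesis S : kcsys.

Let ts n a x : t n.+1 a (s n a x) = t n a x. Proof. by have [] := S a. Qed.

Lemma sys_common a b (g : mor Cinf a b) (y : Finf a) :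
  exists n (f : mor (C n) a b) x, tm f = g /\ t n a x = y.
Proof.
have [n [f fg]] := tm_surj g; have [_ tsurj _] := S a; have [m [x xy]] := tsurj y.
have [f' f'g] := @seq_raise (fun n => mor (C n) a b) (fun n => @sm n a b)
  (fun _ f => tm f = g) (fun n f fg => etrans (tms f) fg) _ _ f (leq_maxl n m) fg.
have [x' x'y] := @seq_raise (fun n => F n a) (fun n => s n a)
  (fun n x => t n a x = y) (fun n x xy => etrans (ts x) xy) _ _ x (leq_maxr n m) xy.
by exists (maxn n m), f', x'.
Qed.

(** The summands of [lcov Finf c] are indexed by morphisms of the colimit category, each represented
    at some stage. For the kernel condition, a map back to the colimit of the stages is built
    summand by summand. *)
Lemma lcov_mcsys c : @mcsys K (fun n => lcov (F n) c) (fun n => lcov_map (s n) c)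
  (lcov Finf c) (fun n => lcov_map (t n) c).
Proof.
pose L n := lcov_map (t n) c.
have comp n x : L n.+1 (lcov_map (s n) c x) = L n x.
  apply: (lcov_ext (u := cmplin (L n.+1) (lcov_map (s n) c)) (v := L n)) => a f y.
  rewrite cmplinE lcov_mapE [LHS]lcov_mapE [RHS]lcov_mapE.
  by rewrite [fmap _ (fmap _ _)]tms ts.
split=> //.
- apply: dsum_ind => [|a u v [n [x <-]] [m [y <-]]|[a g] y].
  + by exists 0, 0; rewrite linear0.
  + pose P (z : lcov Finf c) n (x : lcov (F n) c) := L n x = z.
    have PS z n' (x0 : lcov (F n') c) : P z n' x0 -> P z n'.+1 (lcov_map (s n') c x0).
      by rewrite /P comp.
    have [x1 <-] := seq_raise (PS (L n x)) (leq_maxl n m) erefl.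
    have [x2 <-] := seq_raise (PS (L m y)) (leq_maxr n m) erefl.
    by exists (maxn n m), (a *: x1 + x2); rewrite linearP.
  + have [n [f [x [<- <-]]]] := sys_common g y.
    by exists n, (lcov_in (F n) f x); rewrite lcov_mapE.
set sL := (fun n => _ : {linear _ -> _}).
have stepE n a (f : mor (C n) a c) x :
    mc_in sL n.+1 (lcov_in (F n.+1) (sm f) (s n a x)) = mc_in sL n (lcov_in (F n) f x).
  by rewrite -[RHS]mc_in_step; congr (mc_in _ _ _); rewrite /sL lcov_mapE.
have eqE n a (f g : mor (C n) a c) x : eveq f g ->
    mc_in sL n (lcov_in (F n) f x) = mc_in sL n (lcov_in (F n) g x).
  move=> fg; elim: fg x => [//|k {}f {}g _ IH] x.
  by rewrite -stepE IH stepE.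
have ex a (g : mor Cinf a c) : exists k : {linear Finf a -> mcolim sL},
    forall n (f : mor (C n) a c) x, tm f = g -> k (t n a x) = mc_in sL n (lcov_in (F n) f x).
  (* The value at [y] uses any stage where [g] and [y] both have representatives. Two
     representatives of [g] agree at a later stage, so the choice does not matter. *)
  pose R (y : Finf a) (v : mcolim sL) := exists n (f : mor (C n) a c) x,
    [/\ tm f = g, t n a x = y & mc_in sL n (lcov_in (F n) f x) = v].
  have [||v|k kP] := @lin_of_rel K (Finf a) (mcolim sL) R.
  - move=> b u u' v v' [n [f [x [fg <- <-]]]] [m [f' [x' [f'g <- <-]]]].
    pose X n := (mor (C n) a c * F n a)%type.
    pose st n (p : X n) : X n.+1 := (sm p.1, s n a p.2).
    pose P (y : Finf a) (v : mcolim sL) n (p : X n) := [/\ tm p.1 = g, t n a p.2 = y & mc_in sL n (lcov_in (F n) p.1 p.2) = v].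
    have PS y w n' (p : X n') : P y w n' p -> P y w n'.+1 (st n' p).
      move=> [fp tp mp]; split; [exact: etrans (tms _) fp|exact: etrans (ts _) tp|].
      exact: etrans (stepE _ _ _ _) mp.
    have [p1 [fp1 <- <-]] := @seq_raise X st (P _ _) (PS _ _) _ _ (f, x) (leq_maxl n m) (And3 fg erefl erefl).
    have [p2 [fp2 <- <-]] := @seq_raise X st (P _ _) (PS _ _) _ _ (f', x') (leq_maxr n m) (And3 f'g erefl erefl).
    exists (maxn n m), p1.1, (b *: p1.2 + p2.2); split=> //; first by rewrite linearP.
    rewrite !linearP; congr (_ + _); apply: eqE; apply: tm_inj; by rewrite fp1 fp2.
  - by move=> y; have [n [f [x [fg <-]]]] := sys_common g y;
      exists (mc_in sL n (lcov_in (F n) f x)), n, f, x.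
  - move=> [n [f [x [_ x0 <-]]]]; have [_ _ /(_ _ _ x0) ev] := S a.
    elim: ev f => [k|k {x0}x _ IH] f; first by rewrite !linear0.
    by rewrite -stepE IH.
  by exists k => n f x fg; apply/kP; exists n, f, x.
pose k a g := sval (cid (ex a g)).
have kP a g n (f : mor (C n) a c) x : tm f = g -> k a g (t n a x) = mc_in sL n (lcov_in (F n) f x).
  by rewrite /k; case: cid => k' k'P /=; apply: k'P.
move=> n x x0; apply: mc_in_evz.
rewrite -[LHS](_ : lcov_lift k (lcov_map (t n) c x) = _); first by rewrite x0 linear0.
apply: (lcov_ext (u := cmplin (lcov_lift k) (lcov_map (t n) c)) (v := mc_in sL n)) => a f y.
by rewrite cmplinE lcov_mapE lcov_liftE; apply: kP.
Qed.

Lemma colim_mcsys : @mcsys K (fun n => colim (F n)) (fun n => colim_map (s n))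
  (colim Finf) (fun n => colim_map (t n)).
Proof.
have comp n x : colim_map (t n.+1) (colim_map (s n) x) = colim_map (t n) x.
  apply: (colim_ext (f := cmplin (colim_map (t n.+1)) (colim_map (s n))) (g := colim_map (t n))) => a y.
  by rewrite cmplinE !colim_mapE ts.
split=> //.
- apply: colim_ind => [|a u v [n [x <-]] [m [y <-]]|a y].
  + by exists 0, 0; rewrite linear0.
  + pose P (z : colim Finf) n (x : colim (F n)) := colim_map (t n) x = z.
    have PS z n' (x0 : colim (F n')) : P z n' x0 -> P z n'.+1 (colim_map (s n') x0).
      by rewrite /P comp.
    have [x1 <-] := seq_raise (PS (colim_map (t n) x)) (leq_maxl n m) erefl.
    have [x2 <-] := seq_raise (PS (colim_map (t m) y)) (leq_maxr n m) erefl.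
    by exists (maxn n m), (a *: x1 + x2); rewrite linearP.
  + have [_ tsurj _] := S a; have [n [x <-]] := tsurj y.
    by exists n, (colim_in (F n) a x); rewrite colim_mapE.
set sL := (fun n => _ : {linear _ -> _}).
have stepE n a x : mc_in sL n.+1 (colim_in (F n.+1) a (s n a x)) = mc_in sL n (colim_in (F n) a x).
  by rewrite -[RHS]mc_in_step; congr (mc_in _ _ _); rewrite /sL colim_mapE.
pose w a n := cmplin (mc_in sL n) (colim_in (F n) a).
have ex a := mcsys_lift (S a) (w := w a) (fun n x => stepE n a x).
pose k a := sval (cid (ex a)).
have kP a n x : k a (t n a x) = mc_in sL n (colim_in (F n) a x).
  by rewrite /k; case: cid => k' k'P /=; rewrite k'P.
have kN a b (g : mor Cinf a b) y : k b (km Finf g y) = k a y.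
  have [n [f [x [<- <-]]]] := sys_common g y.
  have := kaN (t n) f x; rewrite /= => <-.
  by rewrite !kP colim_inE.
move=> n x x0; apply: mc_in_evz.
rewrite -[LHS](_ : colim_lift kN (colim_map (t n) x) = _); first by rewrite x0 linear0.
apply: (colim_ext (f := cmplin (colim_lift kN) (colim_map (t n))) (g := mc_in sL n)) => a y.
by rewrite cmplinE colim_mapE colim_liftE kP.
Qed.
End OneSystem.

Lemma lomega_kcsys (F : forall n, kfun K (C n)) (Finf : kfun K Cinf)
  (s : forall n, kmor (sys_s n) (F n) (F n.+1)) (t : forall n, kmor (sys_t n) (F n) Finf) :
  kcsys s t -> kcsys (fun n => lomega_map (s n)) (fun n => lomega_map (t n)).
Proof.
move=> S c.
exact: (@kernel_mcsys K (fun n => lcov (F n) c) (fun n => F n c) (fun n => lcov_map (s n) c)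
  (fun n => s n c) (lcov Finf c) (Finf c) (fun n => lcov_map (t n) c) (fun n => t n c)
  (fun n => leps (F n) c) (leps Finf c) (fun n => @leps_lcov_map _ _ _ _ _ _ _ _ (s n) c)
  (fun n => @leps_lcov_map _ _ _ _ _ _ _ _ (t n) c) (lcov_mcsys S c) (S c)).
Qed.

Lemma lcov_kcsys (F : forall n, kfun K (C n)) (Finf : kfun K Cinf)
  (s : forall n, kmor (sys_s n) (F n) (F n.+1)) (t : forall n, kmor (sys_t n) (F n) Finf) :
  kcsys s t -> kcsys (fun n => lcov_map (s n)) (fun n => lcov_map (t n)).
Proof. move=> S c; exact: lcov_mcsys. Qed.

Theorem h_mcsys m (F : forall n, kfun K (C n)) (Finf : kfun K Cinf)
  (s : forall n, kmor (sys_s n) (F n) (F n.+1)) (t : forall n, kmor (sys_t n) (F n) Finf) :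
  kcsys s t ->
  @mcsys K (fun n => homol m (F n)) (fun n => hmap m (s n)) (homol m Finf) (fun n => hmap m (t n)).
Proof.
case: m => [|m]; first exact: colim_mcsys.
elim: m F Finf s t => [|m IH] F Finf s t S; last exact: (IH _ _ _ _ (lomega_kcsys S)).
exact: (@kernel_mcsys K (fun n => colim (lomega (F n))) (fun n => colim (lcov (F n)))
  (fun n => colim_map (lomega_map (s n))) (fun n => colim_map (lcov_map (s n)))
  (colim (lomega Finf)) (colim (lcov Finf))
  (fun n => colim_map (lomega_map (t n))) (fun n => colim_map (lcov_map (t n)))
  (fun n => colim_map (lomega_in (F n))) (colim_map (lomega_in Finf))
  (fun n => @homol1_map_subproof _ _ _ _ _ _ _ _ (s n))
  (fun n => @homol1_map_subproof _ _ _ _ _ _ _ _ (t n))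
  (colim_mcsys (lomega_kcsys S)) (colim_mcsys (lcov_kcsys S))).
Qed.
End CategorySystems.

(** * Shapiro isomorphism and trivial coefficients *)

Section CategoryOfElements.
Variables (O : Type) (C : category O) (X : O -> Type).
Variable Xm : forall a b, mor C a b -> X a -> X b.
Hypothesis Xm1 : forall a x, Xm (idm C a) x = x.
Hypothesis XmM : forall a b c (g : mor C b c) (f : mor C a b) x,
  Xm (cmp C g f) x = Xm g (Xm f x).

Definition el_obj := {c : O & X c}.

Definition el_mor (p q : el_obj) :=
  {f : mor C (projT1 p) (projT1 q) | Xm f (projT2 p) = projT2 q}.

Lemma el_mor_eq p q (f g : el_mor p q) : sval f = sval g -> f = g.
Proof.
case: f g => [f fe] [g ge] /= fg; case: g / fg ge => ge.
by congr exist; apply: Prop_irrelevance.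
Qed.

Definition el : category el_obj.
Proof.
refine (@Category el_obj el_mor (fun p => exist _ (idm C (projT1 p)) (Xm1 (projT2 p)))
  (fun p q r g f => exist _ (cmp C (sval g) (sval f))
     (etrans (XmM _ _ _) (etrans (congr1 _ (svalP f)) (svalP g)))) _ _ _).
- by move=> p q f; apply: el_mor_eq; rewrite /= cmp1m.
- by move=> p q f; apply: el_mor_eq; rewrite /= cmpm1.
- by move=> p q r s k g f; apply: el_mor_eq; rewrite /= cmpA.
Defined.

Definition el_proj : functor el C :=
  @Functor el_obj O el C (@projT1 O X) (fun p q f => sval f) (fun _ => erefl)
    (fun _ _ _ _ _ => erefl).

Definition el_in a b (f : mor C a b) (x : X a) :
  mor el (existT X a x) (existT X b (Xm f x)) := exist _ f erefl.

Variable K : fieldType.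

Section OneKmor.
Variables (M : kfun K el) (N : kfun K C) (t : kmor el_proj M N).

Definition el_sum c : {linear dsum (fun x : X c => M (existT X c x)) -> N c} :=
  dsum_lift (fun x => t (existT X c x) : {linear M (existT X c x) -> N c}).

Lemma el_sumE c x (m : M (existT X c x)) :
  el_sum c (dsum_in (fun x : X c => M (existT X c x)) x m) = t (existT X c x) m.
Proof. exact: dsum_liftE. Qed.

Definition el_good := forall c, lbij (el_sum c).
End OneKmor.

Lemma el_sum_nat (M M' : kfun K el) (N N' : kfun K C) (t : kmor el_proj M N)
    (t' : kmor el_proj M' N') (u : knat M M') (v : knat N N') :
  (forall p x, v _ (t p x) = t' p (u p x)) ->
  forall c x, v c (el_sum t c x) = el_sum t' c (dsum_map (fun x : X c => u (existT X c x)) x).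
Proof.
move=> vt c; apply: (dsum_ext (f := cmplin (v c) (el_sum t c))
  (g := cmplin (el_sum t' c) (dsum_map (fun x : X c => u (existT X c x))))) => x m.
rewrite !cmplinE dsum_mapE !el_sumE; exact: (vt (existT X c x)).
Qed.

Section Good.
Variables (M : kfun K el) (N : kfun K C) (t : kmor el_proj M N).
Hypothesis G : el_good t.

Lemma el_sum_inv : exists s : forall c, {linear N c -> dsum (fun x : X c => M (existT X c x))},
  (forall c x, s c (el_sum t c x) = x) /\ (forall c y, el_sum t c (s c y) = y).
Proof.
have ex c := linv_exists (G c).
exists (fun c => sval (cid (ex c))).
by split=> c; case: cid => s [? ?].
Qed.

(** A morphism [f : a -> c] has a unique lift starting at a given point of [X a], so the summands of
    the cover of [N] at [c] match those of the cover of [M] over the fibre. *)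
Lemma lcov_el_good : el_good (lcov_map t).
Proof.
have [s [sl sr]] := el_sum_inv => c.
pose M' (x : X c) := lcov M (existT X c x).
pose g a (f : mor C a c) : {linear N a -> dsum M'} := cmplin (dsum_lift (fun y : X a =>
  cmplin (dsum_in M' (Xm f y)) (lcov_in M (el_in f y)))) (s a).
have gE a (f : mor C a c) y m : g a f (t (existT X a y) m) =
    dsum_in M' (Xm f y) (lcov_in M (el_in f y) m).
  by rewrite /g cmplinE -el_sumE sl dsum_liftE.
clearbody g.
have k1 x : lcov_lift g (el_sum (lcov_map t) c x) = x.
  apply: (dsum_ext (f := cmplin (lcov_lift g) (el_sum (lcov_map t) c)) (g := idlin _)) => y m.
  rewrite cmplinE el_sumE idlinE.
  apply: (lcov_ext (u := cmplin (lcov_lift g) (lcov_map t (existT X c y))) (v := dsum_in M' y)).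
  move=> {m}[a y'] [f fe] m'.
  rewrite cmplinE lcov_mapE lcov_liftE [LHS]gE.
  (* The endpoint of a lift is only propositionally equal to [Xm f y'], so it is generalised before
     the equality is eliminated. *)
  have key z (e : Xm f y' = z) : dsum_in M' _ (lcov_in M (el_in f y') m') =
    dsum_in M' z (lcov_in M (exist _ f e : mor el (existT X a y') (existT X c z)) m').
    by subst z.
  exact: key.
have k2 y : el_sum (lcov_map t) c (lcov_lift g y) = y.
  apply: (lcov_ext (u := cmplin (el_sum (lcov_map t) c) (lcov_lift g)) (v := idlin _)) => a f n.
  rewrite cmplinE lcov_liftE idlinE -(sr a n).
  apply: (dsum_ext (f := cmplin (el_sum (lcov_map t) c) (cmplin (g a f) (el_sum t a)))
    (g := cmplin (lcov_in N f) (el_sum t a))) => x m.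
  by rewrite !cmplinE el_sumE gE el_sumE lcov_mapE.
split=> [x x0|y]; first by rewrite -(k1 x) x0 linear0.
by exists (lcov_lift g y).
Qed.

Lemma colim_el_bij : lbij (colim_map t).
Proof.
have [s [sl sr]] := el_sum_inv.
pose g a : {linear N a -> colim M} :=
  cmplin (dsum_lift (fun x : X a => colim_in M (existT X a x))) (s a).
have gE a x m : g a (t (existT X a x) m) = colim_in M (existT X a x) m.
  by rewrite /g cmplinE -el_sumE sl dsum_liftE.
clearbody g.
have gN a b (f : mor C a b) y : g b (km N f y) = g a y.
  rewrite -(sr a y); apply: (dsum_ext (f := cmplin (g b) (cmplin (km N f) (el_sum t a)))
    (g := cmplin (g a) (el_sum t a))) => x m.
  rewrite !cmplinE el_sumE gE -(colim_inE (el_in f x)) -gE.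
  by rewrite (kaN t (el_in f x)).
have k1 x : colim_lift gN (colim_map t x) = x.
  apply: (colim_ext (f := cmplin (colim_lift gN) (colim_map t)) (g := idlin _)) => -[a y] m.
  by rewrite cmplinE colim_mapE colim_liftE gE.
have k2 y : colim_map t (colim_lift gN y) = y.
  apply: (colim_ext (f := cmplin (colim_map t) (colim_lift gN)) (g := idlin _)) => a n.
  rewrite cmplinE colim_liftE idlinE -(sr a n).
  apply: (dsum_ext (f := cmplin (colim_map t) (cmplin (g a) (el_sum t a)))
    (g := cmplin (colim_in N a) (el_sum t a))) => x m.
  by rewrite !cmplinE el_sumE gE colim_mapE.
split=> [x x0|y]; first by rewrite -(k1 x) x0 linear0.
by exists (colim_lift gN y).
Qed.
End Good.

Lemma lomega_el_good (M : kfun K el) (N : kfun K C) (t : kmor el_proj M N) :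
  el_good t -> el_good (lomega_map t).
Proof.
move=> G c; apply: (ker_lbij (i := dsum_map (fun x : X c => lomega_in M (existT X c x)))
    (f := dsum_map (fun x : X c => leps M (existT X c x))) (i' := lomega_in N c) (f' := leps N c)
    (be := el_sum (lcov_map t) c) (ga := el_sum t c)).
- by apply: dsum_map_linj => x; apply: lomega_inj.
- by apply: dsum_map_lexact => x; apply: lomega_lexact.
- exact: lomega_inj.
- exact: lomega_lexact.
- exact: (el_sum_nat (t := lomega_map t) (t' := lcov_map t) (u := lomega_in M) (v := lomega_in N)).
- apply: (el_sum_nat (t := lcov_map t) (t' := t) (u := leps M) (v := leps N)) => p x.
  exact: leps_lcov_map.
- exact: lcov_el_good.
- by have [] := G c.
Qed.

(* N is the left Kan extension of M along a discrete opfibration, an exact operation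
   that commutes with linear covers. *)
Theorem hmap_el_bij n (M : kfun K el) (N : kfun K C) (t : kmor el_proj M N) :
  el_good t -> lbij (hmap n t).
Proof.
case: n => [|n]; first exact: colim_el_bij.
elim: n M N t => [|n IH] M N t G; last exact: (IH _ _ _ (lomega_el_good G)).
apply: (ker_lbij (i := ker_in (colim_map (lomega_in M))) (f := colim_map (lomega_in M))
  (i' := ker_in (colim_map (lomega_in N))) (f' := colim_map (lomega_in N))
  (be := colim_map (lomega_map t)) (ga := colim_map (lcov_map t))) => //.
- exact: ker_in_inj.
- exact: ker_lexact.
- exact: ker_in_inj.
- exact: ker_lexact.
- exact: homol1_map_subproof.
- exact/colim_el_bij/lomega_el_good.
- by have [] := colim_el_bij (lcov_el_good G).
Qed.
End CategoryOfElements.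

(** * Coefficients tensored with a vector space *)

Section TensorCoefficients.
Variables (K : fieldType) (O : Type) (C : category O) (V : lmodType K).

(** A linear family of transformations indexed by [V] stands for one transformation from [U]
    tensored with [V] to [W], without constructing that tensor product as a functor. *)
Definition klinear (U W : kfun K C) (t : V -> knat U W) :=
  forall a u v c x, t (a *: u + v) c x = a *: t u c x + t v c x.

Definition ktensor (U W : kfun K C) (t : V -> knat U W) (tL : klinear t) c :
  {linear tensor (U c) V -> W c} :=
  tensor_lift (f := fun v => t v c) (fun a u v x => tL a u v c x).

Definition ktensor_good (U W : kfun K C) (t : V -> knat U W) (tL : klinear t) :=
  forall c, lbij (ktensor tL c).

Section One.
Variables (U W : kfun K C) (t : V -> knat U W) (tL : klinear t).

Lemma ktensorE c x v : ktensor tL c (tens x v) = t v c x.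
Proof. exact: tensor_liftE. Qed.

Lemma lcov_klinear : klinear (fun v => lcov_map (t v)).
Proof.
move=> a u v c; apply: (lcov_ext (u := lcov_map (t _) c)
  (v := lincomb a (lcov_map (t u) c) (lcov_map (t v) c))) => b f x.
by rewrite lincombE !lcov_mapE tL linearP.
Qed.

Lemma lomega_klinear : klinear (fun v => lomega_map (t v)).
Proof. by move=> a u v; apply: lomega_map_lin => c x; apply: tL. Qed.

Definition htensor n : {linear tensor (homol n U) V -> homol n W} :=
  tensor_lift (f := fun v => hmap n (t v))
    (fun a u v => hmap_lin (t := t (a *: u + v)) (tL a u v)).

Lemma htensorE n z v : htensor n (tens z v) = hmap n (t v) z.
Proof. exact: tensor_liftE. Qed.

Hypothesis G : ktensor_good tL.

Lemma ktensor_inv : exists s : forall c, {linear W c -> tensor (U c) V},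
  (forall c x, s c (ktensor tL c x) = x) /\ (forall c y, ktensor tL c (s c y) = y).
Proof.
have ex c := linv_exists (G c).
exists (fun c => sval (cid (ex c))).
by split=> c; case: cid => s [? ?].
Qed.

Lemma lcov_ktensor_good : ktensor_good lcov_klinear.
Proof.
have [s [sl sr]] := ktensor_inv => c.
pose T := tensor_lift (f := fun v => lcov_map (t v) c) (fun a u v x => lcov_klinear a u v x).
have TE x v : T (tens x v) = lcov_map (t v) c x by apply: tensor_liftE.
pose g a (f : mor C a c) : {linear W a -> tensor (lcov U c) V} :=
  cmplin (tmap V (lcov_in U f)) (s a).
have gE a (f : mor C a c) x v : g a f (t v a x) = tens (lcov_in U f x) v.
  by rewrite /g cmplinE -ktensorE sl tmapE.
clearbody g.
have k1 x : lcov_lift g (T x) = x.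
  apply: (tensor_ext (f := cmplin (lcov_lift g) T) (g := idlin _)) => y v.
  rewrite cmplinE TE idlinE.
  apply: (lcov_ext (u := cmplin (lcov_lift g) (lcov_map (t v) c)) (v := tensl _ v)) => a f z.
  by rewrite cmplinE lcov_mapE lcov_liftE gE.
have k2 y : T (lcov_lift g y) = y.
  apply: (lcov_ext (u := cmplin T (lcov_lift g)) (v := idlin _)) => a f z.
  rewrite cmplinE lcov_liftE idlinE -(sr a z).
  apply: (tensor_ext (f := cmplin T (cmplin (g a f) (ktensor tL a)))
    (g := cmplin (lcov_in W f) (ktensor tL a))) => x v.
  by rewrite !cmplinE ktensorE gE TE lcov_mapE.
split=> [x x0|y]; first by rewrite -(k1 x) (_ : T x = 0) ?linear0.
by exists (lcov_lift g y).
Qed.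

Lemma colim_tensor_bij : lbij (htensor 0).
Proof.
have [s [sl sr]] := ktensor_inv.
pose g a : {linear W a -> tensor (colim U) V} := cmplin (tmap V (colim_in U a)) (s a).
have gE a x v : g a (t v a x) = tens (colim_in U a x) v.
  by rewrite /g cmplinE -ktensorE sl tmapE.
clearbody g.
have gN a b (f : mor C a b) y : g b (km W f y) = g a y.
  rewrite -(sr a y); apply: (tensor_ext (f := cmplin (g b) (cmplin (km W f) (ktensor tL a)))
    (g := cmplin (g a) (ktensor tL a))) => x v.
  rewrite !cmplinE ktensorE gE -[km W f _](kaN (t v)) gE.
  by rewrite colim_inE.
have k1 x : colim_lift gN (htensor 0 x) = x.
  apply: (tensor_ext (f := cmplin (colim_lift gN) (htensor 0)) (g := idlin _)) => y v.
  rewrite cmplinE htensorE idlinE.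
  apply: (colim_ext (f := cmplin (colim_lift gN) (colim_map (t v))) (g := tensl _ v)) => a z.
  by rewrite cmplinE colim_mapE colim_liftE gE.
have k2 y : htensor 0 (colim_lift gN y) = y.
  apply: (colim_ext (f := cmplin (htensor 0) (colim_lift gN)) (g := idlin _)) => a z.
  rewrite cmplinE colim_liftE idlinE -(sr a z).
  apply: (tensor_ext (f := cmplin (htensor 0) (cmplin (g a) (ktensor tL a)))
    (g := cmplin (colim_in W a) (ktensor tL a))) => x v.
  by rewrite !cmplinE ktensorE gE htensorE [LHS]colim_mapE.
split=> [x x0|y]; first by rewrite -(k1 x) x0 linear0.
by exists (colim_lift gN y).
Qed.
End One.

Lemma lomega_ktensor_good (U W : kfun K C) (t : V -> knat U W) (tL : klinear t) :
  ktensor_good tL -> ktensor_good (lomega_klinear tL).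
Proof.
move=> G c; apply: (ker_lbij (i := tmap V (lomega_in U c)) (f := tmap V (leps U c))
    (i' := lomega_in W c) (f' := leps W c)
    (be := ktensor (lcov_klinear tL) c) (ga := ktensor tL c)).
- exact/tmap_linj/lomega_inj.
- exact/tmap_lexact/lomega_lexact.
- exact: lomega_inj.
- exact: lomega_lexact.
- apply: (tensor_ext (f := cmplin (lomega_in W c) (ktensor (lomega_klinear tL) c))
    (g := cmplin (ktensor (lcov_klinear tL) c) (tmap V (lomega_in U c)))) => x v.
  by rewrite !cmplinE tmapE !ktensorE.
- apply: (tensor_ext (f := cmplin (leps W c) (ktensor (lcov_klinear tL) c))
    (g := cmplin (ktensor tL c) (tmap V (leps U c)))) => x v.
  by rewrite !cmplinE tmapE !ktensorE; apply: (leps_lcov_map (t v)).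
- exact: lcov_ktensor_good.
- by have [] := G c.
Qed.

Theorem htensor_bij n (U W : kfun K C) (t : V -> knat U W) (tL : klinear t) :
  ktensor_good tL -> lbij (htensor tL n).
Proof.
case: n => [|n]; first exact: colim_tensor_bij.
elim: n U W t tL => [|n IH] U W t tL G; last first.
  apply: lbij_ext (IH _ _ _ _ (lomega_ktensor_good G)).
  apply: (tensor_ext (f := htensor (lomega_klinear tL) n.+1) (g := htensor tL n.+2)) => z v.
  exact: etrans (@htensorE _ _ _ (lomega_klinear tL) n.+1 z v) (esym (@htensorE _ _ _ tL n.+2 z v)).
apply: (ker_lbij (i := tmap V (ker_in (colim_map (lomega_in U))))
  (f := tmap V (colim_map (lomega_in U)))
  (i' := ker_in (colim_map (lomega_in W))) (f' := colim_map (lomega_in W))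
  (be := htensor (lomega_klinear tL) 0) (ga := htensor (lcov_klinear tL) 0)).
- exact/tmap_linj/ker_in_inj.
- exact/tmap_lexact/ker_lexact.
- exact: ker_in_inj.
- exact: ker_lexact.
- apply: (tensor_ext (f := cmplin (ker_in _) (htensor tL 1))
    (g := cmplin (htensor (lomega_klinear tL) 0) (tmap V (ker_in _)))) => x v.
  by rewrite !cmplinE tmapE !htensorE.
- apply: (tensor_ext (f := cmplin (colim_map (lomega_in W)) (htensor (lomega_klinear tL) 0))
    (g := cmplin (htensor (lcov_klinear tL) 0) (tmap V (colim_map (lomega_in U))))) => x v.
  by rewrite !cmplinE tmapE !htensorE; apply: (homol1_map_subproof (t v)).
- exact/colim_tensor_bij/lomega_ktensor_good.
- by have [] := colim_tensor_bij (lcov_ktensor_good G).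
Qed.
End TensorCoefficients.

(** * Families of modules over a discrete category of tags *)

Section Tagged.
Variables (K : fieldType) (T : Type) (F : T -> lmodType K).

Definition kcast a b (e : a = b) : {linear F a -> F b} :=
  match e in _ = y return {linear F a -> F y} with erefl => idlin (F a) end.

Lemma kcast_id a (e : a = a) x : kcast e x = x.
Proof. by rewrite (Prop_irrelevance e erefl). Qed.

Lemma kcast_irr a b (e e' : a = b) x : kcast e x = kcast e' x.
Proof. by rewrite (Prop_irrelevance e e'). Qed.

Lemma kcast_trans a b c (e : a = b) (e' : b = c) (e'' : a = c) x :
  kcast e'' x = kcast e' (kcast e x).
Proof. by subst c; subst b; rewrite !kcast_id. Qed.

Variables (O : Type) (C : category O).

(* The product of C with the discrete category on T *)
Definition tag_el : category (el_obj (fun _ : O => T)) :=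
  @el O C (fun _ => T) (fun _ _ _ x => x) (fun _ _ => erefl) (fun _ _ _ _ _ _ => erefl).

Definition tag_proj : functor tag_el C :=
  @el_proj O C (fun _ => T) (fun _ _ _ x => x) (fun _ _ => erefl) (fun _ _ _ _ _ _ => erefl).

Definition tag_km p q (f : mor tag_el p q) : {linear F (projT2 p) -> F (projT2 q)} :=
  kcast (svalP f).

Definition tag_kfun : kfun K tag_el.
Proof.
refine (@KFun K _ tag_el (fun p => F (projT2 p)) tag_km _ _).
- by move=> p x; apply: kcast_id.
- by move=> p q r g f x; apply: kcast_trans.
Defined.

Variables (X : O -> Type) (Xm : forall a b, mor C a b -> X a -> X b).
Hypothesis Xm1 : forall a x, Xm (idm C a) x = x.
Hypothesis XmM : forall a b c (g : mor C b c) (f : mor C a b) x,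
  Xm (cmp C g f) x = Xm g (Xm f x).
Variable tag : forall a, X a -> T.
Hypothesis tagE : forall a b (f : mor C a b) x, tag (Xm f x) = tag x.

Definition tag_functor : functor (el Xm1 XmM) tag_el.
Proof.
refine (@Functor _ _ (el Xm1 XmM) tag_el (fun p => existT _ (projT1 p) (tag (projT2 p)))
  (fun p q f => exist _ (sval f) (etrans (esym (tagE (sval f) (projT2 p))) (congr1 (@tag _) (svalP f)))) _ _).
- by move=> p; apply: el_mor_eq.
- by move=> p q r g f; apply: el_mor_eq.
Defined.
End Tagged.

Definition proj1_functor O O' (C : category O) (D : category O') : functor (cat_prod C D) C :=
  @Functor _ _ (cat_prod C D) C fst (fun _ _ f => f.1) (fun=> erefl) (fun _ _ _ _ _ => erefl).

(** * The Kuenneth decomposition *)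

Section Kunneth.
Variable K : fieldType.
Implicit Types U V W : lmodType K.

Section Constant.
Variables (O : Type) (C : category O).

Definition const_map V W (f : {linear V -> W}) : knat (kconst C V) (kconst C W) :=
  @KMor K _ _ _ _ (functor_id C) (kconst C V) (kconst C W) (fun _ => f) (fun _ _ _ _ => erefl).

Definition hconst n V W (f : {linear V -> W}) : {linear homol n (kconst C V) -> homol n (kconst C W)} :=
  hmap n (const_map f).

Lemma hconst_comp n U V W (g : {linear V -> W}) (f : {linear U -> V}) (e : {linear U -> W}) :
  (forall x, e x = g (f x)) -> forall z, hconst n e z = hconst n g (hconst n f z).
Proof. by move=> egf z; apply: hmap_compr. Qed.

Lemma hconst_id n V (e : {linear V -> V}) : (forall x, e x = x) -> forall z, hconst n e z = z.
Proof. by move=> e1 z; apply: hmap_id. Qed.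

Lemma hconst_linj n V W (f : {linear V -> W}) : linj f -> linj (hconst n f).
Proof.
move=> /linj_retract[r rP] z z0.
rewrite -(hconst_id (e := idlin V) (fun x => erefl) z).
have -> := hconst_comp (e := idlin V) (g := r) (f := f) (fun x => esym (rP x)) z.
by rewrite z0 linear0.
Qed.

Lemma hconst_lexact n U V W (f : {linear U -> V}) (g : {linear V -> W}) :
  lexact f g -> lexact (hconst n f) (hconst n g).
Proof.
move=> ex; have [s [t st]] := lexact_split ex.
apply: (@split_lexact K _ _ _ (hconst n f) (hconst n g) (hconst n s) (hconst n t)) => z.
  rewrite -(hconst_comp (e := cmplin g f)) //; apply: hmap_zero => c x.
  by rewrite [LHS]cmplinE; apply/ex; exists x.
rewrite -(hconst_comp (e := cmplin f s) (fun x => erefl)) -(hconst_comp (e := cmplin t g) (fun x => erefl)).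
rewrite -[LHS](hconst_id (e := idlin V) (fun x => erefl)).
by apply: hmap_add => c x; apply: st.
Qed.

Lemma hconst_lsurj n V W (f : {linear V -> W}) : lsurj f -> lsurj (hconst n f).
Proof.
move=> fs; have [p pP] := pinv_exists f => z.
exists (hconst n p z); rewrite -(hconst_comp (e := idlin W)) ?hconst_id// => y.
by have [x <-] := fs y; rewrite pP.
Qed.
End Constant.

Section Product.
Variables (O O' : Type) (C : category O) (D : category O').
Implicit Type F : kfun K D.

Definition ext_pull F : kfun K (cat_prod C D) := kpull (proj2_functor C D) F.

Definition ext_nat F F' (t : knat F F') : knat (ext_pull F) (ext_pull F') :=
  kpull_nat (proj2_functor C D) t.

(** The augmentation to the colimit in the second variable, as a morphism over the projection to
    [C]. On homology it gives the Kuenneth components with [l = 0]. *)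
Definition ext_colim F : kmor (proj1_functor C D) (ext_pull F) (kconst C (colim F)).
Proof.
refine (@KMor K _ _ _ _ (proj1_functor C D) (ext_pull F) (kconst C (colim F))
  (fun p => colim_in F p.2) _).
by move=> p q f x; apply: colim_inE.
Defined.

Definition hcol n F : {linear homol n (ext_pull F) -> homol n (kconst C (colim F))} := hmap n (ext_colim F).

Lemma hcol_nat n F F' (t : knat F F') z :
  hcol n F' (hmap n (ext_nat t) z) = hconst C n (colim_map t) (hcol n F z).
Proof.
rewrite /hcol /hconst -!hmap_comp; apply: (@hmap_nat K _ _ _ _
  (fcomp (proj1_functor C D) (functor_id _)) (fcomp (functor_id C) (proj1_functor C D))
  (fun p => idm C p.1)).
  by move=> p q f; rewrite /= cmp1m cmpm1.
by move=> p x; apply: (colim_mapE t x).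
Qed.

Section FreeCase.
Variable F : kfun K D.

(** The set-valued functor sending [(c, d)] to all morphisms into [d]. Its category of elements is
    the product of [C] with the disjoint union of the coslices [a / D], each of which has the
    initial object [id_a]. *)
Definition coslice_km (p q : O * O') (f : mor (cat_prod C D) p q) (x : lidx D p.2) : lidx D q.2 :=
  existT _ (projT1 x) (cmp D f.2 (projT2 x)).

Lemma coslice_km1 p x : coslice_km (idm (cat_prod C D) p) x = x.
Proof. by case: x => a f; rewrite /coslice_km /= cmp1m. Qed.

Lemma coslice_kmM p q r (g : mor (cat_prod C D) q r) (f : mor (cat_prod C D) p q) x :
  coslice_km (cmp (cat_prod C D) g f) x = coslice_km g (coslice_km f x).
Proof. by case: x => a e; rewrite /coslice_km /= cmpA. Qed.

Definition coslice := el coslice_km1 coslice_kmM.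

Definition coslice_tag : functor coslice (tag_el O' C).
Proof.
refine (@Functor _ _ coslice (tag_el O' C)
  (fun p => existT (fun _ : O => O') (projT1 p).1 (projT1 (projT2 p)))
  (fun p q f => exist _ (sval f).1 (congr1 (@projT1 _ _) (svalP f))) _ _).
- by move=> p; apply: el_mor_eq.
- by move=> p q r g f; apply: el_mor_eq.
Defined.

Definition coslice_kfun : kfun K coslice := kpull coslice_tag (tag_kfun F C).

Lemma coslice_mor_eq d d' (g : mor D d d') (x : lidx D d) (y : lidx D d')
    (e : existT (fun a => mor D a d') (projT1 x) (cmp D g (projT2 x)) = y)
    (e' : projT1 x = projT1 y) :
  cmp D (projT2 y) (eqhom D e') = cmp D g (projT2 x).
Proof. by subst y; rewrite (eqhom_id D e') cmpm1. Qed.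

Definition initial_fun (p : el_obj (fun _ : O => O')) : el_obj (fun q : O * O' => lidx D q.2) :=
  existT (fun q : O * O' => lidx D q.2) (projT1 p, projT2 p)
    (existT (fun a => mor D a (projT2 p)) (projT2 p) (idm D (projT2 p))).

Lemma initial_aux a b (e : a = b) :
  existT (fun x => mor D x b) a (cmp D (eqhom D e) (idm D a)) =
  existT (fun x => mor D x b) b (idm D b).
Proof. by subst b; rewrite cmp1m. Qed.

Lemma initial_subproof p q (f : mor (tag_el O' C) p q) :
  coslice_km (p := (projT1 p, projT2 p)) (q := (projT1 q, projT2 q)) (sval f, eqhom D (svalP f))
    (projT2 (initial_fun p)) = projT2 (initial_fun q).
Proof. exact: initial_aux. Qed.

Definition initial : functor (tag_el O' C) coslice.
Proof.
refine (@Functor _ _ (tag_el O' C) coslice initial_fun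
  (fun p q f => exist _ (sval f, eqhom D (svalP f)) (initial_subproof f)) _ _).
- by move=> p; apply: el_mor_eq => /=; rewrite eqhom_id.
- move=> p q r g f; apply: el_mor_eq => /=; congr pair.
  by rewrite eqhom_cmp; apply: eqhom_irr.
Defined.

Lemma initial_counit_subproof (p : el_obj (fun q : O * O' => lidx D q.2)) :
  coslice_km (p := ((projT1 p).1, projT1 (projT2 p))) (idm C (projT1 p).1, projT2 (projT2 p))
    (existT (fun a => mor D a _) (projT1 (projT2 p)) (idm D _)) = projT2 p.
Proof. by case: p => [[c d] [a f]]; rewrite /coslice_km /= cmpm1. Qed.

Definition initial_counit (p : el_obj (fun q : O * O' => lidx D q.2)) :
  mor coslice (initial (coslice_tag p)) p := exist _ _ (initial_counit_subproof p).

Lemma initial_counitN p q (f : mor coslice p q) :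
  cmp coslice (initial_counit q) (fmap (fcomp initial coslice_tag) f) =
  cmp coslice (fmap (functor_id coslice) f) (initial_counit p).
Proof.
apply: el_mor_eq; rewrite /= cmp1m cmpm1; congr pair.
exact: coslice_mor_eq (svalP f) _.
Qed.

Lemma coslice_kmor_subproof d d' (g : mor D d d') (x : lidx D d) (y : lidx D d')
    (e : existT (fun a => mor D a d') (projT1 x) (cmp D g (projT2 x)) = y)
    (e' : projT1 x = projT1 y) m :
  lcov_in F (projT2 y) (kcast F e' m) = lcov_in F (cmp D g (projT2 x)) m.
Proof. by subst y; rewrite (kcast_id e'). Qed.

Definition coslice_kmor : kmor (el_proj coslice_km1 coslice_kmM) coslice_kfun (ext_pull (lcov F)).
Proof.
refine (@KMor K _ _ _ _ (el_proj coslice_km1 coslice_kmM) coslice_kfun (ext_pull (lcov F))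
  (fun p => lcov_in F (projT2 (projT2 p))) _).
move=> p q f x; rewrite [RHS]lcov_kmE; apply: coslice_kmor_subproof.
exact: svalP f.
Defined.

Lemma coslice_good : el_good coslice_kmor.
Proof.
move=> c; have E x : el_sum coslice_kmor c x = x.
  move: x; apply: (dsum_ext (f := el_sum coslice_kmor c) (g := idlin _)) => -[a f] m.
  by rewrite el_sumE.
by split=> [x|y]; [rewrite E|exists y; rewrite E].
Qed.

Lemma free_kmor_subproof a b (e : a = b) x :
  colim_in (lcov F) b (lcov_in F (idm D b) (kcast F e x)) = colim_in (lcov F) a (lcov_in F (idm D a) x).
Proof. by subst b; rewrite kcast_id. Qed.

Definition free_kmor : kmor (tag_proj O' C)
  (tag_kfun F C) (kconst C (colim (lcov F))).
Proof.
refine (@KMor K _ _ _ _ (tag_proj O' C)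
  (tag_kfun F C) (kconst C (colim (lcov F)))
  (fun p => cmplin (colim_in (lcov F) (projT2 p)) (lcov_in F (idm D (projT2 p)))) _).
by move=> p q f x; apply: free_kmor_subproof.
Defined.

Lemma free_good : @el_good O C (fun _ => O') (fun _ _ _ x => x) (fun _ _ => erefl)
  (fun _ _ _ _ _ _ => erefl) K (tag_kfun F C) (kconst C (colim (lcov F))) free_kmor.
Proof.
move=> c; have E x : lcov_colim F (el_sum free_kmor c x) = x.
  move: x; apply: (dsum_ext (f := cmplin (lcov_colim F) (el_sum free_kmor c)) (g := idlin _)) => a m.
  by rewrite cmplinE el_sumE; apply: lcov_colimE.
split=> [x x0|y]; first by rewrite -(E x) x0 linear0.
by exists (lcov_colim F y); apply: (linj_eq (@lcov_colim_inj _ _ _ F)); rewrite E.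
Qed.

Definition coslice_tag_kmor : kmor coslice_tag coslice_kfun (tag_kfun F C) :=
  kpull_mor coslice_tag (tag_kfun F C).

Definition initial_kmor : kmor initial (tag_kfun F C) coslice_kfun.
Proof.
refine (@KMor K _ _ _ _ initial (tag_kfun F C) coslice_kfun (fun p => idlin (F (projT2 p))) _).
move=> p q f x.
exact: (@kcast_irr K O' F (projT2 p) (projT2 q) (svalP f)
  (svalP (fmap coslice_tag (fmap initial f))) x).
Defined.

(** [initial] is left adjoint to [coslice_tag]. The counit joins one composite to the identity, and
    the other composite is joined to it by identity components, so [hmap_nat] makes the two maps
    inverse to each other. *)
Lemma coslice_tag_bij n : lbij (hmap n coslice_tag_kmor).
Proof.
have k1 z : hmap n initial_kmor (hmap n coslice_tag_kmor z) = z.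
  rewrite -hmap_comp -[RHS](hmap_id (t := @KMor K _ _ _ _ (functor_id coslice) coslice_kfun
    coslice_kfun (fun p => idlin _) (fun _ _ _ _ => erefl)) (fun _ _ => erefl)).
  apply: (hmap_nat (psi := functor_id coslice) initial_counitN) => p x.
  exact: esym (@kcast_id K O' F (projT1 (projT2 p)) _ x).
have tN p q (f : mor (tag_el O' C) p q) :
    cmp (tag_el O' C) (exist _ (idm C (projT1 q)) erefl : mor (tag_el O' C) (coslice_tag (initial q)) q)
      (fmap (fcomp coslice_tag initial) f) =
    cmp (tag_el O' C) (fmap (functor_id (tag_el O' C)) f)
      (exist _ (idm C (projT1 p)) erefl : mor (tag_el O' C) (coslice_tag (initial p)) p).
  by apply: el_mor_eq; rewrite /= cmp1m cmpm1.
have k2 z : hmap n coslice_tag_kmor (hmap n initial_kmor z) = z.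
  rewrite -hmap_comp -[RHS](hmap_id (t := @KMor K _ _ _ _ (functor_id (tag_el O' C)) (tag_kfun F C)
    (tag_kfun F C) (fun p => idlin _) (fun _ _ _ _ => erefl)) (fun _ _ => erefl)).
  apply: (hmap_nat (psi := functor_id _) tN) => p x.
  exact: esym (@kcast_id K O' F (projT2 p) _ x).
split=> [z z0|y]; first by rewrite -(k1 z) z0 linear0.
by exists (hmap n initial_kmor y).
Qed.

(** A commutative square whose other sides are isomorphisms: Shapiro for the coslices, their
    contraction to initial objects, and Shapiro over [C], where [colim (lcov F)] is the sum of the
    [F a]. *)
Theorem hcol_lcov_bij n : lbij (hcol n (lcov F)).
Proof.
have sq z : hcol n (lcov F) (hmap n coslice_kmor z) = hmap n free_kmor (hmap n coslice_tag_kmor z).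
  rewrite /hcol -!hmap_comp; apply: (@hmap_nat K _ _ _ _
    (fcomp (proj1_functor C D) (el_proj coslice_km1 coslice_kmM))
    (fcomp (tag_proj O' C) coslice_tag)
    (fun p => idm C (projT1 p).1)).
    by move=> p q f; rewrite /= cmp1m cmpm1.
  by move=> p x; symmetry; apply: colim_lcov_in.
have [ai as_] := hmap_el_bij n coslice_good; have [bi bs] := hmap_el_bij n free_good.
have [ci cs] := coslice_tag_bij n.
split=> [y|y].
  by have [z <-] := as_ y; rewrite sq => /bi/ci ->; rewrite linear0.
have [x <-] := bs y; have [z <-] := cs x.
by exists (hmap n coslice_kmor z); rewrite sq.
Qed.
End FreeCase.
End Product.
End Kunneth.

(** * Construction of the Kuenneth components *)

Section KunnethTheorem.
Variable K : fieldType.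

Lemma lfactor (U V W : lmodType K) (j : {linear U -> V}) (f : {linear W -> V}) :
  linj j -> (forall x, exists u, j u = f x) ->
  exists g : {linear W -> U}, forall x, j (g x) = f x.
Proof.
move=> ji jf; have [|//||g gP] := @lin_of_rel K W U (fun x u => j u = f x).
- by move=> a u u' v v' uv uv'; rewrite !linearP uv uv'.
- by move=> v; rewrite linear0; apply: ji.
by exists g => x; apply/gP.
Qed.

Section Shift.
Variables (O : Type) (C : category O).

(** Dimension shift read off from the definition of [homol]: a kernel inclusion in degree one, a
    conversion above. *)
Definition hshift {n} {F : kfun K C} : {linear homol n.+1 F -> homol n (lomega F)} :=
  match n return {linear homol n.+1 F -> homol n (lomega F)} with
  | 0 => ker_in (colim_map (lomega_in F))
  | m.+1 => idlin (homol m.+1 (lomega F))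
  end.

Lemma hshift_linj n F : linj (@hshift n F).
Proof. by case: n => [|n]; [apply: ker_in_inj|move=> x]. Qed.

Lemma hshift_nat n F F' (t : knat F F') z :
  hshift (hmap n.+1 t z) = hmap n (lomega_map t) (hshift z).
Proof. by case: n z. Qed.

Opaque hmap.

Lemma hshift_lexact n F : lexact (@hshift n F) (hmap n (lomega_in F)).
Proof.
case: n => [|n]; first exact: ker_lexact.
by move=> y; split=> _; [exists y|apply: (@lsplit_h K _ _ n (lcov F) (lsplit_lcov F))].
Qed.

Lemma lomega_kses_F (F : kfun K C) : kses (lomega_in F) (leps F).
Proof. by move=> c; split; [apply: lomega_inj|apply: lomega_lexact|apply: leps_surj]. Qed.
End Shift.

Variables (O O' : Type) (C : category O) (D : category O').
Implicit Type F : kfun K D.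

Lemma ext_kses F F' F'' (i : knat F F') (q : knat F' F'') :
  kses i q -> kses (ext_nat C i) (ext_nat C q).
Proof. by move=> S c; apply: S. Qed.

Definition ext_lomega_kses F := ext_kses (lomega_kses_F F).

Definition ext_delta n F : {linear homol n.+1 (ext_pull C F) -> homol n (ext_pull C (lomega F))} :=
  delta n (ext_lomega_kses F).

Lemma ext_delta_nat n F F' (t : knat F F') z :
  ext_delta n F' (hmap n.+1 (ext_nat C t) z) = hmap n (ext_nat C (lomega_map t)) (ext_delta n F z).
Proof.
apply: (@delta_nat K _ _ _ _ (functor_id _) n _ _ _ _ _ _ _ _ _ _ _ _
  (ext_nat C (lomega_map t)) (ext_nat C (lcov_map t)) (ext_nat C t)) => // a x.
exact: esym (leps_lcov_map t x).
Qed.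

Lemma hcol_lsurj n F : lsurj (hcol C n F).
Proof.
move=> y; have [z <-] := hconst_lsurj (colim_map_lsurjN (@leps_surj _ _ _ F)) y.
have [w <-] := (hcol_lcov_bij C F n).2 z.
by exists (hmap n (ext_nat C (leps F)) w); rewrite hcol_nat.
Qed.

(* A class in the kernel of the connecting map comes from the linear cover, where it is
   detected by hcol. *)
Lemma hcol_cover_inj n F (l : homol n (ext_pull C (lcov F))) :
  hcol C n F (hmap n (ext_nat C (leps F)) l) = 0 -> hmap n (ext_nat C (leps F)) l = 0.
Proof.
rewrite hcol_nat => /(hconst_lexact (C := C) (n := n) (@colim_leps_lexact K _ _ F))[w wl].
have [w' w'w] := hcol_lsurj w.
have -> : l = hmap n (ext_nat C (lomega_in F)) w'.
  by apply: (linj_eq (hcol_lcov_bij C F n).1); rewrite hcol_nat w'w wl.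
by apply/(kses_h_lexactB (ext_lomega_kses F)); exists w'.
Qed.

Lemma hcol0_linj F : linj (hcol C 0 F).
Proof.
move=> y; have [l <-] := kses_h_lsurj (ext_lomega_kses F) y.
exact: (hcol_cover_inj (n := 0)).
Qed.

(** With [hcol_delta_surj] this describes degree [n.+1]: a class amounts to its connecting image,
    which may be any class killed in the cover, and to its value under [hcol], which is
    arbitrary. *)
Lemma hcol_delta_inj n F (y : homol n.+1 (ext_pull C F)) :
  ext_delta n F y = 0 -> hcol C n.+1 F y = 0 -> y = 0.
Proof. by move=> /kses_h_lexactD[l <-]; apply: hcol_cover_inj. Qed.

Lemma hcol_delta_surj n F (v : homol n.+1 (kconst C (colim F))) (e : homol n (ext_pull C (lomega F))) :
  hmap n (ext_nat C (lomega_in F)) e = 0 ->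
  exists y, ext_delta n F y = e /\ hcol C n.+1 F y = v.
Proof.
move=> /(kses_h_lexactA (ext_lomega_kses F))[y <-].
(* A class from the cover corrects the value of [hcol] without changing the connecting image. *)
have [z zE] := hconst_lsurj (colim_map_lsurjN (@leps_surj _ _ _ F)) (v - hcol C n.+1 F y).
have [w wE] := (hcol_lcov_bij C F n.+1).2 z.
exists (y + hmap n.+1 (ext_nat C (leps F)) w); split; last first.
  by rewrite linearD hcol_nat wE zE addrC subrK.
rewrite linearD [X in _ + X](_ : _ = 0) ?addr0//.
by apply/(kses_h_lexactD (ext_lomega_kses F)); exists w.
Qed.

(** [H_1(D, F)] is the kernel of [colim (lomega F) -> colim (lcov F)], so by [hconst_lexact] a class
    that dies in the cover, as connecting images do, comes from [H_k(C, H_1(D, F))]. *)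
Lemma kcomp1_exists k F : exists g : {linear homol k.+1 (ext_pull C F) -> homol k (kconst C (homol 1 F))},
  forall y, hconst C k (hshift (n := 0) (F := F)) (g y) = hcol C k (lomega F) (ext_delta k F y).
Proof.
apply: (lfactor (f := cmplin (hcol C k (lomega F)) (ext_delta k F))).
  exact/hconst_linj/hshift_linj.
move=> y; rewrite cmplinE.
apply: (hconst_lexact (C := C) (n := k) (@hshift_lexact _ _ 0 F) _).1.
rewrite -[LHS]hcol_nat (_ : hmap k _ _ = 0) ?linear0//.
by apply/(kses_h_lexactA (ext_lomega_kses F)); exists y.
Qed.

(* The (k, l) component of the Kuenneth decomposition: l connecting maps followed by hcol. *)
Fixpoint hcomp l k F : {linear homol (l + k) (ext_pull C F) -> homol k (kconst C (homol l F))} :=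
  match l return {linear homol (l + k) (ext_pull C F) -> homol k (kconst C (homol l F))} with
  | 0 => hcol C k F
  | l'.+1 =>
    match l' return (forall F, {linear homol (l' + k) (ext_pull C F) -> homol k (kconst C (homol l' F))}) ->
        {linear homol (l' + k).+1 (ext_pull C F) -> homol k (kconst C (homol l'.+1 F))} with
    | 0 => fun _ => sval (cid (kcomp1_exists k F))
    | l''.+1 => fun rec => cmplin (rec (lomega F)) (ext_delta (l''.+1 + k) F)
    end (hcomp l' k)
  end.

(** One recursion formula for all [l]: for [l = 0] it is the property chosen in [kcomp1_exists], and
    above that [hshift] is an identity. *)
Lemma hcompS l k F y : hconst C k (hshift (n := l) (F := F)) (hcomp l.+1 k F y) =
  hcomp l k (lomega F) (ext_delta (l + k) F y).
Proof.
case: l y => [|l] y; first by rewrite /hcomp; case: cid => g /= ->.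
by rewrite (hconst_id (e := hshift (n := l.+1) (F := F))).
Qed.

Lemma hcomp_nat l k F F' (t : knat F F') y :
  hcomp l k F' (hmap (l + k) (ext_nat C t) y) = hconst C k (hmap l t) (hcomp l k F y).
Proof.
elim: l F F' t y => [|l IH] F F' t y; first exact: hcol_nat.
apply: (linj_eq (hconst_linj (n := k) (@hshift_linj _ _ l F'))).
have E : ext_delta (l + k) F' (hmap (l.+1 + k) (ext_nat C t) y) =
    hmap (l + k) (ext_nat C (lomega_map t)) (ext_delta (l + k) F y) := ext_delta_nat t y.
rewrite [LHS]hcompS E IH -[hcomp l k (lomega F) _]hcompS.
rewrite -(hconst_comp (e := cmplin (hmap l (lomega_map t)) (hshift (n := l) (F := F))) (fun=> erefl)).
by apply: hconst_comp => x; rewrite cmplinE hshift_nat.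
Qed.

Definition hcompc m l k (e : (l + k)%N = m) F :
    {linear homol m (ext_pull C F) -> homol k (kconst C (homol l F))} :=
  match e in _ = m return {linear homol m (ext_pull C F) -> homol k (kconst C (homol l F))} with
  | erefl => hcomp l k F
  end.

Lemma hcompc_nat m l k (e : (l + k)%N = m) F F' (t : knat F F') y :
  hcompc e F' (hmap m (ext_nat C t) y) = hconst C k (hmap l t) (hcompc e F y).
Proof. by case: m / e y => y; apply: hcomp_nat. Qed.

Lemma hcompcS m l k (e : (l.+1 + k)%N = m.+1) (e' : (l + k)%N = m) F y :
  hconst C k (hshift (n := l) (F := F)) (hcompc e F y) = hcompc e' (lomega F) (ext_delta m F y).
Proof.
by subst m; rewrite (Prop_irrelevance e erefl); apply: hcompS.
Qed.

Lemma hcompc0 m (e : (0 + m)%N = m) F y : hcompc e F y = hcol C m F y.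
Proof. by rewrite (Prop_irrelevance e erefl). Qed.

(** The components with positive [l] are those of the connecting image, by [hcompcS], and the one
    with [l = 0] is [hcol]; [hcol_delta_inj] needs no more. *)
Lemma hcompc_inj m F (y : homol m (ext_pull C F)) :
  (forall l k (e : (l + k)%N = m), hcompc e F y = 0) -> y = 0.
Proof.
elim: m F y => [|m IH] F y y0.
  by apply: hcol0_linj; have := y0 0 0 erefl; rewrite hcompc0.
apply: hcol_delta_inj; last by have := y0 0 m.+1 erefl; rewrite hcompc0.
apply: IH => l k e.
by rewrite -(hcompcS (congr1 S e)) y0 linear0.
Qed.

Lemma hcompc_surj m F (w : forall l k, (l + k)%N = m -> homol k (kconst C (homol l F))) :
  exists y, forall l k e, hcompc e F y = w l k e.
Proof.
elim: m F w => [|m IH] F w.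
  have [y yE] := hcol_lsurj (w 0 0 erefl); exists y => -[|//] [|//] e.
  by rewrite hcompc0 yE; congr (w _ _ _); apply: Prop_irrelevance.
(* The prescribed components with positive [l], read as components for the syzygy. *)
pose w' l k (e : (l + k)%N = m) := hconst C k (hshift (n := l) (F := F)) (w l.+1 k (congr1 S e)).
have [e0 e0E] := IH _ w'.
have [|y [yd yc]] := @hcol_delta_surj m F (w 0 m.+1 erefl) e0.
  (* [hcol] is injective on the cover, so only the component [w' 0 m] of [e0] matters, and it comes
     from [H_m(C, H_1(D, F))]. *)
  apply: (hcol_lcov_bij C F m).1; rewrite hcol_nat -(hcompc0 erefl) e0E /w'.
  apply: (hconst_lexact (C := C) (n := m) (@hshift_lexact _ _ 0 F) _).2.
  by exists (w 1 m (congr1 S erefl)).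
exists y => -[|l] k e.
  have ke : k = m.+1 := e; subst k.
  by rewrite hcompc0 yc; congr (w _ _ _); apply: Prop_irrelevance.
have e' : (l + k)%N = m by case: e.
apply: (linj_eq (hconst_linj (n := k) (@hshift_linj _ _ l F))).
rewrite (hcompcS e e') yd e0E /w'; congr (hconst _ _ _ (w _ _ _)).
exact: Prop_irrelevance.
Qed.
End KunnethTheorem.

Section FullSubcategory.
Variables (O O' : Type) (C : category O) (ob : O' -> O).
Definition fullsub : category O' :=
  @Category O' (fun a b => mor C (ob a) (ob b)) (fun a => idm C (ob a))
    (fun a b c g f => cmp C g f) (fun a b f => cmp1m f) (fun a b f => cmpm1 f)
    (fun a b c d k g f => cmpA k g f).
Definition fullsub_in : functor fullsub C :=
  @Functor O' O fullsub C ob (fun a b f => f) (fun _ => erefl) (fun _ _ _ _ _ => erefl).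
End FullSubcategory.

(** * The stable homology of linear covers *)

Section StableFree.
Variable G : bsm_groupoid addn 0%N.
Local Notation UG := (quillen G).
Hypothesis stab_inj : forall a b : nat, injective (fun f : mor G a a => mt G f (idm G b)).
Hypothesis no_hom : forall a b : nat, mor G a b -> a = b.

Lemma stab_aut_inj n : injective (@stab_aut_fun G n).
Proof. by move=> f g /cmp_rinj/cmp_linj/stab_inj. Qed.

Lemma to_Ginf_inj n : injective (@to_Ginf G n).
Proof.
move=> f g /sc_in_eq[k]; elim: k => //= k IH.
by move=> /stab_aut_inj.
Qed.

Lemma Ginf_ind (P : Ginf G -> Prop) : (forall n (f : aut G n), P (to_Ginf f)) -> forall g, P g.
Proof. exact: sc_ind. Qed.

Variable K : fieldType.

Section Stages.
Variable F : kfun K UG.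

Definition stage_s n : kmor (@ifunctor unit (group_cat (aut G n)) (group_cat (aut G n.+1))
  (fun _ _ => stab_aut G n) (fun _ => gc_s1 (stab_aut G) n) (fun _ _ _ => @stab_autM G n)) (Fn F n) (Fn F n.+1).
Proof.
refine (@KMor K _ _ _ _ (ifunctor _ _) (Fn F n) (Fn F n.+1) (fun _ => km F (stab_hom G n)) _).
by move=> a b f x; rewrite /= -!kmM stab_homN.
Defined.

(** The data of [to_Finf_mor] over a functor in the form that [h_mcsys] expects; [stage_t_to_stable]
    compares the two. *)
Definition stage_t n : kmor (@ifunctor unit (group_cat (aut G n)) (group_cat (Ginf G))
  (fun _ _ => @to_Ginf G n) (fun _ => gc_in1 (stab_aut G) n) (fun _ _ _ => @gc_inM _ (stab_aut G) n))
  (Fn F n) (Finf F).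
Proof.
refine (@KMor K _ _ _ _ (ifunctor _ _) (Fn F n) (Finf F) (fun _ => to_Finf F n) _).
by move=> a b f x; symmetry; apply: Finf_actE.
Defined.

Lemma to_Finf_step n x : to_Finf F n.+1 (km F (stab_hom G n) x) = to_Finf F n x.
Proof. exact: mc_in_step. Qed.

Lemma Finf_mcsys : @mcsys K (fun n => F n) (fun n => km F (stab_hom G n)) (Finf_mod F) (to_Finf F).
Proof.
split; first exact: to_Finf_step; last by move=> n x; apply: mc_in_evz.
by apply: mc_ind => n x; exists n, x.
Qed.

Theorem stage_mcsys m : @mcsys K (fun n => homol m (Fn F n)) (fun n => hmap m (stage_s n))
  (homol m (Finf F)) (fun n => hmap m (stage_t n)).
Proof.
apply: (@h_mcsys K unit (fun n => group_cat (aut G n)) (group_cat (Ginf G))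
  (fun n _ _ => stab_aut G n) (fun n _ => gc_s1 (stab_aut G) n) (fun n _ _ _ => @stab_autM G n)
  (fun n _ _ => @to_Ginf G n) (fun n _ => gc_in1 (stab_aut G) n)
  (fun n _ _ _ => @gc_inM _ (stab_aut G) n)).
- by move=> n a b f; apply: gc_in_step.
- by move=> a b; apply: Ginf_ind => n f; exists n, f.
- by move=> n a b f g /to_Ginf_inj ->; apply: eveq_now.
- by move=> a; apply: Finf_mcsys.
Qed.

Lemma stage_t_to_stable m n z : hmap m (stage_t n) z = hmap m (to_Finf_mor F n) z.
Proof.
apply: (@hmap_nat K _ _ _ _ _ (to_Ginf_functor G n) (fun _ => 1%g : mor (group_cat (Ginf G)) _ _)).
  by move=> a b f; rewrite /= mul1g mulg1.
by move=> a x; symmetry; apply: Finf_act1.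
Qed.

Lemma stable_aug_exists : exists f : {linear Finf_mod F -> colim F},
  forall n x, f (to_Finf F n x) = colim_in F n x.
Proof. by apply: (mcsys_lift Finf_mcsys) => n x; apply: colim_inE. Qed.

Definition stable_aug_fun : {linear Finf_mod F -> colim F} := sval (cid stable_aug_exists).

Lemma stable_aug_funE n x : stable_aug_fun (to_Finf F n x) = colim_in F n x.
Proof. by rewrite /stable_aug_fun; case: cid => f /= ->. Qed.

Definition stable_aug : knat (Finf F) (kconst (group_cat (Ginf G)) (colim F)).
Proof.
refine (@KMor K _ _ _ _ (functor_id _) (Finf F) (kconst (group_cat (Ginf G)) (colim F))
  (fun _ => stable_aug_fun) _).
move=> a b; apply: sc_ind2 => n f x.
rewrite -[sc_in _ x]/(to_Finf F n x) [X in stable_aug_fun X](Finf_actE f x).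
by rewrite !stable_aug_funE colim_inE.
Defined.
End Stages.

Section GSet.
Variable a : nat.
Definition stab_set := scolim (fun n (u : mor UG a n) => cmp UG (stab_hom G n) u).
Definition stab_in n (u : mor UG a n) : stab_set := sc_in (fun n (u : mor UG a n) => cmp UG (stab_hom G n) u) u.

Lemma stab_in_step n u : stab_in (cmp UG (stab_hom G n) u) = stab_in u.
Proof. exact: sc_in_step. Qed.

Definition stab_act (g : Ginf G) (x : stab_set) : stab_set :=
  sc_op2 (fun n (u : mor UG a n) => cmp UG (stab_hom G n) u)
    (fun n (f : aut G n) (u : mor UG a n) => cmp UG (fmap (qemb G) f) u) g x.

Lemma stab_actE n (f : aut G n) (u : mor UG a n) :
  stab_act (to_Ginf f) (stab_in u) = stab_in (cmp UG (fmap (qemb G) f) u).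
Proof. by apply: sc_op2E => m k v; rewrite [LHS]cmpA [RHS]cmpA stab_homN. Qed.

Lemma stab_act1 x : stab_act 1%g x = x.
Proof.
move: x; apply: sc_ind => n u; rewrite -(gc_in1 (stab_aut G) n) -/(stab_in u).
by rewrite stab_actE fmap1 cmp1m.
Qed.

Lemma stab_actM g k x : stab_act (g * k)%g x = stab_act g (stab_act k x).
Proof.
move: g k x; apply: sc_ind3 => n g k u.
rewrite -/(stab_in u) -!/(to_Ginf _) /to_Ginf -gc_inM.
by rewrite !stab_actE cmpA -fmapM.
Qed.

Definition stab_base : stab_set := stab_in (idm UG a).

Lemma stab_in_xstab m : stab_in (xstab G a m) = stab_base.
Proof. by elim: m => [|m IH]; rewrite ?xstab0// -xstabS stab_in_step. Qed.

Lemma stab_act_transitive x : exists g, stab_act g stab_base = x.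
Proof.
move: x; apply: sc_ind => n u; have [m [e [g ->]]] := xstab_transitive no_hom u.
by subst n; exists (to_Ginf g); rewrite -(stab_in_xstab m) stab_actE.
Qed.

(** Equality in [Colim_n Hom(a, n)] is equality after finitely many stabilisations. At that stage
    [xstab_stabilizer] applies, and the stabilised element has the same image in [G_oo]. *)
Lemma stab_act_stabilizer g : stab_act g stab_base = stab_base ->
  exists m k, to_Ginf (sstab a k : aut G (m + a)) = g.
Proof.
move: g; apply: Ginf_ind => n g.
have [g' gg'] := sc_level (fun n => stab_aut G n) g (leq_addr a n).
rewrite (gg' : to_Ginf g = to_Ginf g') {gg'} -(stab_in_xstab n) stab_actE => /sc_inP[i [j]] E.
have ij : i = j.
  apply/(@addIn (n + a)); move: E; rewrite !sc_iter => E.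
  exact: (congr1 (@projT1 _ _) E).
(* The induction moves one stabilisation at a time from the equation [E] into [n], stabilising [g]
   accordingly. *)
rewrite -ij in E; elim: i n g' E {g j ij} => [|i IH] n g.
  move=> E; have {}E := @sc_pair_inj (fun n => mor UG a n) _ _ _ E.
  by have [k <-] := (xstab_stabilizer g).1 E; exists n, k.
rewrite !iterSr => E.
have E1 : cmp UG (stab_hom G (n + a)) (cmp UG (fmap (qemb G) g) (xstab G a n)) =
    cmp UG (fmap (qemb G) (stab_aut_fun g)) (xstab G a n.+1).
  by rewrite cmpA stab_homN -cmpA xstabS.
have [|m [k kE]] := IH n.+1 (stab_aut_fun g); first by rewrite -E1 -xstabS; exact: E.
by exists m, k; rewrite kE; apply: gc_in_step.
Qed.
End GSet.

Section Elements.
Local Notation Gc := (group_cat (Ginf G)).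

Definition base_set (u : unit) := {a : nat & stab_set a}.
Definition base_act (u v : unit) (g : mor Gc u v) (x : base_set u) : base_set v :=
  existT _ (projT1 x) (stab_act g (projT2 x)).

Lemma base_act1 u (x : base_set u) : base_act (idm Gc u) x = x.
Proof. by case: x => a x; rewrite /base_act stab_act1. Qed.

Lemma base_actM u v w (g : mor Gc v w) (f : mor Gc u v) (x : base_set u) :
  base_act (cmp Gc g f) x = base_act g (base_act f x).
Proof. by rewrite /base_act stab_actM. Qed.

Definition elG := el base_act1 base_actM.

Variable F : nat -> lmodType K.

Definition elG_tag : functor elG (tag_el nat Gc) :=
  tag_functor base_act1 base_actM (tag := fun u (x : base_set u) => projT1 x) (fun _ _ _ _ => erefl).

Definition elG_kfun : kfun K elG := kpull elG_tag (tag_kfun F Gc).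

Definition elG_base (p : el_obj (fun _ : unit => nat)) : el_obj base_set :=
  existT base_set (projT1 p) (existT _ (projT2 p) (stab_base (projT2 p))).

(** One base point for each [a]: this category is the disjoint union of the stabilisers. *)
Definition elG0 := fullsub elG elG_base.
Definition elG0_in : functor elG0 elG := fullsub_in elG elG_base.
Definition elG0_kfun : kfun K elG0 := kpull elG0_in elG_kfun.

(** Transitivity gives each object an isomorphism [th] from a base point. Conjugation by these is a
    functor [rho] back to the base points, and [th] is natural. *)
Lemma elG0_in_lsurj m : lsurj (hmap m (kpull_mor elG0_in elG_kfun)).
Proof.
have ex (p : el_obj base_set) : exists g : Ginf G, stab_act g (stab_base (projT1 (projT2 p))) = projT2 (projT2 p).
  exact: stab_act_transitive.
pose gam p := sval (cid (ex p)).
have gamP p : stab_act (gam p) (stab_base (projT1 (projT2 p))) = projT2 (projT2 p).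
  by rewrite /gam; case: cid.
pose bp (p : el_obj base_set) : el_obj (fun _ : unit => nat) :=
  existT (fun _ => nat) (projT1 p) (projT1 (projT2 p)).
have thE p : base_act (gam p : mor Gc _ (projT1 p)) (projT2 (elG_base (bp p))) = projT2 p.
  by case: p (gamP p) => u [a x] /= E; rewrite /base_act /= E.
pose th p : mor elG (elG_base (bp p)) p := exist _ (gam p) (thE p).
have invE p q (f : mor elG p q) :
    base_act ((sval f : Ginf G)^-1%g : mor Gc (projT1 q) (projT1 p)) (projT2 q) = projT2 p.
  case: f => g ge; rewrite [sval _]/= -ge -base_actM /= mulVg; exact: base_act1.
pose inv p q (f : mor elG p q) : mor elG q p := exist _ _ (invE p q f).
pose rm p q (f : mor elG p q) : mor elG0 (bp p) (bp q) := cmp elG (inv _ _ (th q)) (cmp elG f (th p)).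
have rm1 p : rm p p (idm elG p) = idm elG0 (bp p).
  by apply: el_mor_eq; rewrite /= mul1g mulVg.
have rmM p q r (g : mor elG q r) (f : mor elG p q) : rm p r (cmp elG g f) = cmp elG0 (rm q r g) (rm p q f).
  by apply: el_mor_eq; rewrite /= !mulgA mulgK.
pose rho := @Functor _ _ elG elG0 bp rm rm1 rmM.
have rN p q (f : mor elG p q) x :
    idlin (F (projT1 (projT2 q))) (km elG_kfun f x) = km elG0_kfun (fmap rho f) (idlin (F (projT1 (projT2 p))) x).
  exact: (@kcast_irr K nat F _ _ _ _ x).
pose R := @KMor K _ _ _ _ rho elG_kfun elG0_kfun (fun p => idlin (F (projT1 (projT2 p)))) rN.
move=> z; exists (hmap m R z).
rewrite -hmap_comp -[RHS](hmap_id (t := @KMor K _ _ _ _ (functor_id elG) elG_kfun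
  elG_kfun (fun p => idlin _) (fun _ _ _ _ => erefl)) (fun _ _ => erefl)).
apply: (@hmap_nat K _ _ _ _ (fcomp elG0_in rho) (functor_id elG) th).
  by move=> p q f; apply: el_mor_eq; rewrite /= !mulgA mulgV mul1g.
by move=> p x; symmetry; apply: (@kcast_id K nat F).
Qed.

Section TagMap.
Variables (H H' : groupType) (phi : H -> H').
Hypothesis phi1 : phi 1%g = 1%g.
Hypothesis phiM : forall x y, phi (x * y)%g = (phi x * phi y)%g.

Definition tag_map p q (f : mor (tag_el nat (group_cat H)) p q) :
  mor (tag_el nat (group_cat H')) p q := exist _ (phi (sval f)) (svalP f).
Lemma tag_map1 p : tag_map (idm (tag_el nat (group_cat H)) p) = idm _ p.
Proof. exact: el_mor_eq. Qed.
Lemma tag_mapM p q r (g : mor (tag_el nat (group_cat H)) q r) (f : mor (tag_el nat (group_cat H)) p q) :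
  tag_map (cmp _ g f) = cmp _ (tag_map g) (tag_map f).
Proof. by apply: el_mor_eq; apply: phiM. Qed.
Definition tag_mapF := ifunctor tag_map1 tag_mapM.
Definition tag_map_kmor : kmor tag_mapF (tag_kfun F (group_cat H)) (tag_kfun F (group_cat H')).
Proof.
refine (@KMor K _ _ _ _ tag_mapF (tag_kfun F (group_cat H)) (tag_kfun F (group_cat H'))
  (fun p => idlin (F (projT2 p))) _).
by move=> p q f x; apply: (@kcast_irr K nat F).
Defined.
End TagMap.

Lemma lstab1 n : lstab (1%g : aut G n) = (1%g : aut G n.+1).
Proof. exact: (mt1 G 1%N n). Qed.

Definition tagk n := tag_el nat (group_cat (aut G n)).

Lemma sstab_base a b (e : a = b) n (k : aut G n) :
  existT stab_set a (stab_act (to_Ginf (sstab a k : aut G (n + a))) (stab_base a)) =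
  existT stab_set b (stab_base b).
Proof.
subst b; congr existT; rewrite -[in LHS](stab_in_xstab a n) stab_actE.
by rewrite (xstab_stabilizer _).2 ?stab_in_xstab //; exists k.
Qed.

Definition base_map n p q (f : mor (tagk n) p q) : mor elG0 p q :=
  exist _ (to_Ginf (sstab (projT2 p) (sval f) : aut G (n + projT2 p))) (sstab_base (svalP f) (sval f)).

Lemma base_map1 n p : base_map (idm (tagk n) p) = idm elG0 p.
Proof.
apply: el_mor_eq; rewrite /= -(gc_in1 (stab_aut G) (n + projT2 p)); congr gc_in.
exact: sstab1.
Qed.

Lemma base_mapM n p q r (g : mor (tagk n) q r) (f : mor (tagk n) p q) :
  base_map (cmp (tagk n) g f) = cmp elG0 (base_map g) (base_map f).
Proof.
apply: el_mor_eq; rewrite /=.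
case: p q r f g => [u a] [v b] [w c] [f /= e] [g e']; subst b.
by rewrite -gc_inM; congr gc_in; apply: sstabM.
Qed.

Definition base_kmor n : kmor (ifunctor (@base_map1 n) (@base_mapM n)) (tag_kfun F (group_cat (aut G n))) elG0_kfun.
Proof.
refine (@KMor K _ _ _ _ (ifunctor (@base_map1 n) (@base_mapM n)) (tag_kfun F (group_cat (aut G n))) elG0_kfun
  (fun p => idlin (F (projT2 p))) _).
by move=> p q f x; apply: (@kcast_irr K nat F).
Defined.

Definition tag_lstab_kmor n := tag_map_kmor (H := aut G n) (H' := aut G n.+1) (phi := @lstab G n) (lstab1 n) (@lstabM G n).
Definition tag_stab_kmor n := tag_map_kmor (H := aut G n) (H' := aut G n.+1) (phi := @stab_aut_fun G n) (gc_s1 (stab_aut G) n) (@stab_autM G n).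
Definition tag_Ginf_kmor n := tag_map_kmor (H := aut G n) (H' := Ginf G) (phi := @to_Ginf G n) (gc_in1 (stab_aut G) n) (@gc_inM _ (stab_aut G) n).

Lemma const_mcsys (V : lmodType K) :
  @mcsys K (fun _ => V) (fun _ => idlin V) V (fun _ => idlin V).
Proof.
split=> // [y|n x x0]; first by exists 0, y.
by rewrite (x0 : x = 0); apply: evz_now.
Qed.

Lemma tag_mcsys m : @mcsys K (fun n => homol m (tag_kfun F (group_cat (aut G n))))
  (fun n => hmap m (tag_stab_kmor n)) (homol m (tag_kfun F Gc)) (fun n => hmap m (tag_Ginf_kmor n)).
Proof.
apply: (@h_mcsys K _ tagk (tag_el nat Gc) _ (fun n => tag_map1 (H := aut G n) (H' := aut G n.+1) (phi := @stab_aut_fun G n) (gc_s1 (stab_aut G) n))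
  (fun n => tag_mapM (H := aut G n) (H' := aut G n.+1) (phi := @stab_aut_fun G n) (@stab_autM G n)) _ (fun n => tag_map1 (H := aut G n) (H' := Ginf G) (phi := @to_Ginf G n) (gc_in1 (stab_aut G) n))
  (fun n => tag_mapM (H := aut G n) (H' := Ginf G) (phi := @to_Ginf G n) (@gc_inM _ (stab_aut G) n))).
- by move=> n p q f; apply: el_mor_eq; apply: gc_in_step.
- move=> p q [g e]; have [n [f fg]] : exists n (f : aut G n), to_Ginf f = g.
    by move: g {e}; apply: Ginf_ind => n f; exists n, f.
  by exists n, (exist _ f e); apply: el_mor_eq.
- move=> n p q f g fg; have -> : f = g; last exact: eveq_now.
  by apply: el_mor_eq; apply: to_Ginf_inj; apply: (congr1 sval fg).
- by move=> p; apply: const_mcsys.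
Qed.

(** The stabilisers are the colimit of the [G_n] along left stabilisation: [sstabS] gives
    compatibility, [stab_act_stabilizer] exhaustion and [sstab_inj] injectivity. *)
Lemma base_mcsys m : @mcsys K (fun n => homol m (tag_kfun F (group_cat (aut G n))))
  (fun n => hmap m (tag_lstab_kmor n)) (homol m elG0_kfun) (fun n => hmap m (base_kmor n)).
Proof.
apply: (@h_mcsys K _ tagk elG0 _ (fun n => tag_map1 (H := aut G n) (H' := aut G n.+1) (phi := @lstab G n) (lstab1 n))
  (fun n => tag_mapM (H := aut G n) (H' := aut G n.+1) (phi := @lstab G n) (@lstabM G n)) _ base_map1 base_mapM).
- move=> n p q f; apply: el_mor_eq => /=; rewrite -[RHS]gc_in_step; congr gc_in.
  exact: sstabS.
- move=> p q [g ge]; have e : projT2 p = projT2 q := congr1 (@projT1 _ _) ge.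
  have g0 : stab_act g (stab_base (projT2 p)) = stab_base (projT2 p).
    case: p q g ge e => [u a] [v b] g /= ge e; subst b.
    by have := projT2_eq ge; rewrite (Prop_irrelevance (projT1_eq ge) erefl).
  have [n [k kE]] := stab_act_stabilizer g0.
  by exists n, (exist _ k e); apply: el_mor_eq.
- move=> n p q f g fg; have -> : f = g; last exact: eveq_now.
  apply: el_mor_eq; apply: (@sstab_inj G (projT2 p) stab_inj); apply: to_Ginf_inj.
  exact: (congr1 sval fg).
- by move=> p; apply: const_mcsys.
Qed.

(** [cstab] is a natural transformation between the two stabilisation functors. *)
Lemma tag_lstab_stab m n z : hmap m (tag_lstab_kmor n) z = hmap m (tag_stab_kmor n) z.
Proof.
pose th (p : el_obj (fun _ : unit => nat)) : mor (tagk n.+1) p p := exist _ (cstab G n) erefl.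
apply: (@hmap_nat K _ _ _ _ (tag_mapF (H := aut G n) (H' := aut G n.+1) (phi := @lstab G n) (lstab1 n) (@lstabM G n))
  (tag_mapF (H := aut G n) (H' := aut G n.+1) (phi := @stab_aut_fun G n) (gc_s1 (stab_aut G) n) (@stab_autM G n)) th).
  by move=> p q f; apply: el_mor_eq; apply: cstab_lstab.
by move=> p x; symmetry; apply: (@kcast_id K nat F).
Qed.

Definition elG0_tag_kmor := kcomp (kpull_mor elG_tag (tag_kfun F Gc)) (kpull_mor elG0_in elG_kfun).

(** Both functors send [G_n] to [G_oo]; they differ by the conjugations of [to_Ginf_sstab], one
    element for each [a]. *)
Lemma elG0_tag_base m n z : hmap m elG0_tag_kmor (hmap m (base_kmor n) z) = hmap m (tag_Ginf_kmor n) z.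
Proof.
have ex a := @to_Ginf_sstab G a n.
pose c a := sval (cid (ex a)).
have cP a (k : aut G n) : to_Ginf (sstab a k : aut G (n + a)) = (c a * to_Ginf k * (c a)^-1)%g.
  by rewrite /c; case: cid.
pose th (p : el_obj (fun _ : unit => nat)) : mor (tag_el nat Gc) p p := exist _ ((c (projT2 p))^-1)%g erefl.
rewrite -hmap_comp; apply: (@hmap_nat K _ _ _ _ (fcomp (fcomp elG_tag elG0_in)
  (ifunctor (@base_map1 n) (@base_mapM n)))
  (tag_mapF (H := aut G n) (H' := Ginf G) (phi := @to_Ginf G n) (gc_in1 (stab_aut G) n) (@gc_inM _ (stab_aut G) n)) th).
  move=> p q f; apply: el_mor_eq; rewrite /= cP.
  have -> : c (projT2 q) = c (projT2 p) by congr c; symmetry; apply: (svalP f).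
  by rewrite -!mulgA mulKg.
by move=> p x; symmetry; apply: (@kcast_id K nat F).
Qed.

(* Both homologies are colimits over n of the homology of the same stages; the two
   systems of transition maps differ by conjugation by cstab. *)
Lemma elG0_tag_bij m : lbij (hmap m elG0_tag_kmor).
Proof.
have [_ bsurj _] := base_mcsys m; have [_ tsurj tinj] := tag_mcsys m.
have [bs _ _] := base_mcsys m.
split=> [y|y].
  (* A class that dies in [G_oo] dies after finitely many right stabilisations. On homology these
     are left ones, so it dies in the stabilisers as well. *)
  have [n [z <-]] := bsurj y; rewrite elG0_tag_base => /tinj.
  elim=> [k|k {}z _ IH]; first exact: linear0.
  by rewrite -bs tag_lstab_stab.
have [n [z <-]] := tsurj y; exists (hmap m (base_kmor n) z).
exact: elG0_tag_base.
Qed.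

Lemma elG_tag_bij m : lbij (hmap m (kpull_mor elG_tag (tag_kfun F Gc))).
Proof.
have [oi os] := elG0_tag_bij m.
split=> [z|y].
  have [y <-] := elG0_in_lsurj z; rewrite -hmap_comp => /oi ->.
  by rewrite linear0.
have [x <-] := os y; exists (hmap m (kpull_mor elG0_in elG_kfun) x).
by rewrite -hmap_comp.
Qed.
End Elements.

Section FreeStable.
Variable F : kfun K UG.
Local Notation Gc := (group_cat (Ginf G)).

(** [stab_free_fun] evaluates a point through its [repr]; stabilising a representative does not
    change its class in [(lcov F)_oo]. *)
Lemma stab_free_val a n (u : mor UG a n) (q := repr (stab_in u)) v :
  to_Finf (lcov F) (projT1 q) (lcov_in F (projT2 q) v) = to_Finf (lcov F) n (lcov_in F u v).
Proof.
pose step := sc_step (fun n (u : mor UG a n) => cmp UG (stab_hom G n) u).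
pose val (r : sc_pre (mor UG a)) := to_Finf (lcov F) (projT1 r) (lcov_in F (projT2 r) v).
have valS1 r : val (step r) = val r.
  rewrite -[RHS]/(to_Finf (lcov F) (projT1 r) (lcov_in F (projT2 r) v)) -to_Finf_step.
  by congr (to_Finf _ _ _); symmetry; apply: lcov_kmE.
have valS i r : val (iter i step r) = val r by elim: i => //= i <-; apply: valS1.
rewrite -[LHS]/(val q) -[RHS]/(val (sc_pair u)).
have : stab_in (projT2 q) = stab_in u by rewrite -[RHS]reprK -/q; case: (q).
move=> /sc_inP[i [j E]]; rewrite -(valS j (sc_pair u)) -E valS.
by case: (q).
Qed.

Definition stab_free_fun (p : el_obj base_set) : {linear F (projT1 (projT2 p)) -> Finf_mod (lcov F)} :=
  cmplin (to_Finf (lcov F) (projT1 (repr (projT2 (projT2 p)))))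
         (lcov_in F (projT2 (repr (projT2 (projT2 p))))).

Lemma stab_free_funE u a n (w : mor UG a n) v :
  stab_free_fun (existT base_set u (existT _ a (stab_in w))) v = to_Finf (lcov F) n (lcov_in F w v).
Proof. exact: stab_free_val. Qed.

Lemma stab_free_funN u u' (g : Ginf G) a x (y : base_set u')
    (e : existT stab_set a (stab_act g x) = y) (e' : a = projT1 y) v :
  stab_free_fun (existT base_set u' y) (kcast F e' v) =
  Finf_act (lcov F) g (stab_free_fun (existT base_set u (existT _ a x)) v).
Proof.
subst y; rewrite (kcast_id e'); move: g x {e'}; apply: sc_ind2 => n g x.
rewrite -/(to_Ginf g) -/(stab_in x) stab_actE !stab_free_funE.
by rewrite [RHS]Finf_actE; congr (to_Finf _ _ _); rewrite [RHS]lcov_kmE.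
Qed.

Definition stab_free : kmor (el_proj base_act1 base_actM) (elG_kfun F) (Finf (lcov F)).
Proof.
refine (@KMor K _ _ _ _ (el_proj base_act1 base_actM) (elG_kfun F) (Finf (lcov F)) stab_free_fun _).
move=> [u [a x]] [u' y] [g ge] v.
exact: (stab_free_funN u (g := g) (x := x) ge).
Defined.

(** At stage [n] the cover is a sum over all [Hom(a, n)], so [(lcov F)_oo] is a sum over the points
    of the colimit sets; [k], glued from the [w n], is the inverse. *)
Lemma stab_free_good : el_good stab_free.
Proof.
move=> u; pose M (x : base_set u) := elG_kfun F (existT _ u x).
pose w n : {linear lcov F n -> dsum M} :=
  lcov_lift (fun a (f : mor UG a n) => dsum_in M (existT _ a (stab_in f))).
have wE n a (f : mor UG a n) v : w n (lcov_in F f v) = dsum_in M (existT _ a (stab_in f)) v.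
  exact: lcov_liftE.
clearbody w.
have [|k kP] := mcsys_lift (Finf_mcsys (lcov F)) (w := w).
  move=> n; apply: (lcov_ext (u := cmplin (w n.+1) (km (lcov F) (stab_hom G n))) (v := w n)) => a f v.
  by rewrite cmplinE lcov_kmE !wE stab_in_step.
have k1 x : k (el_sum stab_free u x) = x.
  apply: (dsum_ext (f := cmplin k (el_sum stab_free u)) (g := idlin _)) => -[a y] v.
  rewrite cmplinE el_sumE idlinE.
  move: y v; apply: sc_ind => n f v.
  by rewrite [X in k X](@stab_free_funE u a n f v) kP wE.
have k2 n y : el_sum stab_free u (w n y) = to_Finf (lcov F) n y.
  apply: (lcov_ext (u := cmplin (el_sum stab_free u) (w n)) (v := to_Finf (lcov F) n)) => a f v.
  by rewrite cmplinE wE el_sumE [LHS]stab_free_funE.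
split=> [x x0|]; first by rewrite -(k1 x) x0 linear0.
by apply: mc_ind => n y; exists (w n y); apply: k2.
Qed.

(** The same square as for [hcol_lcov_bij], with the action of [G_oo] on the colimit sets in place
    of the coslices. *)
Theorem stable_aug_lcov_bij m : lbij (hmap m (stable_aug (lcov F))).
Proof.
have sq z : hmap m (stable_aug (lcov F)) (hmap m stab_free z) =
    hmap m (free_kmor Gc F) (hmap m (kpull_mor (elG_tag) (tag_kfun F Gc)) z).
  rewrite -!hmap_comp; apply: (@hmap_nat K _ _ _ _
    (fcomp (functor_id Gc) (el_proj base_act1 base_actM))
    (fcomp (tag_proj nat Gc) elG_tag) (fun p => idm Gc (projT1 p))).
    by move=> p q f; rewrite /= mul1g mulg1.
  move=> [u [a x]] v; move: x v; apply: sc_ind => n f v; symmetry.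
  rewrite -[LHS]/(stable_aug_fun (lcov F) (stab_free_fun (existT base_set u (existT _ a (stab_in f))) v)).
  rewrite stab_free_funE stable_aug_funE; exact: colim_lcov_in.
have [ai as_] := hmap_el_bij m stab_free_good; have [bi bs] := hmap_el_bij m (@free_good K _ _ Gc UG F).
have [ci cs] := elG_tag_bij F m.
split=> [y|y].
  by have [z <-] := as_ y; rewrite sq => /bi/ci ->; rewrite linear0.
have [x <-] := bs y; have [z <-] := cs x.
by exists (hmap m stab_free z); rewrite sq.
Qed.
End FreeStable.
End StableFree.

(** * The comparison map *)

Section StableComparison.
Variable G : bsm_groupoid addn 0%N.
Local Notation UG := (quillen G).
Local Notation Gc := (group_cat (Ginf G)).
Hypothesis stab_inj : forall a b : nat, injective (fun f : mor G a a => mt G f (idm G b)).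
Hypothesis no_hom : forall a b : nat, mor G a b -> a = b.
Variable K : fieldType.
Implicit Type F : kfun K UG.

(** The morphism [(1, stab_hom G n)] is a natural transformation from [Psi_functor n] to the
    composite of [Psi_functor n.+1] with stabilisation. *)
Lemma Psi_mor_step m F n z :
  hmap m (Psi_mor F n.+1) (hmap m (stage_s F n) z) = hmap m (Psi_mor F n) z.
Proof.
rewrite -hmap_comp; symmetry.
apply: (@hmap_nat K _ _ _ _ (Psi_functor G n) (fcomp (Psi_functor G n.+1)
  (@ifunctor unit (group_cat (aut G n)) (group_cat (aut G n.+1)) (fun _ _ => stab_aut G n)
    (fun _ => gc_s1 (stab_aut G) n) (fun _ _ _ => @stab_autM G n)))
  (fun _ => (1%g, stab_hom G n) : mor (cat_prod Gc UG) (tt, n) (tt, n.+1))) => //.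
move=> a b f; congr pair; last exact: stab_homN.
by rewrite /= mul1g mulg1; symmetry; apply: gc_in_step.
Qed.

Lemma hPsi_exists m F : exists f : {linear homol m (Finf F) -> homol m (ext_pull Gc F)},
  forall n z, f (hmap m (stage_t F n) z) = hmap m (Psi_mor F n) z.
Proof. apply: (mcsys_lift (stage_mcsys stab_inj F m)) => n z; exact: Psi_mor_step. Qed.

Definition hPsi m F := sval (cid (hPsi_exists m F)).

Lemma hPsiE m F n z : hPsi m F (hmap m (stage_t F n) z) = hmap m (Psi_mor F n) z.
Proof. by rewrite /hPsi; case: cid => f /= ->. Qed.

Lemma h_Finf_ind m F (P : homol m (Finf F) -> Prop) :
  (forall n z, P (hmap m (stage_t F n) z)) -> forall y, P y.
Proof.
by move=> Pt y; have [_ ts _] := stage_mcsys stab_inj F m; have [n [z <-]] := ts y.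
Qed.

Lemma hcol_hPsi m F y : hcol Gc m F (hPsi m F y) = hmap m (stable_aug F) y.
Proof.
move: y; apply: h_Finf_ind => n z; rewrite hPsiE /hcol -!hmap_comp.
apply: (@hmap_nat K _ _ _ _ (fcomp (proj1_functor Gc UG) (Psi_functor G n))
  (fcomp (functor_id Gc) (@ifunctor unit (group_cat (aut G n)) (group_cat (Ginf G))
  (fun _ _ => @to_Ginf G n) (fun _ => gc_in1 (stab_aut G) n) (fun _ _ _ => @gc_inM _ (stab_aut G) n)))
  (fun _ => 1%g : mor Gc _ _)).
  by move=> a b f; rewrite /= mul1g mulg1.
by move=> a x; apply: stable_aug_funE.
Qed.

Lemma Finf_nat_stage m F F' (t : knat F F') n z :
  hmap m (Finf_nat t) (hmap m (stage_t F n) z) =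
  hmap m (stage_t F' n) (hmap m (kpull_nat (aut_functor G n) t) z).
Proof.
rewrite -!hmap_comp; set phi := ifunctor _ _.
apply: (@hmap_nat K _ _ _ _ (fcomp (functor_id Gc) phi) (fcomp phi (functor_id _))
  (fun _ => 1%g : mor Gc _ _)).
  by move=> a b f; rewrite /= mul1g mulg1.
move=> a x; rewrite [RHS](Finf_act1 (F := F')); symmetry; exact: Finf_nat_funE.
Qed.

Lemma Psi_mor_nat m F F' (t : knat F F') n z :
  hmap m (ext_nat Gc t) (hmap m (Psi_mor F n) z) =
  hmap m (Psi_mor F' n) (hmap m (kpull_nat (aut_functor G n) t) z).
Proof.
rewrite -!hmap_comp.
apply: (@hmap_nat K _ _ _ _ (fcomp (functor_id (cat_prod Gc UG)) (Psi_functor G n))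
  (fcomp (Psi_functor G n) (functor_id _)) (fun _ => idm (cat_prod Gc UG) (tt, n))).
  by move=> a b f; rewrite [LHS]cmp1m [RHS]cmpm1.
by move=> a x; rewrite [RHS]km1.
Qed.

Lemma hPsi_nat m F F' (t : knat F F') y :
  hPsi m F' (hmap m (Finf_nat t) y) = hmap m (ext_nat Gc t) (hPsi m F y).
Proof.
move: y; apply: h_Finf_ind => n z.
by rewrite Finf_nat_stage hPsiE -Psi_mor_nat; congr (hmap _ _ _); rewrite hPsiE.
Qed.

Lemma Finf_kses F F' F'' (i : knat F F') (q : knat F' F'') :
  kses i q -> kses (Finf_nat i) (Finf_nat q).
Proof.
move=> S c; have E1 n x : Finf_nat i c (to_Finf F n x) = to_Finf F' n (i n x) by apply: Finf_nat_funE.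
have E2 n x : Finf_nat q c (to_Finf F' n x) = to_Finf F'' n (q n x) by apply: Finf_nat_funE.
have ev0 H n x : evz (fun n => km H (stab_hom G n)) x -> to_Finf H n x = 0.
  by elim=> [k|k {}x _ <-]; rewrite ?linear0 // to_Finf_step.
split.
- apply: (mc_ind (P := fun x => Finf_nat i c x = 0 -> x = 0)) => n x x0.
  have /mc_in_evz : to_Finf F' n (i n x) = 0 := etrans (esym (E1 n x)) x0.
  move vE : (i n x) => v ev; elim: ev x {x0} vE => [k|k {}v _ IH] x vE.
    by have [ii _ _] := S k; rewrite (ii _ vE) linear0.
  by rewrite -[LHS]to_Finf_step; apply: IH; rewrite (kaN i) vE.
- apply: (mc_ind (P := fun y => Finf_nat q c y = 0 <-> exists x, Finf_nat i c x = y)) => n b; split.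
    move=> b0; have /mc_in_evz : to_Finf F'' n (q n b) = 0 := etrans (esym (E2 n b)) b0.
    move vE : (q n b) => v ev; elim: ev b {b0} vE => [k|k {}v _ IH] b vE.
      have [_ iq _] := S k; have [x <-] := (iq b).1 vE.
      by exists (to_Finf F k x).
    have [|x xE] := IH (km F' (stab_hom G k) b); first by rewrite (kaN q) vE.
    by exists x; rewrite xE; apply: to_Finf_step.
  move=> [x <-]; move: x.
  apply: (mc_ind (P := fun x => Finf_nat q c (Finf_nat i c x) = 0)) => k x.
  rewrite [X in Finf_nat q c X](E1 k x) [LHS]E2 (_ : q k _ = 0) ?linear0//.
  by have [_ iq _] := S k; apply/iq; exists x.
- apply: (mc_ind (P := fun y => exists x, Finf_nat q c x = y)) => n y.
  have [_ _ qs] := S n; have [x <-] := qs y.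
  by exists (to_Finf F' n x); apply: E2.
Qed.

Definition Finf_lomega_kses F := Finf_kses (lomega_kses_F F).

(** [hPsi] is defined as a map out of a colimit and not by a functor on [G_oo], so [delta_nat] is
    applied at the finite stages, to [Psi_mor] and to [stage_t]. *)
Lemma hPsi_delta m F y :
  ext_delta Gc m F (hPsi m.+1 F y) = hPsi m (lomega F) (delta m (Finf_lomega_kses F) y).
Proof.
move: y; apply: h_Finf_ind => n z.
have Sn : kses (kpull_nat (aut_functor G n) (lomega_in F)) (kpull_nat (aut_functor G n) (leps F)).
  by move=> c; apply: (lomega_kses_F F).
rewrite hPsiE (@delta_nat K _ _ _ _ _ m _ _ _ _ _ Sn _ _ _ _ _ (ext_lomega_kses Gc F)
  (Psi_mor (lomega F) n) (Psi_mor (lcov F) n) (Psi_mor F n)) //.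
rewrite (@delta_nat K _ _ _ _ _ m _ _ _ _ _ Sn _ _ _ _ _ (Finf_lomega_kses F)
  (stage_t (lomega F) n) (stage_t (lcov F) n) (stage_t F n)) ?hPsiE //.
  by move=> a x; symmetry; apply: Finf_nat_funE.
by move=> a x; symmetry; apply: Finf_nat_funE.
Qed.

Lemma hPsi_lcov_bij m F : lbij (hPsi m (lcov F)).
Proof.
have [ai as_] := stable_aug_lcov_bij stab_inj no_hom F m.
have [bi bs] := hcol_lcov_bij Gc F m.
split=> [y y0|y]; first by apply: ai; rewrite -hcol_hPsi y0 linear0.
have [x xE] := as_ (hcol Gc m (lcov F) y); exists x.
by apply: (linj_eq bi); rewrite hcol_hPsi.
Qed.

Lemma hPsi_bij m F : lbij (hPsi m F).
Proof.
(* Injectivity for a functor uses surjectivity for its syzygy in the same degree, so in each degree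
   surjectivity is proved first, for all functors. *)
have inj_cover k (F0 : kfun K UG) l : lsurj (hPsi k (lomega F0)) ->
    hPsi k F0 (hmap k (Finf_nat (leps F0)) l) = 0 -> hmap k (Finf_nat (leps F0)) l = 0.
  move=> os; rewrite hPsi_nat => /(kses_h_lexactB (ext_lomega_kses Gc F0))[w wl].
  have [w' w'E] := os w; apply/(kses_h_lexactB (Finf_lomega_kses F0)); exists w'.
  by apply: (linj_eq (hPsi_lcov_bij k F0).1); rewrite hPsi_nat w'E.
elim: m F => [|m IH] F.
  have surj0 F0 : lsurj (hPsi 0 F0).
    move=> y; have [l <-] := kses_h_lsurj (ext_lomega_kses Gc F0) y.
    have [l' <-] := (hPsi_lcov_bij 0 F0).2 l.
    by exists (hmap 0 (Finf_nat (leps F0)) l'); rewrite hPsi_nat.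
  split=> // y; have [l <-] := kses_h_lsurj (Finf_lomega_kses F) y.
  exact: inj_cover.
have surjS F0 : lsurj (hPsi m.+1 F0).
  move=> y; have [e eE] := (IH (lomega F0)).2 (ext_delta Gc m F0 y).
  have [x xE] : exists x, delta m (Finf_lomega_kses F0) x = e.
    apply/(kses_h_lexactA (Finf_lomega_kses F0)); apply: (hPsi_lcov_bij m F0).1.
    rewrite hPsi_nat eE; apply/(kses_h_lexactA (ext_lomega_kses Gc F0)); by exists y.
  have [l lE] : exists l, hmap m.+1 (ext_nat Gc (leps F0)) l = y - hPsi m.+1 F0 x.
    apply/(kses_h_lexactD (ext_lomega_kses Gc F0)).
    by rewrite linearB -/(ext_delta Gc m F0 _) -[X in _ - X]/(ext_delta Gc m F0 _) hPsi_delta xE eE subrr.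
  have [l' l'E] := (hPsi_lcov_bij m.+1 F0).2 l.
  exists (x + hmap m.+1 (Finf_nat (leps F0)) l').
  by rewrite linearD hPsi_nat l'E lE addrC subrK.
split=> // y y0.
have [l lE] : exists l, hmap m.+1 (Finf_nat (leps F)) l = y.
  apply/(kses_h_lexactD (Finf_lomega_kses F)); apply: (IH (lomega F)).1.
  by rewrite -hPsi_delta y0 linear0.
by rewrite -lE; apply: inj_cover; rewrite ?lE.
Qed.
End StableComparison.

(** * Coordinates on finite direct sums *)

Section DsumProjection.
Variables (K : fieldType) (I : Type).
Implicit Types M N : I -> lmodType K.

Definition dproj_fun M p j : {linear M j -> M p} :=
  match pselect (j = p) with left e => kcast M e | right _ => zerolin (M j) (M p) end.

Definition dproj M p : {linear dsum M -> M p} := dsum_lift (dproj_fun M p).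

Lemma dproj_in M p x : dproj M p (dsum_in M p x) = x.
Proof.
rewrite [LHS]dsum_liftE /dproj_fun; case: pselect => // e.
exact: kcast_id.
Qed.

Lemma dproj_in0 M p j x : j <> p -> dproj M p (dsum_in M j x) = 0.
Proof. by move=> jp; rewrite [LHS]dsum_liftE /dproj_fun; case: pselect. Qed.

Lemma dproj_map M N (f : forall i, {linear M i -> N i}) p u :
  dproj N p (dsum_map f u) = f p (dproj M p u).
Proof.
move: u; apply: (dsum_ext (f := cmplin (dproj N p) (dsum_map f)) (g := cmplin (f p) (dproj M p))).
move=> i x; rewrite !cmplinE dsum_mapE; have [e|ne] := pselect (i = p).
  by subst p; rewrite !dproj_in.
by rewrite !dproj_in0 // linear0.
Qed.

Variables (n : nat) (mk : 'I_n -> I).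
Hypothesis mkI : injective mk.
Hypothesis mkS : forall p, exists i, mk i = p.

Lemma dproj_sum M (w : forall p, M p) p :
  dproj M p (\sum_(i < n) dsum_in M (mk i) (w (mk i))) = w p.
Proof.
have [i0 <-] := mkS p; rewrite linear_sum (bigD1 i0) // -[RHS]addr0; congr (_ + _); first exact: dproj_in.
by apply: big1 => i /andP[_ ne]; apply: dproj_in0 => /mkI e; rewrite e eqxx in ne.
Qed.

Lemma dproj_eq0 M u : (forall p, dproj M p u = 0) -> u = 0.
Proof.
pose S v := \sum_(i < n) dsum_in M (mk i) (dproj M (mk i) v).
have SL : linear S.
  move=> a x y; rewrite /S scaler_sumr -big_split; apply: eq_bigr => i _.
  by rewrite !linearP.
have SE v : S v = v.
  move: v; apply: (dsum_ext (f := mklin SL) (g := idlin _)) => j x.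
  rewrite idlinE -[LHS]/(S (dsum_in M j x)) /S; have [i0 ji] := mkS j; subst j.
  rewrite (bigD1 i0) // -[RHS]addr0; congr (_ + _); first by rewrite dproj_in.
  apply: big1 => i /andP[_ ne]; rewrite dproj_in0 ?linear0 // => /mkI e.
  by rewrite e eqxx in ne.
by move=> u0; rewrite -(SE u) /S big1 // => i _; rewrite u0 linear0.
Qed.
End DsumProjection.

Section KunnethIndex.
Variable m : nat.

Lemma kunneth_mk_subproof (i : 'I_m.+1) : ((m - i, i)%N.1 + (m - i, i)%N.2)%N = m.
Proof. by rewrite /= subnK // -ltnS. Qed.

Definition kunneth_mk (i : 'I_m.+1) : kunneth_index m :=
  exist (fun p : nat * nat => (p.1 + p.2)%N = m) (m - i, nat_of_ord i)%N (kunneth_mk_subproof i).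

Lemma kunneth_mk_inj : injective kunneth_mk.
Proof. by move=> i j /(congr1 (fun p => (sval p).2)) /= e; apply: val_inj. Qed.

Lemma kunneth_mk_surj p : exists i, kunneth_mk i = p.
Proof.
case: p => -[k l] /= e; have lm : (l < m.+1)%N by rewrite ltnS -e leq_addl.
have ke : (m - l)%N = k by rewrite -e addnK.
exists (Ordinal lm); rewrite /kunneth_mk; move: (kunneth_mk_subproof _) => /= e'.
subst k; congr exist; exact: Prop_irrelevance.
Qed.
End KunnethIndex.

Section TensorBijection.
Variable K : fieldType.

Lemma tensor_map_lbij (U U' V V' : lmodType K) (f : {linear U -> U'}) (g : {linear V -> V'}) :
  lbij f -> lbij g -> lbij (tensor_map f g).
Proof.
move=> /linv_exists[f' [f1 f2]] /linv_exists[g' [g1 g2]].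
have k1 x : tensor_map f' g' (tensor_map f g x) = x.
  apply: (tensor_ext (f := cmplin (tensor_map f' g') (tensor_map f g)) (g := idlin _)) => u v.
  by rewrite cmplinE !tensor_mapE f1 g1.
have k2 y : tensor_map f g (tensor_map f' g' y) = y.
  apply: (tensor_ext (f := cmplin (tensor_map f g) (tensor_map f' g')) (g := idlin _)) => u v.
  by rewrite cmplinE !tensor_mapE f2 g2.
split=> [x x0|y]; first by rewrite -(k1 x) x0 linear0.
by exists (tensor_map f' g' y).
Qed.

Lemma scalel_subproof (V : lmodType K) (v : V) : linear (fun c : K^o => c *: v).
Proof. by move=> a x y; rewrite scalerDl scalerA. Qed.
Definition scalel (V : lmodType K) (v : V) : {linear (K^o : lmodType K) -> V} :=
  mklin (scalel_subproof v).

Variables (O : Type) (C : category O).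

Definition scale_nat (V : lmodType K) (v : V) : knat (kconst C (K^o : lmodType K)) (kconst C V) :=
  const_map C (scalel v).

Lemma scale_klinear V : klinear (@scale_nat V).
Proof. by move=> a u v c x; rewrite /= scalerDr !scalerA mulrC. Qed.

(** At each object this is the isomorphism of [tensor K V] with [V], inverse to [tens 1]. *)
Lemma scale_good V : ktensor_good (@scale_klinear V).
Proof.
move=> c; have E x : tens (1 : K^o) (ktensor (@scale_klinear V) c x) = x.
  move: x; apply: (tensor_ext (f := cmplin (tensr V (1 : (K^o : lmodType K))) (ktensor (@scale_klinear V) c))
    (g := idlin _)) => x v.
  rewrite cmplinE (ktensorE (@scale_klinear V)).
  transitivity (x *: tens (1 : (K^o : lmodType K)) v).
    exact: (linearZ_LR (tensr V (1 : (K^o : lmodType K))) (x : K) v).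
  exact: (etrans (esym (linearZ_LR (tensl (K^o : lmodType K) v) (x : K) (1 : K^o)))
    (congr1 (fun y : (K^o : lmodType K) => tens y v) (mulr1 (x : K)))).
split=> [x x0|y]; first by rewrite -(E x) x0; apply: (linear0 (tensr V (1 : (K^o : lmodType K)))).
by exists (tens (1 : K^o) y); rewrite ktensorE /= scale1r.
Qed.

Definition hscale n (V : lmodType K) :
    {linear tensor (homol n (kconst C (K^o : lmodType K))) V -> homol n (kconst C V)} :=
  htensor (@scale_klinear V) n.

Lemma hscale_lbij n V : lbij (hscale n V).
Proof. exact/htensor_bij/scale_good. Qed.

Lemma hscale_nat n (V W : lmodType K) (f : {linear V -> W}) x :
  hscale n W (tensor_map (idlin _) f x) = hconst C n f (hscale n V x).
Proof.
move: x; apply: (tensor_ext (f := cmplin (hscale n W) (tensor_map (idlin _) f))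
  (g := cmplin (hconst C n f) (hscale n V))) => z v.
rewrite !cmplinE tensor_mapE !htensorE; apply: hconst_comp => c.
by rewrite /= linearZ.
Qed.
End TensorBijection.

(** * Transport between [homol] and [cat_homology] *)

Section Transport.
Variable K : fieldType.

Lemma hiso_exists n : exists b : forall O (C : category O) (F : kfun K C), {linear homol n F -> cat_homology F n},
  (forall O (C : category O) (F : kfun K C), lbij (b _ _ F)) /\
  (forall O O' (C : category O) (D : category O') (phi : functor C D) (F : kfun K C)
     (H : kfun K D) (t : kmor phi F H) x, b _ _ H (hmap n t x) = cat_homology_map t n (b _ _ F x)).
Proof. exact: cat_homology_natiso. Qed.

Definition hiso n := sval (cid (hiso_exists n)).
Lemma hiso_lbij n O (C : category O) (F : kfun K C) : lbij (hiso n F).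
Proof. by rewrite /hiso; case: cid => b [bb bN]. Qed.
Lemma hiso_nat n O O' (C : category O) (D : category O') (phi : functor C D) (F : kfun K C)
  (H : kfun K D) (t : kmor phi F H) x : hiso n H (hmap n t x) = cat_homology_map t n (hiso n F x).
Proof. by rewrite /hiso; case: cid => b [bb bN]; apply: bN. Qed.

Definition hinv n O (C : category O) (F : kfun K C) : {linear cat_homology F n -> homol n F} :=
  sval (cid (linv_exists (hiso_lbij n F))).
Lemma hinvK n O (C : category O) (F : kfun K C) x : hinv n F (hiso n F x) = x.
Proof. by rewrite /hinv; case: cid => g [gl gr]; apply: gl. Qed.
Lemma hisoK n O (C : category O) (F : kfun K C) x : hiso n F (hinv n F x) = x.
Proof. by rewrite /hinv; case: cid => g [gl gr]; apply: gr. Qed.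
Lemma hinv_lbij n O (C : category O) (F : kfun K C) : lbij (hinv n F).
Proof.
exact: (lbij_of_inv (g := hiso n F) (@hisoK _ _ _ _) (@hinvK _ _ _ _)).
Qed.
Lemma hinv_nat n O O' (C : category O) (D : category O') (phi : functor C D) (F : kfun K C)
  (H : kfun K D) (t : kmor phi F H) x : hinv n H (cat_homology_map t n x) = hmap n t (hinv n F x).
Proof. by rewrite -{1}(hisoK x) -hiso_nat hinvK. Qed.
End Transport.

Lemma lbij_bijective (K : fieldType) (U V : lmodType K) (f : {linear U -> V}) : lbij f -> bijective f.
Proof. by move=> /linv_exists[g [gl gr]]; exists g. Qed.

(** * The Kuenneth isomorphism and the conclusion *)

Section Final.
Variable G : bsm_groupoid addn 0%N.
Local Notation UG := (quillen G).
Local Notation Gc := (group_cat (Ginf G)).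
Variable K : fieldType.
Implicit Type F : kfun K UG.

Lemma kunneth_sym m (p : kunneth_index m) : ((sval p).2 + (sval p).1)%N = m.
Proof. by rewrite addnC (svalP p). Qed.

Definition kunneth_comp F m (p : kunneth_index m) :
    {linear kunneth_term F p -> homol (sval p).1 (kconst Gc (homol (sval p).2 F))} :=
  cmplin (hscale Gc (sval p).1 (homol (sval p).2 F))
    (tensor_map (hinv (sval p).1 (kconst Gc (K^o : lmodType K))) (hinv (sval p).2 F)).

Lemma kunneth_comp_lbij F m (p : kunneth_index m) : lbij (kunneth_comp F p).
Proof.
have [ai as_] := hscale_lbij Gc (sval p).1 (homol (sval p).2 F).
have [bi bs] := tensor_map_lbij (hinv_lbij (sval p).1 (kconst Gc (K^o : lmodType K)))
  (hinv_lbij (sval p).2 F).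
split=> [x /ai/bi//|y]; have [z <-] := as_ y; have [x <-] := bs z.
by exists x.
Qed.

Lemma kunneth_comp_nat F F' (t : knat F F') m (p : kunneth_index m) x :
  kunneth_comp F' p (tensor_map (idlin _) (cat_homology_map t (sval p).2) x) =
  hconst Gc (sval p).1 (hmap (sval p).2 t) (kunneth_comp F p x).
Proof.
rewrite /kunneth_comp !cmplinE -hscale_nat; congr (hscale _ _ _ _).
move: x; apply: (tensor_ext (f := cmplin (tensor_map _ _) (tensor_map _ _))
  (g := cmplin (tensor_map _ _) (tensor_map _ _))) => u v.
by rewrite !cmplinE !tensor_mapE hinv_nat.
Qed.

Definition kunneth_coord F m (p : kunneth_index m) :
    {linear kunneth F m -> homol (sval p).1 (kconst Gc (homol (sval p).2 F))} :=
  cmplin (kunneth_comp F p) (dproj (@kunneth_term G K F m) p).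

(** The isomorphism is specified by its coordinates, so that its naturality reduces to that of each
    coordinate. *)
Definition kunneth_rel F m (y : homol m (ext_pull Gc F)) (u : kunneth F m) :=
  forall p : kunneth_index m,
    kunneth_coord F p u = hcompc Gc (kunneth_sym p) F y.

Lemma kunneth_iso_exists F m : exists f : {linear homol m (ext_pull Gc F) -> kunneth F m},
  forall y u, kunneth_rel y u <-> f y = u.
Proof.
apply: lin_of_rel => [a y y' u u' yu yu' p|y|u u0].
- by rewrite [LHS](linearP (kunneth_coord F p) a u u') yu yu' [RHS]linearP.
- have ex p := (kunneth_comp_lbij F p).2 (hcompc Gc (kunneth_sym p) F y).
  pose w p := sval (cid (ex p)).
  have wP p : kunneth_comp F p (w p) = hcompc Gc (kunneth_sym p) F y by rewrite /w; case: cid.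
  exists (\sum_(i < m.+1) dsum_in (@kunneth_term G K F m) (kunneth_mk i) (w (kunneth_mk i))) => p.
  by rewrite -wP [LHS]cmplinE (dproj_sum (@kunneth_mk_inj m) (@kunneth_mk_surj m)).
- apply: (dproj_eq0 (@kunneth_mk_inj m) (@kunneth_mk_surj m)) => p.
  by apply: (kunneth_comp_lbij F p).1; apply: etrans (u0 p) (linear0 _).
Qed.

Definition kunneth_iso F m := sval (cid (kunneth_iso_exists F m)).
Lemma kunneth_isoP F m y u : kunneth_rel y u <-> kunneth_iso F m y = u.
Proof. by rewrite /kunneth_iso; case: cid => f fP; apply: fP. Qed.

Lemma kunneth_iso_lbij F m : lbij (kunneth_iso F m).
Proof.
split=> [y /kunneth_isoP y0|u].
  apply: hcompc_inj => l k e; have e' : (k + l)%N = m by rewrite addnC.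
  have := y0 (exist (fun p : nat * nat => (p.1 + p.2)%N = m) (k, l) e').
  rewrite [X in X = _](linear0 (kunneth_coord F _)) => /esym E.
  by rewrite -{}E; congr (hcompc _ _ _ _); apply: Prop_irrelevance.
pose ix l k (e : (l + k)%N = m) : kunneth_index m :=
  exist (fun p : nat * nat => (p.1 + p.2)%N = m) (k, l) (etrans (addnC k l) e).
have [y yE] := @hcompc_surj K _ _ Gc UG m F (fun l k e => kunneth_coord F (ix l k e) u).
exists y; apply/kunneth_isoP => -[[k l] e].
have E (e' : (l + k)%N = m) : kunneth_coord F (exist _ (k, l) e) u = hcompc Gc e' F y.
  rewrite (Prop_irrelevance e (etrans (addnC k l) e')); exact: esym (yE l k e').
exact: (E (kunneth_sym (exist _ (k, l) e))).
Qed.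

Lemma kunneth_iso_nat F F' (t : knat F F') m y :
  kunneth_iso F' m (hmap m (ext_nat Gc t) y) = kunneth_map t m (kunneth_iso F m y).
Proof.
apply/kunneth_isoP => p; rewrite hcompc_nat.
have -> : hcompc Gc (kunneth_sym p) F y = kunneth_coord F p (kunneth_iso F m y).
  by symmetry; move: p; apply/kunneth_isoP.
rewrite [LHS]cmplinE [X in kunneth_comp _ _ X](dproj_map _ p (kunneth_iso F m y)).
exact: kunneth_comp_nat.
Qed.
End Final.

Theorem theorem3p2 (K : fieldType) (G : bsm_groupoid addn 0%N)
  (no_hom : forall a b : nat, mor G a b -> a = b)
  (no_zero_div : forall a b : nat,
     isomorphic G (a + b)%N 0%N <-> isomorphic G a 0%N /\ isomorphic G b 0%N)
  (aut0 : forall f : mor G 0%N 0%N, f = idm G 0%N)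
  (cancellation : forall a b c : nat,
     isomorphic G (a + c)%N (b + c)%N -> isomorphic G a b)
  (stab_inj : forall a b : nat,
     injective (fun f : mor G a a => mt G f (idm G b))) :
  exists Psi : forall (F : kfun K (quillen G)) (m : nat),
      {linear cat_homology (Finf F) m -> cat_homology (Pi_pull F) m},
    (forall F m,
       induced_by_Psi_n (Psi F m) /\
       (forall Psi' : {linear cat_homology (Finf F) m -> cat_homology (Pi_pull F) m},
          induced_by_Psi_n Psi' -> forall x, Psi' x = Psi F m x)) /\
    (forall F m, bijective (Psi F m)) /\
    exists kappa : forall (F : kfun K (quillen G)) (m : nat),
        {linear cat_homology (Pi_pull F) m -> kunneth F m},
      (forall F m, bijective (fun x => kappa F m (Psi F m x))) /\
      (forall (F F' : kfun K (quillen G)) (t : knat F F') (m : nat)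
          (x : cat_homology (Finf F) m),
         kappa F' m (Psi F' m (stable_map t m x)) =
         kunneth_map t m (kappa F m (Psi F m x))).
Proof.
pose psi (F : kfun K (quillen G)) m := hPsi stab_inj m F.
pose Psi F m := cmplin (hiso m (Pi_pull F)) (cmplin (psi F m) (hinv m (Finf F))).
have PsiE F m x : Psi F m x = hiso m (Pi_pull F) (psi F m (hinv m (Finf F) x)) by [].
have Psi_ind F m : induced_by_Psi_n (Psi F m).
  move=> n x; rewrite PsiE /to_stable /Psi_n hinv_nat -stage_t_to_stable.
  by rewrite /psi hPsiE hiso_nat hisoK.
exists Psi; split=> [F m|].
  (* Classes from the finite stages exhaust the homology of [G_oo], so the maps [Psi_n] determine
     the extension. *)
  split=> // Psi' Psi'E x; rewrite -(hisoK x).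
  move: (hinv m (Finf F) x); apply: (h_Finf_ind stab_inj) => n z.
  rewrite stage_t_to_stable hiso_nat -/(to_stable F n m _).
  by rewrite Psi'E Psi_ind.
have Psi_bij F m : lbij (Psi F m).
  have [pi_ ps] := hPsi_bij stab_inj no_hom m F.
  split=> [x x0|y]; last first.
    have [z zE] := ps (hinv m (Pi_pull F) y); exists (hiso m (Finf F) z).
    by rewrite PsiE hinvK /psi zE hisoK.
  by apply: (hinv_lbij m (Finf F)).1; apply: pi_; apply: (hiso_lbij m (Pi_pull F)).1.
split=> [F m|]; first exact: lbij_bijective.
exists (fun F m => cmplin (kunneth_iso F m) (hinv m (Pi_pull F))); split=> [F m|F F' t m x].
  apply: (lbij_bijective (f := cmplin (cmplin (kunneth_iso F m) (hinv m (Pi_pull F))) (Psi F m))).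
  have [ai as_] := Psi_bij F m; have [bi bs] := hinv_lbij m (Pi_pull F).
  have [ci cs] := kunneth_iso_lbij F m.
  split=> [x /ci/bi/ai//|u]; have [y <-] := cs u; have [z <-] := bs y; have [x <-] := as_ z.
  by exists x.
have kE F0 y : cmplin (kunneth_iso F0 m) (hinv m (Pi_pull F0)) (Psi F0 m y) =
    kunneth_iso F0 m (psi F0 m (hinv m (Finf F0) y)) by rewrite cmplinE PsiE hinvK.
rewrite [LHS]kE [X in kunneth_map t m X]kE /stable_map hinv_nat /psi hPsi_nat.
exact: kunneth_iso_nat.
Qed.
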